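(* Consider the hardware-impaired uplink model described in the context, with data transmitted at full power. If the maximum ratio combining (MRC) filter $\mathbf{v}_{jk}(t)=\hat{\mathbf{h}}_{jjk}(t)$ is used at a channel use $t\in\{B+1,\ldots,T\}$, then for all $j,k$ and all $l,m$ $$\mathbb{E}\{\|\mathbf{v}_{jk}(t)\|^2\}=N\lambda_{jjk}^2\,\tilde{\mathbf{x}}_{jk}^{H}\mathbf{D}_{\boldsymbol{\delta}(t)}\boldsymbol{\Psi}_j^{-1}\mathbf{D}_{\boldsymbol{\delta}(t)}^{H}\tilde{\mathbf{x}}_{jk},$$ $$\mathbb{E}\{\mathbf{v}_{jk}^{H}(t)\mathbf{h}_{jjk}(t)\}=\mathbb{E}\{\|\mathbf{v}_{jk}(t)\|^2\},$$ $$\begin{aligned}\mathbb{E}\{|\mathbf{v}_{jk}^{H}(t)\mathbf{h}_{jlm}(t)|^2\}=\;&\lambda_{jlm}\mathbb{E}\{\|\mathbf{v}_{jk}(t)\|^2\}+N\lambda_{jjk}^2\lambda_{jlm}^2\,\tilde{\mathbf{x}}_{jk}^{H}\mathbf{D}_{\boldsymbol{\delta}(t)}\boldsymbol{\Psi}_j^{-1}\mathbf{X}_{lm}\boldsymbol{\Psi}_j^{-1}\mathbf{D}_{\boldsymbol{\delta}(t)}^{H}\tilde{\mathbf{x}}_{jk}\\&+N(N-1)\lambda_{jjk}^2\lambda_{jlm}^2\,|\tilde{\mathbf{x}}_{jk}^{H}\mathbf{D}_{\boldsymbol{\delta}(t)}\boldsymbol{\Psi}_j^{-1}\mathbf{D}_{\boldsymbol{\delta}(t)}^{H}\tilde{\mathbf{x}}_{lm}|^2,\end{aligned}$$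 $$\begin{aligned}\mathbb{E}\{|\mathbf{v}_{jk}^{H}(t)\boldsymbol{\upsilon}_j(t)|^2\}=\;&\kappa^2\sum_{l=1}^{L}\sum_{m=1}^{K}p_{lm}\lambda_{jlm}\mathbb{E}\{\|\mathbf{v}_{jk}(t)\|^2\}\\&+\kappa^2\sum_{l=1}^{L}\sum_{m=1}^{K}p_{lm}N\lambda_{jjk}^2\lambda_{jlm}^2\,\tilde{\mathbf{x}}_{jk}^{H}\mathbf{D}_{\boldsymbol{\delta}(t)}\boldsymbol{\Psi}_j^{-1}\mathbf{X}_{lm}\boldsymbol{\Psi}_j^{-1}\mathbf{D}_{\boldsymbol{\delta}(t)}^{H}\tilde{\mathbf{x}}_{jk}.\end{aligned}$$
   Context: Model. There are $L\ge1$ cells, each with one base station (BS) having $N$ antennas and $K$ single-antenna users (UEs). A coherence block has $T$ channel uses $t\in\{1,\ldots,T\}$, the first $B\ge K$ of which are used for pilots and the remaining ones for data. The channel from UE $k$ in cell $l$ to BS $j$ is $\mathbf{h}_{jlk}=[h_{jlk}^{(1)}\ldots h_{jlk}^{(N)}]^T\sim\mathcal{CN}(\mathbf{0},\lambda_{jlk}\mathbf{I}_N)$ with $\lambda_{jlk}>0$ (circularly symmetric complex Gaussian), constant over the block; different channels are independent. Write $\mathbf{H}_{jl}=[\mathbf{h}_{jl1}\ldots\mathbf{h}_{jlK}]$. The signal received by BS $j$ at channel use $t$ is $$\mathbf{y}_j(t)=\mathbf{D}_{\boldsymbol{\phi}_j(t)}\sum_{l=1}^{L}\mathbf{H}_{jl}\mathbf{x}_l(t)+\boldsymbol{\upsilon}_j(t)+\boldsymbol{\eta}_j(t),$$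 where $\mathbf{x}_l(t)=[x_{l1}(t)\ldots x_{lK}(t)]^T$ are the transmit signals. For $t\le B$ the $x_{lk}(t)$ are deterministic pilot symbols with $|x_{lk}(t)|^2\le p_{lk}$, arbitrary otherwise; $\tilde{\mathbf{x}}_{lk}=[x_{lk}(1)\ldots x_{lk}(B)]^T$. For $t>B$ they are random data symbols with full power $\mathbb{E}\{|x_{lk}(t)|^2\}=p_{lk}$. The effective channel is $\mathbf{h}_{jlk}(t)=\mathbf{D}_{\boldsymbol{\phi}_j(t)}\mathbf{h}_{jlk}$. (1) Phase drift: $\mathbf{D}_{\boldsymbol{\phi}_j(t)}=\mathrm{diag}(e^{\imath\phi_{j1}(t)},\ldots,e^{\imath\phi_{jN}(t)})$, where $\imath$ is the imaginary unit and each $\phi_{jn}$ is a discrete-time Wiener process: $\phi_{jn}(t)$ equals $\phi_{jn}(t-1)$ plus an independent $\mathcal{N}(0,\delta)$ innovation, $\delta\ge0$; the processes are independent across antennas. (2) Distortion noise: conditionally on the channels, $\boldsymbol{\upsilon}_j(t)\sim\mathcal{CN}(\mathbf{0},\boldsymbol{\Upsilon}_j(t))$ with $\boldsymbol{\Upsilon}_j(t)=\kappa^2\sum_{l=1}^{L}\sum_{k=1}^{K}\mathbb{E}\{|x_{lk}(t)|^2\}\,\mathrm{diag}(|h_{jlk}^{(1)}|^2,\ldots,|h_{jlk}^{(N)}|^2)$, $\kappa\ge0$, independent between antennas and channel uses. (3) Receiver noise: $\boldsymbol{\eta}_j(t)\sim\mathcal{CN}(\mathbf{0},\sigma^2\xi\mathbf{I}_N)$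 with $\sigma^2>0$, $\xi\ge1$, independent over time. Channels, phase-drift processes and receiver noise are mutually independent, and given the channels the distortion noise is independent of the phase drifts and receiver noise. Channel estimate. With $\boldsymbol{\psi}_j=[\mathbf{y}_j^{T}(1)\ldots\mathbf{y}_j^{T}(B)]^{T}\in\mathbb{C}^{NB}$, $$\hat{\mathbf{h}}_{jlk}(t)=\left(\lambda_{jlk}\,\tilde{\mathbf{x}}_{lk}^{H}\mathbf{D}_{\boldsymbol{\delta}(t)}\boldsymbol{\Psi}_j^{-1}\otimes\mathbf{I}_N\right)\boldsymbol{\psi}_j,$$ where $\otimes$ is the Kronecker product, $\mathbf{D}_{\boldsymbol{\delta}(t)}=\mathrm{diag}(e^{-\frac{\delta}{2}(t-1)},\ldots,e^{-\frac{\delta}{2}(t-B)})$, $\boldsymbol{\Psi}_j=\sum_{\ell=1}^{L}\sum_{m=1}^{K}\lambda_{j\ell m}\mathbf{X}_{\ell m}+\sigma^2\xi\mathbf{I}_B$, and $\mathbf{X}_{\ell m}\in\mathbb{C}^{B\times B}$ has entries $[\mathbf{X}_{\ell m}]_{i,i}=|x_{\ell m}(i)|^2(1+\kappa^2)$ and $[\mathbf{X}_{\ell m}]_{i_1,i_2}=x_{\ell m}(i_1)x_{\ell m}^*(i_2)e^{-\frac{\delta}{2}|i_1-i_2|}$ for $i_1\ne i_2$. $(\cdot)^H$ denotes conjugate transpose. *)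

(* Defs.v *)
From HB Require Import structures.
From mathcomp Require Import all_boot all_order all_algebra.
From mathcomp Require Import all_classical all_reals all_analysis.
From mathcomp Require Import measurable_realfun.
From mathcomp.real_closed Require Import complex mxtens.

Set Implicit Arguments.
Unset Strict Implicit.
Unset Printing Implicit Defensive.

Import Order.TTheory GRing.Theory Num.Theory.
Import numFieldNormedType.Exports.

Local Open Scope classical_set_scope.
Local Open Scope ring_scope.
Local Open Scope sesquilinear_scope.
Local Open Scope complex_scope.

(* R[i] carries no sigma-algebra in the library: events about complex random
   variables are pulled back from R * R. *)
Definition reim (R : realType) (z : R[i]) : measurableTypeR R * measurableTypeR R :=
  (complex.Re z, complex.Im z).

Definition cis (R : realType) (x : R) : R[i] := cos x +i* sin x.

Definition norm2sq (R : realType) (n : nat) (v : 'cV[R[i]]_n) : R[i] :=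
  \sum_i `|v i 0| ^+ 2.

Section Probability.
Context (R : realType) (d : measure_display) (Omega : measurableType d).
Variable P : probability Omega R.

Definition cintegrable (X : Omega -> R[i]) : Prop :=
  P.-integrable setT (fun w => (complex.Re (X w))%:E) /\
  P.-integrable setT (fun w => (complex.Im (X w))%:E).

Definition cexpect (X : Omega -> R[i]) : R[i] :=
  fine (expectation P (fun w => complex.Re (X w))) +i*
  fine (expectation P (fun w => complex.Im (X w))).

Definition has_cexpect (X : Omega -> R[i]) (z : R[i]) : Prop :=
  cintegrable X /\ cexpect X = z.

(* The sigma-algebra on Omega generated by the family (X i)_i. *)
Definition sigma_of (I : Type) (d' : measure_display) (S : measurableType d')
    (X : I -> Omega -> S) : set (set Omega) :=
  <<s \bigcup_(i in [set: I]) preimage_set_system setT (X i) measurable >>.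

(* Used with sigma-algebras F i only, so that taking E i = setT for some of the
   i's yields the product rule for every subfamily. *)
Definition mutual_indep (I : finType) (F : I -> set (set Omega)) : Prop :=
  forall E : I -> set Omega, (forall i, F i (E i)) ->
    P (\bigcap_(i in [set: I]) E i) = (\prod_i P (E i))%E.

(* f is a version of the conditional probability P(E | G). *)
Definition cond_prob (G : set (set Omega)) (E : set Omega) (f : Omega -> \bar R) : Prop :=
  (forall Y : set (\bar R), measurable Y -> G (f @^-1` Y)) /\
  (forall A, G A -> (\int[P]_(w in A) f w)%E = P (A `&` E)).

Definition cond_indep (G F1 F2 : set (set Omega)) : Prop :=
  forall E1 E2 f1 f2, F1 E1 -> F2 E2 ->
    cond_prob G E1 f1 -> cond_prob G E2 f2 ->
    cond_prob G (E1 `&` E2) (fun w => (f1 w * f2 w)%E).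

(* N(0, v), with variance v.  The library's [normal_prob] takes the standard
   deviation and is not the point mass when that is 0. *)
Definition gauss (v : R) : probability (measurableTypeR R) R :=
  if v == 0 then (dirac (0 : measurableTypeR R) : probability _ R)
  else (normal_prob 0 (Num.sqrt v) : probability _ R).

(* CN(0, v): the real and imaginary parts are i.i.d. N(0, v / 2). *)
Definition cgauss (v : R) : set (measurableTypeR R * measurableTypeR R) -> \bar R :=
  (gauss (v / 2) \x gauss (v / 2))%E.

Definition has_law (d' : measure_display) (S : measurableType d')
    (X : Omega -> S) (mu : set S -> \bar R) : Prop :=
  forall D, measurable D -> P (X @^-1` D) = mu D.

(* X ~ CN(0, v I_n). *)
Definition cgauss_vec (n : nat) (X : Omega -> 'cV[R[i]]_n) (v : R) : Prop :=
  (forall i, has_law (fun w => reim (X w i 0)) (cgauss v)) /\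
  mutual_indep (fun i : 'I_n => sigma_of (fun (_ : unit) w => reim (X w i 0))).

End Probability.

(* L cells, K users per cell, N antennas per base station, B pilot symbols.
   Channel uses are natural numbers t = 1, 2, ...; the pilot x_lk(t), 1 <= t <= B,
   is entry t - 1 of [pilot l k]. *)
Record uplink (R : realType) (d : measure_display) (Omega : measurableType d)
    (L K N B : nat) := Uplink {
  lambda : 'I_L -> 'I_L -> 'I_K -> R;
  power : 'I_L -> 'I_K -> R;
  kappa : R;
  delta : R;
  sigma : R;
  xi : R;
  pilot : 'I_L -> 'I_K -> 'cV[R[i]]_B;
  symbol : 'I_L -> 'I_K -> nat -> Omega -> R[i];
  channel : 'I_L -> 'I_L -> 'I_K -> Omega -> 'cV[R[i]]_N;
  phase : 'I_L -> 'I_N -> nat -> Omega -> R;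
  distortion : 'I_L -> nat -> Omega -> 'cV[R[i]]_N;
  noise : 'I_L -> nat -> Omega -> 'cV[R[i]]_N }.

Section Model.
Context (R : realType) (d : measure_display) (Omega : measurableType d).
Context (L K N B : nat).
Variables (P : probability Omega R) (M : uplink R Omega L K N B).

Definition phase_mx (j : 'I_L) (t : nat) (w : Omega) : 'M[R[i]]_N :=
  diag_mx (\row_n cis (phase M j n t w)).

Definition channel_mx (j l : 'I_L) (w : Omega) : 'M[R[i]]_(N, K) :=
  \matrix_(n, k) channel M j l k w n 0.

Definition symbol_vec (l : 'I_L) (t : nat) (w : Omega) : 'cV[R[i]]_K :=
  \col_k symbol M l k t w.

Definition received (j : 'I_L) (t : nat) (w : Omega) : 'cV[R[i]]_N :=
  phase_mx j t w *m (\sum_l channel_mx j l w *m symbol_vec l t w)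
  + distortion M j t w + noise M j t w.

Definition eff_channel (j l : 'I_L) (k : 'I_K) (t : nat) (w : Omega) : 'cV[R[i]]_N :=
  phase_mx j t w *m channel M j l k w.

(* Covariance matrix of the distortion noise given the channels. *)
Definition Upsilon (j : 'I_L) (t : nat) (w : Omega) : 'M[R[i]]_N :=
  (kappa M ^+ 2)%:C *:
    \sum_l \sum_k cexpect P (fun w' => `|symbol M l k t w'| ^+ 2) *:
      diag_mx (\row_n `|channel M j l k w n 0| ^+ 2).

Definition Xmx (l : 'I_L) (m : 'I_K) : 'M[R[i]]_B :=
  \matrix_(i1, i2)
    if i1 == i2 then `|pilot M l m i1 0| ^+ 2 * (1 + kappa M ^+ 2)%:C
    else pilot M l m i1 0 * Num.conj (pilot M l m i2 0) *
         (expR (- (delta M / 2) * `|i1%:R - i2%:R|))%:C.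

Definition Psi (j : 'I_L) : 'M[R[i]]_B :=
  \sum_l \sum_m (lambda M j l m)%:C *: Xmx l m + (sigma M ^+ 2 * xi M)%:C%:M.

Definition Ddelta (t : nat) : 'M[R[i]]_B :=
  diag_mx (\row_(i < B) (expR (- (delta M / 2) * (t%:R - i.+1%:R)))%:C).

(* [y_j(1); ...; y_j(B)]: entry i of y_j(s) sits at position (s - 1) * N + i. *)
Definition psi (j : 'I_L) (w : Omega) : 'cV[R[i]]_(B * N) :=
  \col_q received j (mxtens_unindex q).1.+1 w (mxtens_unindex q).2 0.

(* The Kronecker product has 1 * N rows, hence the cast. *)
Definition channel_est (j l : 'I_L) (k : 'I_K) (t : nat) (w : Omega) : 'cV[R[i]]_N :=
  castmx (mul1n N, erefl 1%N)
    ((((lambda M j l k)%:C *: ((pilot M l k)^t* *m Ddelta t *m invmx (Psi j)))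
      *t (1%:M : 'M[R[i]]_N)) *m psi j w).

Definition mrc (j : 'I_L) (k : 'I_K) (t : nat) (w : Omega) : 'cV[R[i]]_N :=
  channel_est j j k t w.

Definition inner (n : nat) (u v : 'cV[R[i]]_n) : R[i] := (u^t* *m v) 0 0.

Definition sigma_channels : set (set Omega) :=
  sigma_of (fun (i : 'I_L * 'I_L * 'I_K * 'I_N) w =>
    let: (j, l, k, n) := i in reim (channel M j l k w n 0)).

Definition sigma_phases (T : nat) : set (set Omega) :=
  sigma_of (fun (i : 'I_L * 'I_N * 'I_T) (w : Omega) =>
    let: (j, n, t) := i in phase M j n t.+1 w : measurableTypeR R).

Definition sigma_noise (T : nat) : set (set Omega) :=
  sigma_of (fun (i : 'I_L * 'I_N * 'I_T) w =>
    let: (j, n, t) := i in reim (noise M j t.+1 w n 0)).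

Definition sigma_distortion (T : nat) : set (set Omega) :=
  sigma_of (fun (i : 'I_L * 'I_N * 'I_T) w =>
    let: (j, n, t) := i in reim (distortion M j t.+1 w n 0)).

(* The hypotheses on the model for a coherence block of T channel uses. *)
Record uplink_model (T : nat) : Prop := UplinkModel {
  um_L : (1 <= L)%N;
  um_N : (1 <= N)%N;
  um_K : (1 <= K)%N;
  um_KB : (K <= B)%N;
  um_BT : (B <= T)%N;
  um_lambda : forall j l k, 0 < lambda M j l k;
  um_kappa : 0 <= kappa M;
  um_delta : 0 <= delta M;
  um_sigma : 0 < sigma M ^+ 2;
  um_xi : 1 <= xi M;

  um_symbol_meas : forall l k t, (1 <= t <= T)%N ->
    measurable_fun setT (fun w => reim (symbol M l k t w));
  um_channel_meas : forall j l k n,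
    measurable_fun setT (fun w => reim (channel M j l k w n 0));
  um_phase_meas : forall j n t, (1 <= t <= T)%N ->
    measurable_fun setT (phase M j n t : Omega -> measurableTypeR R);
  um_distortion_meas : forall j t n, (1 <= t <= T)%N ->
    measurable_fun setT (fun w => reim (distortion M j t w n 0));
  um_noise_meas : forall j t n, (1 <= t <= T)%N ->
    measurable_fun setT (fun w => reim (noise M j t w n 0));

  um_pilot : forall l k (i : 'I_B) w, symbol M l k i.+1 w = pilot M l k i 0;
  um_pilot_power : forall l k (i : 'I_B),
    `|pilot M l k i 0| ^+ 2 <= (power M l k)%:C;
  um_data_power : forall l k t, (B < t <= T)%N ->
    has_cexpect P (fun w => `|symbol M l k t w| ^+ 2) (power M l k)%:C;

  um_channel_law : forall j l k, cgauss_vec P (channel M j l k) (lambda M j l k);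
  um_channel_indep : mutual_indep P (fun i : 'I_L * 'I_L * 'I_K =>
    sigma_of (fun (n : 'I_N) w =>
      let: (j, l, k) := i in reim (channel M j l k w n 0)));

  (* The initial phases are arbitrary. *)
  um_phase_law : forall j n t, (1 <= t < T)%N ->
    has_law P (fun w => phase M j n t.+1 w - phase M j n t w : measurableTypeR R)
      (gauss (delta M));
  um_phase_incr : forall j n t, (1 <= t < T)%N ->
    mutual_indep P (tnth [tuple
      sigma_of (fun (_ : unit) w =>
        phase M j n t.+1 w - phase M j n t w : measurableTypeR R);
      sigma_of (fun (s : 'I_t) w => phase M j n s.+1 w : measurableTypeR R)]);
  um_phase_indep : forall j, mutual_indep P (fun n : 'I_N =>
    sigma_of (fun (t : 'I_T) w => phase M j n t.+1 w : measurableTypeR R));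

  (* The conditional law of (upsilon_jn(t))_{n,t} given the channels is the
     product of the laws CN(0, [Upsilon_j(t)]_{n,n}). *)
  um_distortion_law : forall j
      (D : 'I_N -> 'I_T -> set (measurableTypeR R * measurableTypeR R)),
    (forall n t, measurable (D n t)) ->
    cond_prob P sigma_channels
      [set w | forall n (t : 'I_T), D n t (reim (distortion M j t.+1 w n 0))]
      (fun w => \prod_n \prod_(t < T)
         cgauss (complex.Re (Upsilon j t.+1 w n n)) (D n t))%E;

  um_noise_law : forall j t, (1 <= t <= T)%N ->
    cgauss_vec P (noise M j t) (sigma M ^+ 2 * xi M);
  um_noise_indep : forall j, mutual_indep P (fun t : 'I_T =>
    sigma_of (fun (n : 'I_N) w => reim (noise M j t.+1 w n 0)));

  um_indep : mutual_indep P
    (tnth [tuple sigma_channels; sigma_phases T; sigma_noise T]);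
  um_distortion_indep : cond_indep P sigma_channels (sigma_distortion T)
    <<s sigma_phases T `|` sigma_noise T >> }.

End Model.

(* Main.v *)
(* Each expectation is a polynomial moment of independent Gaussian variables and unit
   phases, evaluated by conditioning on everything else, one variable at a time.  Write
   v_n = sum_s a_s y_n(s) for the combiner on antenna n, with
   a = lambda x^H D Psi^-1.  Given the channels, the phases, the receiver noise and its
   other samples, a distortion sample is centred Gaussian with variance [distortion_var],
   so it only contributes through its second moment; the receiver noise is removed in
   the same way.  Given the channels, the other antennas and the past of the phase, the
   increment e^(i(phi(t) - phi(s))) has mean e^(-delta(t - s)/2).  What remains is a moment
   of order at most four of the channels; E|h|^4 = 2 lambda^2 produces the terms in X_lm.
   For a data time t this gives E|v_n|^2 = a Psi a^H,
   E(|v_n|^2 |h_n|^2) = lambda a Psi a^H + lambda^2 a X a^H, and for two distinct antennas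
   the cross terms factor into products of E(conj(v_n) h_n) = lambda conj(a D x).
   The same computation shows that a Psi a^H - sigma^2 xi |a|^2 is an expectation of
   nonnegative quantities, so Psi is positive definite, hence invertible. *)
Require Import Defs.
From HB Require Import structures.
From mathcomp Require Import all_boot all_order all_algebra.
From mathcomp Require Import all_classical all_reals all_analysis.
From mathcomp Require Import measurable_realfun.
From mathcomp.real_closed Require Import complex mxtens.
From mathcomp Require Import ring lra.

Set Implicit Arguments.
Unset Strict Implicit.
Unset Printing Implicit Defensive.

Import Order.TTheory GRing.Theory Num.Theory.
Import numFieldNormedType.Exports.
Import HBNNSimple.

Local Open Scope classical_set_scope.
Local Open Scope ring_scope.

(** No conditional expectation is constructed. [condE] expresses one by duality, as an equality of
    expectations against all test variables with moments of every order; these form an algebra, so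
    products never raise an integrability question. Conditional laws reach [condE] through integrals
    of nonnegative functions only, which is why vanishing means are stated with positive and
    negative parts and cosines are shifted by 1. Variances may vanish, since [kappa] and [delta] may
    be 0, so every normal law is handled as a scaled image of the standard one. The delicate
    variable is the distortion: its variance is random, and its law and its independence are given
    only conditionally on the channels, so its law given the phases, the noise and its other samples
    has to be rebuilt on a pi-system of product events. Distortion has to be averaged before noise,
    and noise before phases, because the family given which a variable is averaged does not contain
    those already removed. A data time differs from every pilot time, hence the combiner is known
    when the distortion at that time is averaged. *)

Section Transfer.
Local Open Scope ereal_scope.
Context d1 d2 d (T1 : measurableType d1) (T2 : measurableType d2)
  (T : measurableType d) (R : realType).
Variables (m1 : {measure set T1 -> \bar R}) (m2 : {measure set T2 -> \bar R}).
Variables (X1 : T1 -> T) (X2 : T2 -> T) (u1 : T1 -> \bar R) (u2 : T2 -> \bar R).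
Hypotheses (mX1 : measurable_fun setT X1) (mX2 : measurable_fun setT X2).
Hypotheses (mu1 : measurable_fun setT u1) (mu2 : measurable_fun setT u2).
Hypotheses (u1_ge0 : forall x, 0 <= u1 x) (u2_ge0 : forall x, 0 <= u2 x).
Hypotheses (u1_fin : forall x, u1 x \is a fin_num) (u2_fin : forall x, u2 x \is a fin_num).

Let simple_integral d' (T' : measurableType d') (m : {measure set T' -> \bar R})
    (X : T' -> T) (u : T' -> \bar R) (f : {nnsfun T >-> R}) :
    measurable_fun setT X -> measurable_fun setT u -> (forall x, 0 <= u x) ->
  \int[m]_x ((f (X x))%:E * u x) =
  \sum_(k \in range f) (k%:E * \int[m]_(x in X @^-1` (f @^-1` [set k])) u x).
Proof.
move=> mX mu u0.
have mfX k : measurable (X @^-1` (f @^-1` [set k])).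
  by rewrite -[_ @^-1` _]setTI; exact: mX.
transitivity (\int[m]_x
    (\sum_(k \in range f) k%:E * (u x * (\1_(X @^-1` (f @^-1` [set k])) x)%:E))).
  apply: eq_integral => x _; rewrite {1}fimfunE -fsumEFin//.
  rewrite ge0_mule_fsuml; last by move=> y; rewrite nnfun_muleindic_ge0.
  by apply: eq_fsbigr => r _; rewrite EFinM -muleA (muleC _ (u x)).
have k0 k x : range f k -> 0 <= k%:E * (u x * (\1_(X @^-1` (f @^-1` [set k])) x)%:E).
  by move=> [y _ <-]; rewrite mule_ge0// ?lee_fin// mule_ge0// lee_fin.
rewrite fsbig_finite//=; under eq_integral do rewrite fsbig_finite//=.
rewrite ge0_integral_sum//; last 2 first.
- move=> k; apply: emeasurable_funM => //; apply: emeasurable_funM => //.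
  by apply/measurable_EFinP; exact: measurable_indic.
- move=> k x _.
  (* Nonnegativity is required at every real [k]; outside the range [k] may be negative, but there
     the indicator vanishes. *)
  have [kf|kf] := pselect (range f k); first exact: k0.
  rewrite [X in _ * (_ * X)](_ : _ = 0) ?mule0//.
  congr EFin; rewrite indicE; case: (boolP (_ \in _)) => //; rewrite inE /= => fX.
  by exfalso; apply: kf; exists (X x).
rewrite -!fsbig_finite//; apply: eq_fsbigr => k; rewrite inE => -[y _ <-].
rewrite ge0_integralZl//; last 3 first.
- apply: emeasurable_funM => //.
  by apply/measurable_EFinP; exact: measurable_indic.
- by move=> x _; rewrite mule_ge0// lee_fin.
- by rewrite lee_fin.
congr (_ * _); rewrite [RHS]integral_mkcond; apply: eq_integral => x _.
by rewrite epatch_indic.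
Qed.

(** The hypothesis says that the measures [u1 m1] and [u2 m2] have the same image in [T] under [X1]
    and [X2]. Simple functions reduce to it level set by level set, and monotone convergence does
    the rest; finiteness of the weights lets a limit be multiplied by them. Densities, conditional
    laws and conditional expectations all enter through this lemma. *)
Lemma ge0_integral_transfer (q : T -> \bar R) :
  (forall A, measurable A ->
    \int[m1]_(x in X1 @^-1` A) u1 x = \int[m2]_(x in X2 @^-1` A) u2 x) ->
  measurable_fun setT q -> (forall x, 0 <= q x) ->
  \int[m1]_x (q (X1 x) * u1 x) = \int[m2]_x (q (X2 x) * u2 x).
Proof.
move=> eqA mq q0.
pose f_ := nnsfun_approx measurableT mq.
have lim_int d' (T' : measurableType d') (m : {measure set T' -> \bar R})
    (X : T' -> T) (u : T' -> \bar R) :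
    measurable_fun setT X -> measurable_fun setT u -> (forall x, 0 <= u x) ->
    (forall x, u x \is a fin_num) ->
  \int[m]_x (q (X x) * u x) = limn (fun n => \int[m]_x ((f_ n (X x))%:E * u x)).
  move=> mX mu u0 ufin; rewrite -monotone_convergence//.
  - apply: eq_integral => x _; apply/esym/cvg_lim => //.
    apply: cvgeZr; first exact: ufin.
    by apply: cvg_nnsfun_approx.
  - move=> n; apply: emeasurable_funM => //; apply/measurable_EFinP.
    exact: measurableT_comp.
  - by move=> n x _; rewrite mule_ge0// lee_fin.
  - move=> x _ a b ab; rewrite lee_wpmul2r// lee_fin.
    exact/lefP/nd_nnsfun_approx.
rewrite !lim_int//; congr (limn _); apply/funext => n.
rewrite !simple_integral//; apply: eq_fsbigr => k _; congr (_ * _).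
exact: eqA.
Qed.
End Transfer.

(** * Gaussian moments *)

Section Gauss.
Context {R : realType}.
Local Notation mu := (@lebesgue_measure R).
Implicit Types (f g F : R -> R) (x s : R).

(** The fundamental theorem of calculus on [[- (n+1), n+1]]: the integrals converge by dominated
    convergence, with [|f|] as bound, and the boundary values are O(1 / n). *)
Lemma integral_derivative_eq0 F f (C : R) :
  (forall x, is_derive x (1 : R) F (f x)) -> continuous f ->
  mu.-integrable setT (EFin \o f) ->
  (forall n : nat, `|F n.+1%:R| <= C / n.+1%:R) ->
  (forall n : nat, `|F (- n.+1%:R)| <= C / n.+1%:R) ->
  (\int[mu]_x (f x)%:E = 0)%E.
Proof.
move=> dF cf intf Fp Fn.
have cF : continuous F.
  by move=> x; apply: differentiable_continuous; apply/derivable1_diffP; have [] := dF x.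
pose I (n : nat) : set R := `[- n.+1%:R, n.+1%:R]%classic.
have intI n : (\int[mu]_(x in I n) (f x)%:E = (F n.+1%:R - F (- n.+1%:R))%:E)%E.
  rewrite /I (@continuous_FTC2 _ f F) ?EFinB//.
  - by rewrite -subr_gt0 opprK -natrD ltr0n.
  - exact: continuous_subspaceT.
  - split.
    + by move=> x _; have [] := dF x.
    + exact/cvg_at_right_filter/cF.
    + exact/cvg_at_left_filter/cF.
  - by move=> x _; rewrite derive1E; have [_ ->] := dF x.
have mf : measurable_fun setT f by exact: continuous_measurable_fun.
have lim1 : ((fun n => \int[mu]_(x in I n) (f x)%:E) @ \oo --> \int[mu]_x (f x)%:E)%E.
  pose f_ n := ((EFin \o f) \_ (I n)).
  have -> : (fun n => \int[mu]_(x in I n) (f x)%:E)%E = (fun n => \int[mu]_x f_ n x)%E.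
    by apply/funext => n; rewrite integral_mkcond.
  have mf_ n : measurable_fun setT (f_ n).
    apply/(measurable_restrictT _ _).1 => //; first exact: measurable_itv.
    by apply/measurable_EFinP; exact: measurable_funTS.
  suff [_ _] : [/\ mu.-integrable setT (EFin \o f),
      [sequence \int[mu]_x (`|f_ n x - (EFin \o f) x|)]_n @ \oo --> 0 &
      [sequence \int[mu]_x (f_ n x)]_n @ \oo --> \int[mu]_x ((EFin \o f) x)]%E by [].
  apply: (@dominated_convergence _ _ _ mu _ measurableT f_ _ (abse \o (EFin \o f))) => //.
  - exact/measurable_EFinP.
  - apply: aeW => x _; apply: cvg_near_cst; near=> n.
    rewrite /f_ patchE ifT// inE /I /= in_itv /= -ler_norml.
    near: n; have [m Hm] := ltr_add_invr (ltr01 : (0 : R) < 1).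
    exists (Num.truncn `|x|).+1 => // n /= hn.
    apply: ltW; apply: (lt_le_trans (truncnS_gt _)).
    by rewrite ler_nat (leq_trans hn).
  - exact: integrable_abse.
  - apply: aeW => x n _; rewrite /f_ patchE; case: ifP => // _.
    by rewrite abse0 abse_ge0.
have lim0 : ((fun n => \int[mu]_(x in I n) (f x)%:E) @ \oo --> (0 : \bar R))%E.
  have -> : (fun n => \int[mu]_(x in I n) (f x)%:E)%E =
            EFin \o (fun n : nat => F n.+1%:R - F (- n.+1%:R)).
    by apply/funext => n; rewrite intI.
  apply/fine_cvgP; split; first exact: nearW.
  apply: norm_cvg0.
  apply: (@squeeze_cvgr _ _ _ _ (cst 0) (fun n : nat => 2 * C * n.+1%:R^-1)).
  - apply: nearW => n; rewrite /= normr_ge0 /= (le_trans (ler_normB _ _))//.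
    by rewrite mulrAC -mulrA mulr_natl mulr2n lerD// mulrC.
  - exact: cvg_cst.
  - rewrite [X in _ --> X](_ : _ = 2 * C * 0); last by rewrite mulr0.
    by apply: cvgMr; exact: cvg_harmonic.
by apply: cvg_unique lim1 lim0.
Unshelve. all: by end_near. Qed.

Let phi := normal_pdf (0 : R) 1.

Let phiE x : phi x = normal_peak 1 * expR (- (x ^+ 2 / 2)).
Proof. by rewrite /phi normal_pdfE ?oner_neq0// /normal_fun subr0 expr1n mulNr. Qed.

Let phi_ge0 x : 0 <= phi x. Proof. exact: normal_pdf_ge0. Qed.

Let cphi : continuous phi.
Proof. by apply: continuous_normal_pdf; exact: oner_neq0. Qed.

Let mphi : measurable_fun setT phi. Proof. exact: measurable_normal_pdf. Qed.

Lemma ge0_integral_std_normal f : measurable_fun setT f -> (forall x, 0 <= f x) ->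
  (\int[normal_prob 0 1]_x (f x)%:E = \int[mu]_x (f x * phi x)%:E)%E.
Proof.
move=> mf f0.
transitivity (\int[normal_prob (0 : R) 1]_x ((f (id x))%:E * (cst 1 x)))%E.
  by apply: eq_integral => x _; rewrite mule1.
under [RHS]eq_integral do rewrite EFinM.
pose RR := measurableTypeR R.
have H := @ge0_integral_transfer _ _ _ RR RR RR R
  (normal_prob (0 : R) 1) mu id id (cst 1%E) (EFin \o phi).
apply: (H _ _ _ _ _ _ _ _ (EFin \o f)) => //=.
- exact/measurable_EFinP.
- by move=> A mA; rewrite integral_cst//= mul1e.
- exact/measurable_EFinP.
Qed.

Let exp_le_1Dexp (x : R) (k m : nat) : 0 <= x -> (k <= m)%N -> x ^+ k <= 1 + x ^+ m.
Proof.
move=> x0 km; have [x1|x1] := leP x 1.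
  by rewrite -[leLHS]addr0 lerD ?exprn_ge0// exprn_ile1.
by rewrite -[leLHS]add0r lerD// ler_eXn2l.
Qed.

(** The term of degree [k] of the exponential series at [x^2 / 4] is at most the exponential, whence
    the constant [k! 4^k]. The rate 1/4 is half the rate of the Gaussian density, so the product
    with that density still decays. *)
Let pow_le_expR (k : nat) : exists2 C : R, 0 <= C &
  forall x, x ^+ (2 * k) <= C * expR (x ^+ 2 / 4).
Proof.
case: k => [|k].
  by exists 1 => // x; rewrite mul1r expr0 -[leLHS]expR0 ler_expR divr_ge0// sqr_ge0.
exists (k.+1`!%:R * 4 ^+ k.+1); first by rewrite mulr_ge0// exprn_ge0.
move=> x; have y0 : 0 <= x ^+ 2 / 4 by rewrite divr_ge0// sqr_ge0.
have := expR_ge1Dxn k y0.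
rewrite exprM expr_div_n => h.
have {}h := le_trans (ler_wpDl ler01 (lexx _)) h.
by rewrite !ler_pdivrMr ?exprn_gt0 ?ltr0n ?fact_gt0// -mulrA mulrC in h.
Qed.

(** Since [exp(x^2 / 4) exp(- x^2 / 2) = exp(- x^2 / 4)], the integrand is dominated by a multiple
    of the density of N(0, 2), which explains [s = sqrt 2]. *)
Lemma integrable_poly_std_normal g (C : R) (k : nat) : measurable_fun setT g ->
  (forall x, `|g x| <= C * (1 + x ^+ (2 * k))) ->
  mu.-integrable setT (EFin \o (fun x => g x * phi x)).
Proof.
move=> mg gC; have [D D0 HD] := pow_le_expR k.
have C0 : 0 <= C.
  have h : 0 < 1 + (0 : R) ^+ (2 * k) by rewrite ltr_wpDr// exprM exprn_ge0// sqr_ge0.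
  by rewrite -(pmulr_lge0 _ h); exact: le_trans (gC 0).
pose s := Num.sqrt (2 : R).
have s0 : s != 0 by rewrite sqrtr_eq0 -ltNge.
have s2 : s ^+ 2 = 2 by rewrite sqr_sqrtr.
pose c := (C * (1 + D) * normal_peak 1) / normal_peak s.
apply: (@le_integrable _ _ _ mu setT measurableT _ (EFin \o (fun x => c * normal_pdf 0 s x))).
- by apply/measurable_EFinP; apply: measurable_funM.
- move=> x _ /=; rewrite lee_fin normrM (ger0_norm (phi_ge0 x)).
  rewrite [leRHS]ger0_norm; last first.
    rewrite mulr_ge0 ?normal_pdf_ge0// divr_ge0 ?normal_peak_ge0//.
    by rewrite mulr_ge0 ?normal_peak_ge0// mulr_ge0// addr_ge0.
  rewrite normal_pdfE// /c -!mulrA.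
  rewrite [(normal_peak s)^-1 * _]mulrA mulVf ?mul1r; last by rewrite gt_eqF// normal_peak_gt0.
  rewrite phiE.
  apply: (@le_trans _ _ (C * (1 + D) * expR (x ^+ 2 / 4) * (normal_peak 1 * expR (- (x ^+ 2 / 2))))).
    rewrite ler_wpM2r ?mulr_ge0 ?normal_peak_ge0 ?expR_ge0//.
    apply: (le_trans (gC x)); rewrite -mulrA ler_wpM2l// mulrDl mul1r lerD//.
    by rewrite -[leLHS]expR0 ler_expR divr_ge0// sqr_ge0.
  rewrite /normal_fun subr0 s2 -!mulrA ler_wpM2l// ler_wpM2l ?addr_ge0//.
  rewrite mulrCA ler_wpM2l ?normal_peak_ge0// -expRD ler_expR.
  by rewrite le_eqVlt; apply/orP; left; apply/eqP; field.
- rewrite (_ : _ \o _ = (fun x => c%:E * (normal_pdf 0 s x)%:E)%E); last exact/funext.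
  by apply: integrableZl => //; exact: integrable_normal_pdf.
Qed.

Let derive_phi x : is_derive x (1 : R) phi (- x * phi x).
Proof.
have E : phi = normal_peak 1 \*: (expR \o ((- 2^-1) \*: ((@id R) ^+ 2))).
  apply/funext => y; rewrite phiE /GRing.scale /=; congr (_ * expR _).
  by rewrite exprfctE -[RHS]/(- 2^-1 * y ^+ 2); field.
rewrite phiE {1}E; apply: is_derive_eq.
rewrite exprfctE.
rewrite -[LHS]/(normal_peak 1 * (expR (- 2^-1 * x ^+ 2) * (- 2^-1 * (2%:R * x ^+ 1 * 1)))).
by rewrite (_ : - 2^-1 * x ^+ 2 = - (x ^+ 2 / 2)); field.
Qed.

(** Integration by parts: [(g phi)' = (g' - x g) phi] for the standard density [phi], and polynomial
    growth makes the boundary terms vanish. *)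
Lemma stein g g' (C : R) : (forall x, is_derive x (1 : R) g (g' x)) ->
  continuous g' ->
  (forall x, `|g x| <= C * (1 + x ^+ 4)) ->
  (forall x, `|g' x| <= C * (1 + x ^+ 4)) ->
  (\int[mu]_x (g' x * phi x)%:E = \int[mu]_x (x * g x * phi x)%:E)%E.
Proof.
move=> dg cg' gC g'C.
have C0 : 0 <= C.
  have h : 0 < 1 + (0 : R) ^+ 4 by rewrite expr0n /= addr0.
  by rewrite -(pmulr_lge0 _ h); exact: le_trans (gC 0).
have cg : continuous g.
  by move=> x; apply: differentiable_continuous; apply/derivable1_diffP; have [] := dg x.
have mg : measurable_fun setT g by exact: continuous_measurable_fun.
have mg' : measurable_fun setT g' by exact: continuous_measurable_fun.
have i1 : mu.-integrable setT (EFin \o (fun x => g' x * phi x)).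
  exact: (@integrable_poly_std_normal _ C 2).
have i2 : mu.-integrable setT (EFin \o (fun x => x * g x * phi x)).
  apply: (@integrable_poly_std_normal _ (4 * C) 3); first exact: measurable_funM.
  move=> x; rewrite normrM.
  apply: (@le_trans _ _ (`|x| * (C * (1 + x ^+ 4)))); first by rewrite ler_wpM2l.
  rewrite mulrCA [4 * C]mulrC -mulrA ler_wpM2l//.
  rewrite -[x ^+ 4]ger0_norm ?exprn_even_ge0// -[x ^+ (2 * 3)]ger0_norm ?exprn_even_ge0//.
  rewrite !normrX; have := normr_ge0 x; set a := `|x| => a0.
  have -> : a ^+ (2 * 3) = a ^+ 6 by [].
  have -> : a * (1 + a ^+ 4) = a + a ^+ 5 by rewrite mulrDr mulr1 -exprS.
  have := exp_le_1Dexp a0 (isT : (1 <= 6)%N); have := exp_le_1Dexp a0 (isT : (5 <= 6)%N).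
  have := exprn_ge0 6 a0; rewrite expr1 => *; lra.
(* On [|x| >= 1], the cubic term of the series gives [exp(x^2 / 2) >= 1 + x^6 / 48], while
   [|x| (1 + x^4) <= 2 x^6]; hence 96 = 2 * 48. *)
have tail n x : `|x| = n.+1%:R -> `|g x * phi x| <= 96 * C * normal_peak 1 / n.+1%:R.
  move=> xn; have x1 : 1 <= `|x| by rewrite xn ler1n.
  rewrite normrM (ger0_norm (phi_ge0 x)) phiE.
  apply: (@le_trans _ _ (C * (1 + x ^+ 4) * (normal_peak 1 * expR (- (x ^+ 2 / 2))))).
    by rewrite ler_wpM2r// mulr_ge0 ?normal_peak_ge0 ?expR_ge0.
  rewrite [leRHS](_ : _ = C * (96 / n.+1%:R) * normal_peak 1); last by ring.
  rewrite -!mulrA ler_wpM2l// [normal_peak 1 * _]mulrC !mulrA ler_wpM2r ?normal_peak_ge0//.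
  rewrite expRN ler_pdivrMr ?expR_gt0// mulrAC ler_pdivlMr ?ltr0n// -xn.
  have y0 : 0 <= x ^+ 2 / 2 by rewrite divr_ge0// sqr_ge0.
  have := expR_ge1Dxn 2 y0.
  have E2 : x ^+ 2 = `|x| ^+ 2 by rewrite -normrX ger0_norm ?sqr_ge0.
  have E4 : x ^+ 4 = `|x| ^+ 4 by rewrite -normrX ger0_norm ?exprn_even_ge0.
  rewrite -?expr2 E2 E4; move: x1; move: (`|x| : R) => a x1.
  rewrite expr_div_n -exprM (_ : 3`! = 6)%N//; set e := expR _ => h.
  have h2 : a ^+ 4 * a <= a ^+ 6 by rewrite -exprSr ler_weXn2l.
  have h3 : a <= a ^+ 6 by rewrite -[leLHS]expr1 ler_weXn2l.
  have {}h : 1 + a ^+ 6 / 2 ^+ 3 / 6%:R <= e by [].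
  have E6 : a ^+ 6 = 48 * (a ^+ 6 / 2 ^+ 3 / 6%:R) by field.
  have -> : (1 + a ^+ 4) * a = a + a ^+ 4 * a by ring.
  move: (a ^+ 4 * a) (a ^+ 6 / 2 ^+ 3 / 6%:R) (a ^+ 6) h h2 h3 E6 => u v w h h2 h3 E6.
  lra.
have : (\int[mu]_x (g' x * phi x - x * g x * phi x)%:E = 0)%E.
  apply: (@integral_derivative_eq0 (g * phi) _ (96 * C * normal_peak 1)).
  - move=> x; have ? := derive_phi x; have ? := dg x; apply: is_derive_eq.
    by rewrite -[LHS]/(g x * (- x * phi x) + phi x * g' x); ring.
  - move=> x; apply: cvgB; apply: cvgM; [exact: cg'|exact: cphi| |exact: cphi].
    by apply: cvgM; [exact: cvg_id|exact: cg].
  - rewrite (_ : _ \o _ = (EFin \o (fun x => (g' x * phi x)%R)) \- (EFin \o (fun x => (x * g x * phi x)%R)))%E.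
      exact: integrableB.
    exact/funext.
  - by move=> n; apply: tail => //; rewrite normr_nat.
  - by move=> n; apply: tail => //; rewrite normrN normr_nat.
under eq_integral do rewrite EFinB.
rewrite integralB_EFin// => /eqP; rewrite sube_eq ?add0e; last 2 first.
- exact: (integrable_fin_num measurableT i1).
- by rewrite fin_num_adde_defl//; exact: (integrable_fin_num measurableT i2).
by move/eqP.
Qed.
End Gauss.

(** * Moments of the standard normal law *)

Section GaussMoments.
Context {R : realType}.
Local Notation mu := (@lebesgue_measure R).
Implicit Types (f g : R -> R) (x s : R).

Let N1 : probability (measurableTypeR R) R := normal_prob 0 1.

Let ge0_integral_N1 f (D : R) : measurable_fun setT f -> (forall x, 0 <= f x) ->
  (\int[mu]_x (f x * normal_pdf 0 1 x)%:E = D%:E)%E ->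
  (\int[N1]_x (f x)%:E = D%:E)%E.
Proof. by move=> mf f0 fD; rewrite ge0_integral_std_normal. Qed.

Let i_phi (g : R -> R) (C : R) (k : nat) : measurable_fun setT g ->
  (forall x, `|g x| <= C * (1 + x ^+ (2 * k))) ->
  mu.-integrable setT (fun x => (g x * normal_pdf 0 1 x)%:E).
Proof. exact: integrable_poly_std_normal. Qed.

Let absX_le (x : R) (k m : nat) : ~~ odd m -> (k <= m)%N -> `|x| ^+ k <= 1 + x ^+ m.
Proof.
move=> om km; have -> : x ^+ m = `|x| ^+ m by rewrite -normrX ger0_norm ?exprn_even_ge0.
move: (`|x| : R) (normr_ge0 x) => a a0; have [a1|/ltW a1] := leP a 1.
  by rewrite -[leLHS]addr0 lerD ?exprn_ge0// exprn_ile1.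
by rewrite -[leLHS]add0r lerD// ler_weXn2l.
Qed.

Lemma integral_std_normal_sqr : (\int[normal_prob (0 : R) 1]_x (x ^+ 2)%:E = 1)%E.
Proof.
apply: ge0_integral_N1; [exact: measurable_funX|by move=> x; rewrite sqr_ge0|].
have := @stein R id (cst 1) 1.
rewrite /cst => <-.
- by under eq_integral do rewrite mul1r; rewrite integral_normal_pdf.
- by move=> x; exact: cvg_cst.
- by move=> x; rewrite mul1r -[leLHS]expr1; exact: absX_le.
- by move=> x; rewrite normr1 mul1r lerDl exprn_even_ge0.
Qed.

Lemma integral_std_normal_pow4 : (\int[normal_prob (0 : R) 1]_x (x ^+ 4)%:E = 3%:E)%E.
Proof.
apply: ge0_integral_N1; [exact: measurable_funX|by move=> x; rewrite exprn_even_ge0|].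
have x3 (x : R) (k : nat) : (k <= 4)%N -> `|x| ^+ k <= 1 + x ^+ 4 by exact: absX_le.
have dX (x : R) : is_derive x (1 : R) (fun x => x ^+ 3) (3 * x ^+ 2).
  have : is_derive x (1 : R) ((@id R) ^+ 3) ((3%:R * id x ^+ 2) *: 1).
    exact: is_deriveX.
  by rewrite exprfctE -[X in is_derive _ _ _ X -> _]/(3 * x ^+ 2 * 1) mulr1.
have := @stein R (fun x => x ^+ 3) (fun x => 3 * x ^+ 2) 3 dX.
move=> H; transitivity (\int[mu]_x (x * x ^+ 3 * normal_pdf 0 1 x)%:E)%E.
  by apply: eq_integral => x _; rewrite -exprS.
rewrite -H.
- transitivity (\int[mu]_x (3%:E * (x ^+ 2 * normal_pdf 0 1 x)%:E))%E.
    by apply: eq_integral => x _; rewrite -mulrA EFinM.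
  rewrite ge0_integralZl//; first last.
  + by move=> x _; rewrite lee_fin mulr_ge0 ?sqr_ge0 ?normal_pdf_ge0.
  + apply/measurable_EFinP/measurable_funM; last exact: measurable_normal_pdf.
    exact: measurable_funX.
  rewrite -ge0_integral_std_normal//; first last.
    by move=> x; rewrite sqr_ge0.
  by rewrite integral_std_normal_sqr mule1.
- move=> x; apply: (@cvgM R _ _ _ (cst 3) (fun x => x ^+ 2)); first exact: cvg_cst.
  exact: exprn_continuous.
- move=> x; rewrite normrX; apply: (le_trans (x3 x 3 isT)).
  by rewrite ler_peMl ?addr_ge0 ?exprn_even_ge0// ler1n.
- by move=> x; rewrite normrM normrX ger0_norm// ler_wpM2l// x3.
Qed.

Lemma integral_std_normal_pow_lty (k : nat) :
  (\int[normal_prob (0 : R) 1]_x (`|x| ^+ k)%:E < +oo)%E.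
Proof.
rewrite ge0_integral_std_normal; first last.
- by move=> x; rewrite exprn_ge0.
- by apply: measurable_funX; exact: normr_measurable.
have : mu.-integrable setT (fun x => (`|x| ^+ k * normal_pdf 0 1 x)%:E).
  apply: (@i_phi _ 1 k); first by apply: measurable_funX; exact: normr_measurable.
  move=> x; rewrite mul1r normrX normr_id; apply: absX_le.
    by rewrite mul2n odd_double.
  by rewrite mul2n -addnn leq_addr.
move=> /integrableP[_]; under eq_integral do rewrite abse_EFin ger0_norm ?mulr_ge0 ?exprn_ge0 ?normal_pdf_ge0//.
by [].
Qed.

(** The mean vanishes by [stein] with [g = 1]. It is stated with positive and negative parts because
    only nonnegative integrands are carried over to conditional laws. *)
Lemma integral_std_normal_maxN :
  (\int[normal_prob (0 : R) 1]_x (Num.max x 0)%:E =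
   \int[normal_prob (0 : R) 1]_x (Num.max (- x) 0)%:E)%E.
Proof.
have ix : mu.-integrable setT (fun x => (x * normal_pdf 0 1 x)%:E).
  apply: (@i_phi _ 1 1) => // x; rewrite mul1r -subr_ge0.
  have := sqr_ge0 (`|x| - 1); rewrite sqrrB expr1n mulr1 -normrX ger0_norm ?sqr_ge0//.
  have -> : x ^+ (2 * 1) = x ^+ 2 by [].
  by have := normr_ge0 x; have := sqr_ge0 x; move=> *; lra.
have m0 : (\int[mu]_x (x * normal_pdf 0 1 x)%:E = 0)%E.
  have := @stein R (cst 1) (cst 0) 1.
  move=> H; transitivity (\int[mu]_x (x * cst 1 x * normal_pdf 0 1 x)%:E)%E.
    by apply: eq_integral => x _; rewrite mulr1.
  rewrite -H.
  - by under eq_integral do rewrite mul0r; rewrite integral0.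
  - by move=> x; exact: cvg_cst.
  - by move=> x; rewrite normr1 mul1r lerDl exprn_even_ge0.
  - by move=> x; rewrite normr0 mul1r addr_ge0// exprn_even_ge0.
have E1 : (\int[normal_prob (0 : R) 1]_x (Num.max x 0)%:E =
    \int[mu]_x (fun x => (x * normal_pdf 0 1 x)%:E)^\+ x)%E.
  rewrite ge0_integral_std_normal; first last.
  - by move=> x; rewrite le_max lexx orbT.
  - by apply: measurable_maxr.
  apply: eq_integral => x _; rewrite funeposE -EFin_max; congr EFin.
  by rewrite maxr_pMl ?normal_pdf_ge0// mul0r.
have E2 : (\int[normal_prob (0 : R) 1]_x (Num.max (- x) 0)%:E =
    \int[mu]_x (fun x => (x * normal_pdf 0 1 x)%:E)^\- x)%E.
  rewrite ge0_integral_std_normal; first last.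
  - by move=> x; rewrite le_max lexx orbT.
  - by apply: measurable_maxr => //; exact: measurable_funN.
  apply: eq_integral => x _; rewrite funenegE -EFinN -EFin_max; congr EFin.
  by rewrite maxr_pMl ?normal_pdf_ge0// mul0r mulNr.
rewrite E1 E2; move: m0; rewrite integralE => /eqP.
rewrite sube_eq ?add0e; first by move/eqP.
- exact: (integrable_fin_num measurableT (integrable_funepos measurableT ix)).
- rewrite fin_num_adde_defl//.
  exact: (integrable_fin_num measurableT (integrable_funeneg measurableT ix)).
Qed.

(** * Characteristic function of the standard normal law *)

Section CosMoment.
Variable theta : R.

Let f s x := cos (s * x + theta) * normal_pdf 0 1 x.

Let mtrig (h : R -> R) s : continuous h -> measurable_fun setT (fun x : R => h (s * x + theta)).
Proof.
move=> ch; apply: measurableT_comp; first exact: continuous_measurable_fun.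
by apply: measurable_funD => //; exact: measurable_funM.
Qed.

Let if_ s : mu.-integrable setT (EFin \o f s).
Proof.
apply: (@i_phi _ 1 0); first by apply: mtrig; exact: continuous_cos.
move=> x; rewrite mul1r (_ : x ^+ (2 * 0) = 1)//.
by rewrite (@le_trans _ _ 1) ?lerDl// ler_norml cos_geN1 cos_le1.
Qed.

Let df s x : is_derive s (1 : R) (f ^~ x) (- (x * sin (s * x + theta)) * normal_pdf 0 1 x).
Proof.
have -> : f ^~ x = normal_pdf 0 1 x \*: (cos \o (x \*: (@id R) + cst theta)).
  apply/funext => y; rewrite /f mulrC; congr (_ * cos (_ + _)); exact: mulrC.
have := @is_derive1_comp R cos (x \*: (@id R) + cst theta) s (- sin (s * x + theta)) x.
have -> : (x \*: (@id R) + cst theta) s = s * x + theta.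
  by rewrite -[LHS]/(x * s + theta) mulrC.
move=> /(_ (is_derive_cos _)) dc.
have {}dc := dc (is_derive_eq (is_deriveD (is_deriveZ x (is_derive_id s (1 : R))) (is_derive_cst theta s (1 : R))) _).
have {}dc : is_derive s (1 : R) (cos \o (x \*: (@id R) + cst theta)) (- sin (s * x + theta) * x).
  by apply: dc; rewrite addr0; exact: mulr1.
apply: is_derive_eq.
rewrite -[LHS]/(normal_pdf 0 1 x * (- sin (s * x + theta) * x)); ring.
Qed.

Let F s := (\int[mu]_x f s x)%R.

(** Differentiation under the integral sign, with the bound [|x| phi(x)], gives minus the integral
    of [x sin(s x + theta) phi(x)]; [stein] applied to the sine turns it into [- s F]. *)
Let dF s : is_derive s (1 : R) F (- s * F s).
Proof.
have Is : `]s - 1, s + 1[%classic s by rewrite /= in_itv /= ltrBlDr ltrDl ltr01.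
have intG : mu.-integrable setT (EFin \o (fun x => `|x| * normal_pdf 0 1 x)).
  apply: (@i_phi _ 1 1); first exact: normr_measurable.
  by move=> x; rewrite normr_id mul1r -[leLHS]expr1; exact: absX_le.
have G0 x : 0 <= `|x| * normal_pdf 0 1 x by rewrite mulr_ge0 ?normal_pdf_ge0.
have d1 r x : partial1of2 f r x = - (x * sin (r * x + theta)) * normal_pdf 0 1 x.
  by rewrite partial1of2E; have [_ ->] := df r x.
have Gub r x : `]s - 1, s + 1[%classic r -> setT x ->
    `|partial1of2 f r x| <= `|x| * normal_pdf 0 1 x.
  move=> _ _; rewrite d1 normrM normrN normrM [`|normal_pdf _ _ _|]ger0_norm ?normal_pdf_ge0//.
  rewrite ler_wpM2r ?normal_pdf_ge0// ler_piMr// ler_norml sin_geN1 sin_le1//.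
have derf r x : `]s - 1, s + 1[%classic r -> setT x -> derivable (f ^~ x) r 1.
  by move=> _ _; have [] := df r x.
have D := @derivable_under_integral R _ _ mu f setT measurableT s (s - 1) (s + 1)
  Is (fun r _ => if_ r) derf _ G0 intG Gub.
have := @differentiation_under_integral R _ _ mu f setT measurableT s (s - 1) (s + 1)
  Is (fun r _ => if_ r) derf _ G0 intG Gub.
rewrite derive1E => E; apply: DeriveDef => //; rewrite [LHS]E.
have bnd (h : R) (c x : R) : `|h| <= 1 -> `|c| <= 1 + `|s| -> `|c * h| <= (1 + `|s|) * (1 + x ^+ 4).
  move=> h1 cs; rewrite normrM (@le_trans _ _ (`|c| * 1)) ?ler_wpM2l// mulr1.
  by rewrite (le_trans cs)// ler_peMr ?addr_ge0// lerDl exprn_even_ge0.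
have st : (\int[mu]_x (s * cos (s * x + theta) * normal_pdf 0 1 x)%:E =
           \int[mu]_x (x * sin (s * x + theta) * normal_pdf 0 1 x)%:E)%E.
  apply: (@stein R (fun x => sin (s * x + theta)) (fun x => s * cos (s * x + theta)) (1 + `|s|)).
  - move=> x; have := @is_derive1_comp R sin (s \*: (@id R) + cst theta) x (cos (s * x + theta)) s.
    move=> /(_ (is_derive_sin _)) dc.
    have {}dc := dc (is_derive_eq (is_deriveD (is_deriveZ s (is_derive_id x (1 : R))) (is_derive_cst theta x (1 : R))) _).
    rewrite mulrC; apply: dc; rewrite addr0; exact: mulr1.
  - move=> x; apply: (@cvgM R _ _ _ (cst s) (fun x => cos (s * x + theta))); first exact: cvg_cst.
    apply: (@cvg_comp _ _ _ (fun x => s * x + theta) cos); last exact: continuous_cos.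
    apply: (@cvgD R R); last exact: cvg_cst.
    by apply: (@cvgM R _ _ _ (cst s) id); [exact: cvg_cst|exact: cvg_id].
  - by move=> x; rewrite -[sin _]mul1r; apply: bnd; [rewrite ler_norml sin_geN1 sin_le1|rewrite normr1 lerDl].
  - by move=> x; apply: bnd; [rewrite ler_norml cos_geN1 cos_le1|rewrite lerDr].
rewrite /F /Rintegral; under eq_integral do rewrite d1 mulNr EFinN.
have intsin : mu.-integrable setT (fun x => (x * sin (s * x + theta) * normal_pdf 0 1 x)%:E).
  apply: (@i_phi _ 1 1).
    apply: measurable_funM; first exact: measurable_id.
    by apply: mtrig; exact: continuous_sin.
  move=> x; rewrite mul1r (le_trans _ (absX_le x (isT : ~~ odd 2) (isT : (1 <= 2)%N)))//.
  by rewrite expr1 normrM ler_piMr// ler_norml sin_geN1 sin_le1.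
rewrite integralN; last exact: (integrable_add_def measurableT intsin).
rewrite -st.
have -> : (\int[mu]_x (s * cos (s * x + theta) * normal_pdf 0 1 x)%:E = s%:E * \int[mu]_x (f s x)%:E)%E.
  transitivity (\int[mu]_x (s%:E * (f s x)%:E))%E.
    by apply: eq_integral => x _; rewrite -EFinM mulrA.
  by rewrite integralZl//; exact: (if_ s).
rewrite fineN fineM// ?mulNr//.
exact: (integrable_fin_num measurableT (if_ s)).
Qed.

(** Since [F' = - s F], the function [F(s) exp(s^2 / 2)] is constant, with value [cos theta] at 0.
    The shift [theta] covers the cosine and the sine part of the characteristic function at once. *)
Lemma integral_std_normal_cos s :
  (\int[mu]_x (cos (s * x + theta) * normal_pdf 0 1 x)%:E = (cos theta * expR (- (s ^+ 2 / 2)))%:E)%E.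
Proof.
rewrite -[LHS]fineK; last exact: (integrable_fin_num measurableT (if_ s)).
congr EFin; rewrite -[LHS]/(F s).
pose H : R -> R := F * (expR \o (2^-1 \*: ((@id R) ^+ 2))).
have dH (r : R) : is_derive r (1 : R) H 0.
  have ? := dF r; apply: is_derive_eq.
  rewrite exprfctE -[LHS]/(F r * (expR (2^-1 * r ^+ 2) * (2^-1 * (2%:R * r ^+ 1 * 1))) +
    expR (2^-1 * r ^+ 2) * (- r * F r)); by field.
have := @is_derive_0_is_cst R H s 0 dH.
rewrite /H exprfctE -[LHS]/(F s * expR (2^-1 * s ^+ 2)) -[RHS]/(F 0 * expR (2^-1 * 0 ^+ 2)).
rewrite expr0n /= mulr0 expR0 mulr1.
have -> : F 0 = cos theta.
  rewrite /F /f /Rintegral; under eq_integral do rewrite mul0r add0r EFinM.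
  rewrite integralZl//; last exact: integrable_normal_pdf.
  by rewrite integral_normal_pdf mule1.
move=> <-; rewrite -mulrA -expRD (_ : _ + _ = 0) ?expR0 ?mulr1//; by field.
Qed.

(** Adding 1 makes the integrand nonnegative, as the transfer to conditional laws requires. *)
Lemma integral_std_normal_1Dcos s :
  (\int[normal_prob (0 : R) 1]_x (1 + cos (s * x + theta))%:E =
   (1 + cos theta * expR (- (s ^+ 2 / 2)))%:E)%E.
Proof.
apply: ge0_integral_N1.
- apply: (@measurable_funD _ _ _ _ (cst 1) (fun x => cos (s * x + theta))) => //.
  by apply: mtrig; exact: continuous_cos.
- by move=> x; rewrite -lerBlDl sub0r cos_geN1.
under eq_integral do rewrite mulrDl mul1r EFinD.
rewrite integralD//=; last 2 first.
- exact: integrable_normal_pdf.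
- exact: (if_ s).
by rewrite integral_normal_pdf integral_std_normal_cos.
Qed.

End CosMoment.

End GaussMoments.

(** * Real and complex normal laws as scaled images of standard ones *)

Section GaussScale.
Context {R : realType}.
Local Notation mu := (@lebesgue_measure R).
Local Notation N1 := (normal_prob (0 : R) 1).
Let RR := measurableTypeR R.

Let pushforward_at d1 d2 (T1 : measurableType d1) (T2 : measurableType d2)
    (m : {measure set T1 -> \bar R}) (f : T1 -> T2) (mf : measurable_fun setT f) :
  {measure set T2 -> \bar R} :=
  measure_function_pushforward__canonical__measure_function_Measure m mf.

Let measurable_mull (c : R) : measurable_fun setT (fun x : RR => c * x : RR).
Proof. exact: measurable_funM. Qed.

Let lebesgue_measure_scale (c : R) (A : set RR) : 0 < c -> measurable A ->
  (mu A = c%:E * mu [set x : RR | A (c * x)%R])%E.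
Proof.
move=> c0 mA.
pose h : RR -> RR := fun x => c * x.
have mh : measurable_fun setT h by exact: measurable_mull.
pose pf : {measure set RR -> \bar R} := pushforward_at mu mh.
pose nu : {measure set RR -> \bar R} := mscale (NngNum (ltW c0)) pf.
rewrite (@lebesgue_measure_unique R nu)//= => X [[a b] /= _ <-].
rewrite /nu /mscale /= /pushforward.
have -> : h @^-1` `]a, b]%classic = `]a / c, b / c]%classic.
  apply/seteqP; split => x /=; rewrite !in_itv /= /h ltr_pdivrMr// ler_pdivlMr// mulrC//.
rewrite !lebesgue_measure_itv /= !lte_fin ltr_pM2r ?invr_gt0//.
case: ifP => _; last by rewrite mule0.
by rewrite -!EFinD -EFinM mulrBr -!(mulrC c^-1) !mulrA divff ?gt_eqF// !mul1r.
Qed.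

(** Covers the point mass at [v = 0], so that zero variances need no separate treatment afterwards.
    For [v > 0] it is the substitution [x -> sqrt v x]. *)
Lemma gaussE (v : R) (D : set RR) : 0 <= v -> measurable D ->
  gauss v D = N1 [set x : RR | D (Num.sqrt v * x)].
Proof.
rewrite le_eqVlt => /predU1P[<-|v0] mD; rewrite /gauss.
  rewrite eqxx sqrtr0.
  have [D0|D0] := pselect (D 0).
    rewrite /= diracE mem_set// (_ : [set x : RR | _] = setT) ?probability_setT//.
    by apply/seteqP; split => x //= _; rewrite mul0r.
  rewrite /= diracE memNset// (_ : [set x : RR | _] = set0) ?measure0//.
  by apply/seteqP; split => x //=; rewrite mul0r.
rewrite (gt_eqF v0).
set c := Num.sqrt v; have c0 : 0 < c by rewrite sqrtr_gt0.
have cn0 : c != 0 by rewrite gt_eqF.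
pose h : RR -> RR := fun x => c * x.
have mh : measurable_fun setT h by exact: measurable_mull.
pose pf : {measure set RR -> \bar R} := pushforward_at mu mh.
pose nu : {measure set RR -> \bar R} := mscale (NngNum (ltW c0)) pf.
(* Lebesgue measure equals [c] times its image under [h]; integrating against that image performs
   the substitution. *)
rewrite /= /normal_prob (@eq_measure_integral _ _ _ D nu mu); last first.
  by move=> A mA _; rewrite [LHS](lebesgue_measure_scale c0 mA).
have mpdf (s : R) (E : set RR) : measurable_fun E (fun x : RR => (normal_pdf 0 s x)%:E).
  by apply/measurable_EFinP; apply: measurable_funTS; exact: measurable_normal_pdf.
rewrite ge0_integral_mscale//; last first.
  by move=> x _; rewrite lee_fin normal_pdf_ge0.
rewrite ge0_integral_pushforward//; last first.
  by move=> x _; rewrite lee_fin normal_pdf_ge0.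
rewrite -ge0_integralZl//; last 3 first.
- by rewrite -[X in measurable X]setTI; exact: (measurable_mull c).
- apply/measurable_funTS; apply: (measurableT_comp (mpdf c setT)); exact: (measurable_mull c).
- by move=> x _; rewrite lee_fin normal_pdf_ge0.
apply: eq_integral => x _ /=; rewrite -EFinM; congr EFin.
rewrite !normal_pdfE ?oner_neq0// /normal_fun /normal_peak /h !subr0 expr1n mul1r.
rewrite -mulrnAr sqrtrM ?sqr_ge0// sqrtr_sqr (gtr0_norm c0) invfM !mulrA divff// mul1r.
congr (_ * expR _); rewrite exprMn; field.
exact: cn0.
Qed.

Let normal_setT : N1 setT = 1%E.
Proof. exact: (probability_setT (normal_prob 0 1)). Qed.

Definition std_normal2 := (N1 \x N1)%E.

HB.instance Definition _ := Measure.on std_normal2.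

Lemma std_normal2_setT : std_normal2 setT = 1%E.
Proof.
rewrite /std_normal2 -setXTT product_measure1E//.
by rewrite [LHS](_ : _ = N1 setT * N1 setT)%E// normal_setT mule1.
Qed.

HB.instance Definition _ := Measure_isProbability.Build _ _ R std_normal2 std_normal2_setT.

(** Sends a pair of independent N(0, 1) variables to the real and imaginary parts of a CN(0, v)
    variable, each of variance [v / 2]. *)
Definition scale2 (v : R) (z : (RR * RR)%type) : (RR * RR)%type :=
  (Num.sqrt (v / 2) * z.1, Num.sqrt (v / 2) * z.2).

Lemma measurable_scale2 (v : R) : measurable_fun setT (scale2 v).
Proof.
by apply: measurable_fun_pair; apply: measurable_funM.
Qed.

Lemma cgaussE (v : R) (D : set (RR * RR)%type) : 0 <= v -> measurable D ->
  cgauss v D = std_normal2 (scale2 v @^-1` D).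
Proof.
move=> v0 mD; rewrite /cgauss.
have v20 : 0 <= v / 2 by rewrite divr_ge0.
rewrite (@product_measure_unique _ _ _ _ R (gauss (v/2)) (gauss (v/2)) (pushforward_at std_normal2 (measurable_scale2 v)))//.
move=> A B mA mB; rewrite -[LHS]/(std_normal2 (scale2 v @^-1` (A `*` B))).
have -> : scale2 v @^-1` (A `*` B) =
    [set x : RR | A (Num.sqrt (v/2) * x)] `*` [set x : RR | B (Num.sqrt (v/2) * x)].
  by apply/seteqP; split => -[x y].
have mpre (E : set RR) : measurable E -> measurable [set x : RR | E (Num.sqrt (v/2) * x)].
  by move=> mE; rewrite -[X in measurable X]setTI; exact: measurable_mull.
rewrite /std_normal2 product_measure1E//; [|exact: mpre|exact: mpre].
by congr (_ * _)%E; apply/esym; exact: gaussE.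
Qed.

(** The moment [E|U|^(2p)] of U ~ CN(0, 1), that is [p!]. Orders 1 and 2 are evaluated below; for
    the others finiteness is enough. *)
Definition cgauss_moment (p : nat) : \bar R :=
  (\int[std_normal2]_z (((z.1 ^+ 2 + z.2 ^+ 2) / 2) ^+ p)%:E)%E.

Let mX (k : nat) : measurable_fun setT (fun x : RR => x ^+ k : R).
Proof. exact: measurable_funX. Qed.

Let sum_pow (f g : RR -> R) : measurable_fun setT f -> measurable_fun setT g ->
  (forall x, 0 <= f x) -> (forall x, 0 <= g x) ->
  (\int[std_normal2]_z (f z.1 * g z.2)%:E = \int[N1]_x (f x)%:E * \int[N1]_x (g x)%:E)%E.
Proof.
move=> mf mg f0 g0; rewrite fubini_tonelli1//=; first last.
- by move=> z; rewrite lee_fin mulr_ge0.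
- apply/measurable_EFinP; apply: measurable_funM.
    exact: (measurableT_comp mf measurable_fst).
  exact: (measurableT_comp mg measurable_snd).
rewrite /fubini_F /=.
have ig : (0 <= \int[N1]_x (g x)%:E)%E by apply: integral_ge0 => x _; rewrite lee_fin.
under eq_integral.
  move=> x _; under eq_integral do rewrite EFinM.
  rewrite ge0_integralZl//; last 3 first.
  - exact/measurable_EFinP.
  - by move=> y _; rewrite lee_fin.
  - by rewrite lee_fin.
  over.
by rewrite ge0_integralZr//; [exact/measurable_EFinP|move=> y _; rewrite lee_fin].
Qed.

Let int1 : (\int[N1]_x (cst 1 x : R)%:E = 1)%E.
Proof. transitivity (\int[N1]_x (cst 1%E x))%E => //.
by rewrite integral_cst// mul1e; exact: normal_setT. Qed.

Lemma ge0_integral_std_normal2_fst (f : RR -> R) : measurable_fun setT f -> (forall x, 0 <= f x) ->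
  (\int[std_normal2]_z (f z.1)%:E = \int[N1]_x (f x)%:E)%E.
Proof.
move=> mf f0; rewrite -[RHS]mule1 -int1 -sum_pow//.
by apply: eq_integral => z _; rewrite mulr1.
Qed.

Lemma ge0_integral_std_normal2_snd (f : RR -> R) : measurable_fun setT f -> (forall x, 0 <= f x) ->
  (\int[std_normal2]_z (f z.2)%:E = \int[N1]_x (f x)%:E)%E.
Proof.
move=> mf f0; rewrite -[RHS]mul1e -int1 -sum_pow//.
by apply: eq_integral => z _; rewrite mul1r.
Qed.

Lemma cgauss_moment1 : cgauss_moment 1 = 1%E.
Proof.
rewrite /cgauss_moment.
have -> : (\int[std_normal2]_z (((z.1 ^+ 2 + z.2 ^+ 2) / 2) ^+ 1)%:E =
   \int[std_normal2]_z ((z.1 ^+ 2 / 2 * cst 1 z.2)%:E + (cst 1 z.1 * (z.2 ^+ 2 / 2))%:E))%E.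
  by apply: eq_integral => z _; rewrite -EFinD expr1 mulrDl mulr1 mul1r.
have m2 : measurable_fun setT (fun x : RR => x ^+ 2 / 2 : R).
  by apply: measurable_funM => //; exact: mX.
have p2 (x : RR) : 0 <= x ^+ 2 / 2 by rewrite divr_ge0// sqr_ge0.
have i2 : (\int[N1]_x (x ^+ 2 / 2)%:E = (2^-1)%:E)%E.
  under eq_integral do rewrite EFinM.
  rewrite ge0_integralZr//; last 2 first.
  - by apply/measurable_EFinP; exact: measurable_funX.
  - by move=> x _; rewrite lee_fin sqr_ge0.
  by rewrite integral_std_normal_sqr mul1e.
rewrite ge0_integralD//; last 4 first.
- by move=> z _; rewrite lee_fin mulr1.
- by apply/measurable_EFinP/measurable_funM => //; exact: (measurableT_comp m2 measurable_fst).
- by move=> z _; rewrite lee_fin mul1r.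
- by apply/measurable_EFinP/measurable_funM => //; exact: (measurableT_comp m2 measurable_snd).
rewrite (@sum_pow (fun x => x ^+ 2 / 2) (cst 1))// (@sum_pow (cst 1) (fun x => x ^+ 2 / 2))//.
by rewrite int1 i2 mule1 mul1e -EFinD; congr EFin; field.
Qed.

(** The square expands to [z1^4 / 4 + z1^2 z2^2 / 2 + z2^4 / 4], with integrals 3/4 + 1/2 + 3/4. *)
Lemma cgauss_moment2 : cgauss_moment 2 = 2%:E.
Proof.
rewrite /cgauss_moment.
pose q4 (x : RR) : R := x ^+ 4 / 4. pose q2 (x : RR) : R := x ^+ 2.
pose q2' (x : RR) : R := x ^+ 2 / 2.
have -> : (\int[std_normal2]_z (((z.1 ^+ 2 + z.2 ^+ 2) / 2) ^+ 2)%:E =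
   \int[std_normal2]_z ((q4 z.1 * cst 1 z.2)%:E + ((q2 z.1 * q2' z.2)%:E + (cst 1 z.1 * q4 z.2)%:E)))%E.
  apply: eq_integral => z _; rewrite -!EFinD /q4 /q2 /q2' /cst; congr EFin; by field.
have m4 : measurable_fun setT q4 by apply: measurable_funM => //; exact: mX.
have m2 : measurable_fun setT q2 by exact: mX.
have m2' : measurable_fun setT q2' by apply: measurable_funM => //; exact: mX.
have p4 x : 0 <= q4 x by rewrite divr_ge0// exprn_even_ge0.
have p2 x : 0 <= q2 x by rewrite sqr_ge0.
have p2' x : 0 <= q2' x by rewrite divr_ge0// sqr_ge0.
have i4 : (\int[N1]_x (q4 x)%:E = (3 / 4)%:E)%E.
  under eq_integral do rewrite EFinM.
  rewrite ge0_integralZr//; last 2 first.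
  - by apply/measurable_EFinP; exact: measurable_funX.
  - by move=> x _; rewrite lee_fin exprn_even_ge0.
  by rewrite integral_std_normal_pow4.
have i2' : (\int[N1]_x (q2' x)%:E = (2^-1)%:E)%E.
  under eq_integral do rewrite EFinM.
  rewrite ge0_integralZr//; last 2 first.
  - by apply/measurable_EFinP; exact: measurable_funX.
  - by move=> x _; rewrite lee_fin sqr_ge0.
  by rewrite integral_std_normal_sqr mul1e.
have m1 : measurable_fun setT (cst 1 : RR -> R) by exact: measurable_cst.
have mM (f g : RR -> R) : measurable_fun setT f -> measurable_fun setT g ->
    measurable_fun setT (fun z : RR * RR => (f z.1 * g z.2)%:E).
  move=> mf mg; apply/measurable_EFinP/measurable_funM.
    exact: (measurableT_comp mf measurable_fst).
  exact: (measurableT_comp mg measurable_snd).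
rewrite ge0_integralD//; last 4 first.
- by move=> z _; rewrite lee_fin mulr1.
- exact: mM.
- by move=> z _; rewrite -EFinD lee_fin addr_ge0// mulr_ge0//=.
- by apply: emeasurable_funD; exact: mM.
rewrite ge0_integralD//; last 4 first.
- by move=> z _; rewrite lee_fin mulr_ge0.
- exact: mM.
- by move=> z _; rewrite lee_fin mulr_ge0.
- exact: mM.
rewrite !sum_pow// int1 i4 i2'.
rewrite (_ : (\int[N1]_x (q2 x)%:E = 1)%E); last exact: integral_std_normal_sqr.
by rewrite mule1 !mul1e -!EFinD; congr EFin; field.
Qed.

Lemma cgauss_moment_lty (p : nat) : (cgauss_moment p < +oo)%E.
Proof.
pose q (x : RR) : R := `|x| ^+ (2 * p).
have mq : measurable_fun setT q by apply: measurable_funX; exact: normr_measurable.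
have q0 x : 0 <= q x by rewrite exprn_ge0.
have m1 : measurable_fun setT (cst 1 : RR -> R) by exact: measurable_cst.
have mM (f g : RR -> R) : measurable_fun setT f -> measurable_fun setT g ->
    measurable_fun setT (fun z : RR * RR => (f z.1 * g z.2)%:E).
  move=> mf mg; apply/measurable_EFinP/measurable_funM.
    exact: (measurableT_comp mf measurable_fst).
  exact: (measurableT_comp mg measurable_snd).
(* The mean of two nonnegative numbers is at most the larger one, so its [p]-th power is at most the
   sum of their [p]-th powers. *)
apply: (@le_lt_trans _ _ (\int[std_normal2]_z ((q z.1 * cst 1 z.2)%:E + (cst 1 z.1 * q z.2)%:E))%E).
  apply: ge0_le_integral => //.
  - by move=> z _; rewrite lee_fin exprn_ge0// divr_ge0// addr_ge0 ?sqr_ge0.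
  - apply/measurable_EFinP; apply: measurable_funX; apply: measurable_funM => //.
    apply: measurable_funD; apply: measurable_funX; [exact: measurable_fst|exact: measurable_snd].
  - by apply: emeasurable_funD; exact: mM.
  move=> [x y] _ /=; rewrite mulr1 mul1r -EFinD lee_fin /q.
  have E (u : R) : `|u| ^+ (2 * p) = (u ^+ 2) ^+ p by rewrite exprM -normrX ger0_norm ?sqr_ge0.
  rewrite !E.
  move: (sqr_ge0 x) (sqr_ge0 y); move: (x ^+ 2) (y ^+ 2) => a b a0 b0.
  have [ab|/ltW ab] := leP a b.
    rewrite (@le_trans _ _ (b ^+ p))// ?lerDr ?exprn_ge0// lerXn2r// ?nnegrE ?divr_ge0 ?addr_ge0//.
    by rewrite ler_pdivrMr// mulr_natr mulr2n lerD.
  rewrite (@le_trans _ _ (a ^+ p))// ?lerDl ?exprn_ge0// lerXn2r// ?nnegrE ?divr_ge0 ?addr_ge0//.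
  by rewrite ler_pdivrMr// mulr_natr mulr2n lerD.
rewrite ge0_integralD//; last 4 first.
- by move=> z _; rewrite lee_fin mulr_ge0.
- exact: mM.
- by move=> z _; rewrite lee_fin mulr_ge0.
- exact: mM.
rewrite !sum_pow// int1 mule1 mul1e lte_add_pinfty//; exact: integral_std_normal_pow_lty.
Qed.

End GaussScale.

(** * Conditionally Gaussian variables *)

Section CondGauss.
Context (R : realType) (d : measure_display) (Omega : measurableType d).
Variable P : probability Omega R.
Let RR := measurableTypeR R.
Local Notation N2 := (@std_normal2 R).
Implicit Types (S : Omega -> R) (U : Omega -> R[i]) (A : set Omega) (G : set (set Omega)).

(** On the product of Omega and a standard pair, [joint S] is a Gaussian sample with random variance
    [S]. A mixture of laws CN(0, S) thus becomes an ordinary product measure, to which uniqueness of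
    measures and Tonelli apply. *)
Let joint (S : Omega -> R) (p : (Omega * (RR * RR))%type) : (RR * RR)%type := scale2 (S p.1) p.2.

Let measurable_joint S : measurable_fun setT S -> measurable_fun setT (joint S).
Proof.
move=> mS.
have ms : measurable_fun setT (fun p : (Omega * (RR * RR))%type => Num.sqrt (S p.1 / 2)).
  apply: (measurableT_comp (continuous_measurable_fun (@sqrt_continuous R))).
  by apply: measurable_funM => //; exact: (measurableT_comp mS measurable_fst).
apply: measurable_fun_pair; apply: measurable_funM => //.
  exact: (measurableT_comp measurable_fst measurable_snd).
exact: (measurableT_comp measurable_snd measurable_snd).
Qed.

Let product_joint S A D : measurable_fun setT S -> (forall w, 0 <= S w) ->
    measurable A -> measurable D ->
  ((P \x N2) ((A `*` setT) `&` (joint S @^-1` D)) = \int[P]_(w in A) cgauss (S w) D)%E.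
Proof.
move=> mS S0 mA mD; rewrite [RHS]integral_mkcond.
rewrite /product_measure1 /=; apply: eq_integral => w _.
rewrite patchE; case: ifPn => [|wA].
  rewrite inE => wA.
  have -> : xsection ((A `*` setT) `&` joint S @^-1` D) w = scale2 (S w) @^-1` D.
    apply/seteqP; split => z /=; first by rewrite /xsection /= inE => -[].
    by move=> Dz; rewrite /xsection /= inE.
  by apply/esym; exact: cgaussE.
rewrite (_ : xsection _ _ = set0) ?measure0//; apply/seteqP; split => z //=.
rewrite /xsection /= inE => -[[/= Aw _] _].
by move: wA; rewrite notin_setE; apply.
Qed.

(* The conditional law of U given <<s G>> is CN(0, S), where S is not required to be
   measurable with respect to <<s G>>. *)
Definition cond_cgauss (G : set (set Omega)) (U : Omega -> R[i]) (S : Omega -> R) :=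
  forall A D, <<s G>> A -> measurable D ->
    P (A `&` (fun w => reim (U w)) @^-1` D) = (\int[P]_(w in A) cgauss (S w) D)%E.

(** For fixed [D] both sides are finite measures in [A], so agreement on a pi-system extends to the
    sigma-algebra that it generates. *)
Lemma cond_cgauss_pi (Pi G : set (set Omega)) U S :
  setI_closed Pi -> Pi `<=` measurable -> Pi setT -> G `<=` <<s Pi>> ->
  measurable_fun setT (fun w => reim (U w)) ->
  measurable_fun setT S -> (forall w, 0 <= S w) ->
  (forall A D, Pi A -> measurable D ->
    P (A `&` (fun w => reim (U w)) @^-1` D) = (\int[P]_(w in A) cgauss (S w) D)%E) ->
  cond_cgauss G U S.
Proof.
move=> PiI Pim PiT GPi mU mS S0 H A D GA mD.
have sPim : <<s Pi>> `<=` measurable.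
  by apply: smallest_sub => //; exact: sigma_algebra_measurable.
have PA : <<s Pi>> A.
  by move: A GA; apply: smallest_sub => //; exact: smallest_sigma_algebra.
have mUD : measurable ((fun w => reim (U w)) @^-1` D).
  by rewrite -[X in measurable X]setTI; exact: mU.
have mJ : measurable (joint S @^-1` D).
  by rewrite -[X in measurable X]setTI; exact: measurable_joint.
(* The left side is [P] restricted to the event on [U]; the right side is the product measure
   restricted to the event that [joint S] lies in [D], projected to Omega. *)
pose m1 : {measure set Omega -> \bar R} := mrestr P mUD.
pose m2' : {measure set (Omega * (RR * RR))%type -> \bar R} := mrestr (P \x N2)%E mJ.
pose m2 : {measure set Omega -> \bar R} :=
  measure_function_pushforward__canonical__measure_function_Measure m2' (@measurable_fst _ _ Omega (RR * RR)%type).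
have m2E B : measurable B -> m2 B = (\int[P]_(w in B) cgauss (S w) D)%E.
  move=> mB; rewrite -(product_joint mS S0 mB mD).
  have <- : (@fst Omega (RR * RR)%type) @^-1` B = B `*` setT.
    by apply/seteqP; split => -[x y] //= -[].
  by [].
rewrite -m2E; last exact: sPim.
apply: (@g_sigma_algebra_measure_unique _ R Omega Pi Pim (fun _ => setT) (fun _ => PiT) _ m1 m2) => //.
- by rewrite bigcup_const//; exists 0%N.
- by move=> B PB; rewrite m2E; [exact: H|exact: Pim].
- move=> k; apply: (@le_lt_trans _ _ (P setT)); last by rewrite probability_setT ltry.
  by rewrite /m1 /= /mrestr le_measure// inE//; exact: measurableI.
Qed.

(** Transfer from [U] on Omega to [joint S] on the product, both weighted by the indicator of [A],
    followed by Tonelli. *)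
Lemma ge0_integral_cond_cgauss G U S (f : RR * RR -> R) A :
  G `<=` measurable -> measurable_fun setT (fun w => reim (U w)) ->
  measurable_fun setT S -> (forall w, 0 <= S w) -> cond_cgauss G U S ->
  <<s G>> A -> measurable_fun setT f -> (forall z, 0 <= f z) ->
  (\int[P]_(w in A) (f (reim (U w)))%:E =
   \int[P]_(w in A) \int[N2]_z (f (scale2 (S w) z))%:E)%E.
Proof.
move=> Gm mU mS S0 H GA mf f0.
have mA : measurable A.
  by move: A GA; apply: smallest_sub => //; exact: sigma_algebra_measurable.
have mJ := measurable_joint mS.
have mi : measurable_fun setT (\1_A : Omega -> R) by exact: measurable_indic.
have m1A : measurable_fun setT (fun p : (Omega * (RR * RR))%type => (\1_A p.1 : R)%:E).
  by apply/measurable_EFinP; exact: (measurableT_comp mi measurable_fst).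
transitivity (\int[P]_w ((EFin \o f) (reim (U w)) * (EFin \o \1_A) w))%E.
  by rewrite integral_mkcond; apply: eq_integral => w _; rewrite epatch_indic.
transitivity (\int[P \x N2]_p ((EFin \o f) (joint S p) * (\1_A p.1)%:E))%E.
  apply: (@ge0_integral_transfer _ _ _ _ _ _ R P (P \x N2)%E (fun w => reim (U w)) (joint S)
    (EFin \o \1_A) (fun p => (\1_A p.1)%:E)) => //.
  - by apply/measurable_EFinP; exact: measurable_indic.
  - by move=> w; rewrite lee_fin.
  - move=> D mD.
    have mUD : measurable ((fun w => reim (U w)) @^-1` D).
      by rewrite -[X in measurable X]setTI; exact: mU.
    have mJD : measurable (joint S @^-1` D).
      by rewrite -[X in measurable X]setTI; exact: mJ.
    transitivity (P (A `&` (fun w => reim (U w)) @^-1` D)); first by rewrite integral_indic.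
    rewrite (H _ _ GA mD) -(product_joint mS S0 mA mD).
    rewrite -(integral_indic (P \x N2)%E mJD)//; last exact: measurableX.
    apply: eq_integral => p _; congr EFin; rewrite !indicE; congr (_%:R).
    by rewrite in_setX [_ \in setT]mem_set// andbT.
  - exact/measurable_EFinP.
rewrite fubini_tonelli1//; last 2 first.
- apply: emeasurable_funM => //; apply/measurable_EFinP; exact: (measurableT_comp mf mJ).
- by move=> p; rewrite mule_ge0// lee_fin.
rewrite [RHS]integral_mkcond; apply: eq_integral => w _.
rewrite /fubini_F /= epatch_indic /= ge0_integralZr//.
- have mfs : measurable_fun setT (fun z => f (scale2 (S w) z)) := measurableT_comp mf (measurable_scale2 (S w)).
  exact/measurable_EFinP.
- by move=> z _; rewrite lee_fin.
Qed.

Let msq : measurable_fun setT (fun z : (RR * RR)%type => z.1 ^+ 2 + z.2 ^+ 2 : R).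
Proof.
by apply: measurable_funD; apply: measurable_funX; [exact: measurable_fst|exact: measurable_snd].
Qed.

Lemma cond_cgauss_moment G U S (p : nat) A :
  G `<=` measurable -> measurable_fun setT (fun w => reim (U w)) ->
  measurable_fun setT S -> (forall w, 0 <= S w) -> cond_cgauss G U S -> <<s G>> A ->
  (\int[P]_(w in A) ((complex.Re (U w) ^+ 2 + complex.Im (U w) ^+ 2) ^+ p)%:E =
   \int[P]_(w in A) ((S w ^+ p)%:E * cgauss_moment p))%E.
Proof.
move=> Gm mU mS S0 H GA.
pose f (z : (RR * RR)%type) : R := (z.1 ^+ 2 + z.2 ^+ 2) ^+ p.
rewrite [LHS](@ge0_integral_cond_cgauss G U S f A)//; last 2 first.
- exact: measurable_funX.
- by move=> z; rewrite exprn_ge0// addr_ge0 ?sqr_ge0.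
apply: eq_integral => w _; rewrite /cgauss_moment -ge0_integralZl//; last 3 first.
- by apply/measurable_EFinP/measurable_funX/measurable_funM.
- by move=> z _; rewrite lee_fin exprn_ge0// divr_ge0// addr_ge0 ?sqr_ge0.
- by rewrite lee_fin exprn_ge0.
apply: eq_integral => z _; rewrite -EFinM -exprMn; congr (_ ^+ p)%:E.
rewrite /scale2 /= !exprMn sqr_sqrtr ?divr_ge0//; by field.
Qed.

Let sym (s : R) : (\int[normal_prob (0 : R) 1]_x (Num.max (Num.sqrt (s / 2) * x) 0)%:E =
   \int[normal_prob (0 : R) 1]_x (Num.max (- (Num.sqrt (s / 2) * x)) 0)%:E)%E.
Proof.
have E (a : RR) : Num.max (Num.sqrt (s / 2) * a) 0 = Num.sqrt (s / 2) * Num.max a 0.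
  by rewrite maxr_pMr// mulr0.
under eq_integral do rewrite E EFinM.
under [RHS]eq_integral do rewrite -mulrN E EFinM.
rewrite !ge0_integralZl//.
- by rewrite integral_std_normal_maxN.
- by apply/measurable_EFinP/measurable_maxr => //; exact: measurable_funN.
- by move=> x _; rewrite lee_fin le_max lexx orbT.
- by apply/measurable_EFinP/measurable_maxr.
- by move=> x _; rewrite lee_fin le_max lexx orbT.
Qed.

Let mmax (h : RR * RR -> R) : measurable_fun setT h -> measurable_fun setT (fun z => Num.max (h z) 0).
Proof. by move=> mh; apply: measurable_maxr. Qed.

Lemma cond_cgauss_sym G U S A :
  G `<=` measurable -> measurable_fun setT (fun w => reim (U w)) ->
  measurable_fun setT S -> (forall w, 0 <= S w) -> cond_cgauss G U S -> <<s G>> A ->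
  (\int[P]_(w in A) (Num.max (complex.Re (U w)) 0)%:E =
   \int[P]_(w in A) (Num.max (- complex.Re (U w)) 0)%:E)%E /\
  (\int[P]_(w in A) (Num.max (complex.Im (U w)) 0)%:E =
   \int[P]_(w in A) (Num.max (- complex.Im (U w)) 0)%:E)%E.
Proof.
move=> Gm mU mS S0 H GA.
have max0 (x : R) : 0 <= Num.max x 0 by rewrite le_max lexx orbT.
have m1 (c : R) : measurable_fun setT (fun x : RR => Num.max (c * x) 0 : R).
  by apply: measurable_maxr => //; exact: measurable_funM.
have m2 (c : R) : measurable_fun setT (fun x : RR => Num.max (- (c * x)) 0 : R).
  by apply: measurable_maxr => //; apply: measurable_funN; exact: measurable_funM.
split.
- have e1 := @ge0_integral_cond_cgauss G U S (fun z => Num.max z.1 0) A Gm mU mS S0 H GA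
    (mmax measurable_fst) (fun z => max0 _).
  have e2 := @ge0_integral_cond_cgauss G U S (fun z => Num.max (- z.1) 0) A Gm mU mS S0 H GA
    (mmax (measurable_funN measurable_fst)) (fun z => max0 _).
  refine (etrans e1 (etrans _ (esym e2))).
  apply: eq_integral => w _; rewrite /scale2 /=.
  refine (etrans (ge0_integral_std_normal2_fst (m1 (Num.sqrt (S w / 2))) (fun x => max0 _)) _).
  refine (etrans _ (esym (ge0_integral_std_normal2_fst (m2 (Num.sqrt (S w / 2))) (fun x => max0 _)))).
  exact: sym.
- have e1 := @ge0_integral_cond_cgauss G U S (fun z => Num.max z.2 0) A Gm mU mS S0 H GA
    (mmax measurable_snd) (fun z => max0 _).
  have e2 := @ge0_integral_cond_cgauss G U S (fun z => Num.max (- z.2) 0) A Gm mU mS S0 H GA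
    (mmax (measurable_funN measurable_snd)) (fun z => max0 _).
  refine (etrans e1 (etrans _ (esym e2))).
  apply: eq_integral => w _; rewrite /scale2 /=.
  refine (etrans (ge0_integral_std_normal2_snd (m1 (Num.sqrt (S w / 2))) (fun x => max0 _)) _).
  refine (etrans _ (esym (ge0_integral_std_normal2_snd (m2 (Num.sqrt (S w / 2))) (fun x => max0 _)))).
  exact: sym.
Qed.

End CondGauss.
Local Open Scope complex_scope.

(** * Variables with moments of all orders *)

Section RealMoments.
Context (R : realType) (d : measure_display) (Omega : measurableType d).
Variable P : probability Omega R.
Implicit Types (G : set (set Omega)) (X Y V : Omega -> R).

(** [G] is any family generating the sigma-algebra with respect to which [X] is measurable. Finite
    absolute moments of every order, rather than up to a fixed one, make the class stable under
    products. *)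
Definition rmom G X := [/\ G `<=` measurable,
  measurable_fun (setT : set (g_sigma_algebraType G)) (X : g_sigma_algebraType G -> R) &
  forall p : nat, (\int[P]_w (`|X w| ^+ p)%:E < +oo)%E].

Lemma sigma_measurable G A : G `<=` measurable -> <<s G>> A -> measurable A.
Proof. by move=> Gm; move: A; apply: smallest_sub => //; exact: sigma_algebra_measurable. Qed.

Lemma rmom_measurable G X : rmom G X -> measurable_fun setT X.
Proof.
move=> [Gm mX _] _ Y mY; rewrite setTI; have := mX measurableT Y mY.
by rewrite setTI; exact: sigma_measurable.
Qed.

Lemma rmom_sub G G' X : G `<=` <<s G'>> -> G' `<=` measurable -> rmom G X -> rmom G' X.
Proof.
move=> GG' G'm [Gm mX iX]; split => // _ Y mY; rewrite setTI.
have := mX measurableT Y mY; rewrite setTI; move: (X @^-1` Y).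
by apply: smallest_sub => //; exact: smallest_sigma_algebra.
Qed.

Let lty_dom (f g h : Omega -> R) (C : R) : measurable_fun setT f -> measurable_fun setT g ->
  measurable_fun setT h -> 0 <= C -> (forall w, 0 <= f w) -> (forall w, 0 <= g w) -> (forall w, 0 <= h w) ->
  (forall w, f w <= C * (g w + h w)) ->
  (\int[P]_w (g w)%:E < +oo -> \int[P]_w (h w)%:E < +oo -> \int[P]_w (f w)%:E < +oo)%E.
Proof.
move=> mf mg mh C0 f0 g0 h0 fgh ig ih.
apply: (@le_lt_trans _ _ (\int[P]_w (C%:E * ((g w)%:E + (h w)%:E)))%E).
  apply: ge0_le_integral => //.
  - by move=> w _; rewrite lee_fin.
  - exact/measurable_EFinP.
  - by apply/measurable_EFinP/measurable_funM => //; exact: measurable_funD.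
  - by move=> w _; rewrite -EFinD -EFinM lee_fin.
rewrite ge0_integralZl//; last 2 first.
- by apply/measurable_EFinP; exact: measurable_funD.
- by move=> w _; rewrite -EFinD lee_fin addr_ge0.
rewrite ge0_integralD//; last 4 first.
- by move=> w _; rewrite lee_fin.
- exact/measurable_EFinP.
- by move=> w _; rewrite lee_fin.
- exact/measurable_EFinP.
by rewrite lte_mul_pinfty ?lee_fin// lte_add_pinfty.
Qed.

Let mpow X (p : nat) : measurable_fun setT X -> measurable_fun setT (fun w => `|X w| ^+ p).
Proof. by move=> mX; apply: measurable_funX; exact: measurableT_comp. Qed.

(** The exponent may change from [p] to [q]: a product takes [q = 2 p], by [a b <= a^2 + b^2]. *)
Lemma rmom_dom G X Y Z : measurable_fun (setT : set (g_sigma_algebraType G)) (X : g_sigma_algebraType G -> R) ->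
  rmom G Y -> rmom G Z ->
  (forall p : nat, exists q : nat, exists2 C : R, 0 <= C &
     forall w, `|X w| ^+ p <= C * (`|Y w| ^+ q + `|Z w| ^+ q)) -> rmom G X.
Proof.
move=> mX LY LZ H; have [Gm mY iY] := LY; have [_ mZ iZ] := LZ; split => // p.
have [q [C C0 XYZ]] := H p.
have mX' : measurable_fun (setT : set Omega) X.
  move=> _ B mB; rewrite setTI; have := mX measurableT B mB.
  by rewrite setTI; exact: sigma_measurable.
apply: (lty_dom _ _ _ C0 _ _ _ XYZ) => //.
- exact: mpow.
- exact/mpow/(rmom_measurable LY).
- exact/mpow/(rmom_measurable LZ).
Qed.

Lemma rmom_cst G (c : R) : G `<=` measurable -> rmom G (cst c).
Proof.
move=> Gm; split => // p.
rewrite (_ : (\int[P]_w (`|cst c w| ^+ p)%:E)%E = (\int[P]_w cst (`|c| ^+ p)%:E w)%E)//.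
by rewrite integral_cst//= probability_setT mule1 ltry.
Qed.

Lemma rmomD G X Y : rmom G X -> rmom G Y -> rmom G (fun w => X w + Y w).
Proof.
move=> LX LY; have [Gm mX iX] := LX; have [_ mY iY] := LY.
apply: (rmom_dom _ LX LY); [exact: measurable_funD|].
move=> p; exists p, (2 ^+ p) => [|w]; first by rewrite exprn_ge0.
have := ler_normD (X w) (Y w); move: (normr_ge0 (X w)) (normr_ge0 (Y w)) (normr_ge0 (X w + Y w)).
move: (`|X w|) (`|Y w|) (`|X w + Y w|) => a b c a0 b0 c0 cab.
have [ab|/ltW ab] := leP a b.
  rewrite (@le_trans _ _ ((2 * b) ^+ p))//.
    rewrite lerXn2r ?nnegrE ?mulr_ge0//; apply: (le_trans cab); rewrite mulr2n mulrDl mul1r lerD//.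
  by rewrite exprMn ler_wpM2l ?exprn_ge0// lerDr exprn_ge0.
rewrite (@le_trans _ _ ((2 * a) ^+ p))//.
  rewrite lerXn2r ?nnegrE ?mulr_ge0//; apply: (le_trans cab); rewrite mulr2n mulrDl mul1r lerD//.
by rewrite exprMn ler_wpM2l ?exprn_ge0// lerDl exprn_ge0.
Qed.

Lemma rmomM G X Y : rmom G X -> rmom G Y -> rmom G (fun w => X w * Y w).
Proof.
move=> LX LY; have [Gm mX iX] := LX; have [_ mY iY] := LY.
apply: (rmom_dom _ LX LY); [exact: measurable_funM|].
move=> p; exists (2 * p)%N, 1 => // w.
rewrite normrM mul1r exprMn !(mulnC 2) !exprM.
have := sqr_ge0 (`|X w| ^+ p - `|Y w| ^+ p).
have := exprn_ge0 p (normr_ge0 (X w)); have := exprn_ge0 p (normr_ge0 (Y w)).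
move: (`|X w| ^+ p) (`|Y w| ^+ p) => a b b0 a0; rewrite sqrrB.
have : 0 <= a * b by rewrite mulr_ge0.
rewrite mulr2n; move: (a * b) (a ^+ 2) (b ^+ 2) => ? ? ? ? ?; lra.
Qed.

Lemma rmomN G X : rmom G X -> rmom G (fun w => - X w).
Proof.
move=> LX; have [Gm _ _] := LX; have := rmomM (rmom_cst (-1) Gm) LX.
by congr rmom; apply/funext => w; rewrite /= mulN1r.
Qed.

Lemma rmomB G X Y : rmom G X -> rmom G Y -> rmom G (fun w => X w - Y w).
Proof. by move=> LX LY; apply: rmomD => //; exact: rmomN. Qed.

Lemma rmom_max0 G X : rmom G X -> rmom G (fun w => Num.max (X w) 0).
Proof.
move=> LX; have [Gm mX iX] := LX.
apply: (rmom_dom _ LX LX); [exact: measurable_maxr|].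
move=> p; exists p, 1 => // w; rewrite mul1r (@le_trans _ _ (`|X w| ^+ p)) ?lerDl ?exprn_ge0//.
by rewrite lerXn2r ?nnegrE//; have [x0|x0] := leP (X w) 0; rewrite ?normr0.
Qed.

Lemma rmom_integrable G X : rmom G X -> P.-integrable setT (EFin \o X).
Proof.
move=> LX; have mX := rmom_measurable LX; case: LX => _ _ /(_ 1%N) iX.
apply/integrableP; split; first exact/measurable_EFinP.
by move: iX; congr (_ < _)%E; apply: eq_integral => w _; rewrite expr1.
Qed.

Local Notation E X := (\int[P]_w X w)%R.

Lemma rexpectD G X Y : rmom G X -> rmom G Y -> E (fun w => X w + Y w) = E X + E Y.
Proof. by move=> /rmom_integrable iX /rmom_integrable iY; rewrite RintegralD. Qed.

Lemma rexpectB G X Y : rmom G X -> rmom G Y -> E (fun w => X w - Y w) = E X - E Y.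
Proof. by move=> /rmom_integrable iX /rmom_integrable iY; rewrite RintegralB. Qed.

Lemma rexpectZ G X (c : R) : rmom G X -> E (fun w => c * X w) = c * E X.
Proof. by move=> /rmom_integrable iX; rewrite RintegralZl. Qed.

Let max0E (x : R) : Num.max x 0 - Num.max (- x) 0 = x.
Proof.
by have [x0|x0] := leP x 0; have [y0|y0] := leP (- x) 0; lra.
Qed.

(* Y = V is rearranged into an equality between the nonnegative functions
   Y^+ + V^- and V^+ + Y^-, to which [ge0_integral_transfer] applies. *)
Lemma rmom_condE G Y V : rmom measurable Y -> rmom measurable V ->
  (forall A, <<s G>> A -> (\int[P]_(w in A) Y w)%R = (\int[P]_(w in A) V w)%R) ->
  forall X, rmom G X -> E (fun w => X w * Y w) = E (fun w => X w * V w).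
Proof.
move=> LY LV H X LX; have [Gm mXG _] := LX.
have LX' : rmom measurable X by apply: rmom_sub LX => //; apply: subset_trans Gm _; exact: sub_sigma_algebra.
pose yp w := Num.max (Y w) 0; pose yn w := Num.max (- Y w) 0.
pose vp w := Num.max (V w) 0; pose vn w := Num.max (- V w) 0.
pose u1 w := yp w + vn w; pose u2 w := vp w + yn w.
have max0 (x : R) : 0 <= Num.max x 0 by rewrite le_max lexx orbT.
have Lu1 : rmom measurable u1 by apply: rmomD; apply: rmom_max0 => //; exact: rmomN.
have Lu2 : rmom measurable u2 by apply: rmomD; apply: rmom_max0 => //; exact: rmomN.
have u10 w : 0 <= u1 w by exact: (addr_ge0 (max0 _) (max0 _)).
have u20 w : 0 <= u2 w by exact: (addr_ge0 (max0 _) (max0 _)).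
have uYV w : u1 w - u2 w = Y w - V w.
  by rewrite -[Y w]max0E -[V w]max0E /u1 /u2 /yp /yn /vp /vn; ring.
have eqA A : <<s G>> A -> (\int[P]_(w in A) (u1 w)%:E = \int[P]_(w in A) (u2 w)%:E)%E.
  move=> GA; have mA := sigma_measurable Gm GA.
  have iA (Z : Omega -> R) : rmom measurable Z -> P.-integrable A (EFin \o Z).
    by move=> /rmom_integrable; apply: integrableS.
  have : (\int[P]_(w in A) (u1 w - u2 w))%R = 0.
    under eq_Rintegral do rewrite uYV.
    by rewrite RintegralB//; [rewrite H// subrr|exact: iA|exact: iA].
  rewrite RintegralB//; [|exact: iA|exact: iA] => /eqP; rewrite subr_eq0 => /eqP h.
  rewrite -[LHS]fineK; last exact: (integrable_fin_num mA (iA _ Lu1)).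
  rewrite -[RHS]fineK; last exact: (integrable_fin_num mA (iA _ Lu2)).
  by congr EFin.
(* The identity onto Omega with the smaller sigma-algebra plays both [X1] and [X2] in the transfer,
   which thus applies to the functions measurable for [G]. *)
have mid : measurable_fun (setT : set Omega) (id : Omega -> g_sigma_algebraType G).
  by move=> _ B mB; rewrite setTI preimage_id; exact: (sigma_measurable Gm).
have main (x : Omega -> R) : rmom G x -> (forall w, 0 <= x w) ->
    E (fun w => x w * u1 w) = E (fun w => x w * u2 w).
  move=> [_ mx _] x0; congr fine.
  under eq_integral do rewrite EFinM.
  under [RHS]eq_integral do rewrite EFinM.
  apply: (@ge0_integral_transfer _ _ _ Omega Omega (g_sigma_algebraType G) R P P id id
    (EFin \o u1) (EFin \o u2) mid mid _ _ _ _ _ _ (EFin \o x)) => //.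
  - by apply/measurable_EFinP; exact: rmom_measurable Lu1.
  - by apply/measurable_EFinP; exact: rmom_measurable Lu2.
  - exact/measurable_EFinP.
(* The transfer asks for nonnegative test variables: a general [X] is the difference of these
   two. *)
have Lxp : rmom G (fun w => Num.max (X w) 0) by exact: rmom_max0.
have Lxn : rmom G (fun w => Num.max (- X w) 0) by apply: rmom_max0; exact: rmomN.
have GM : G `<=` <<s measurable>> by apply: subset_trans Gm _; exact: sub_sigma_algebra.
have Lxp' : rmom measurable (fun w => Num.max (X w) 0) by exact: rmom_sub Lxp.
have Lxn' : rmom measurable (fun w => Num.max (- X w) 0) by exact: rmom_sub Lxn.
apply/eqP; rewrite -subr_eq0 -(rexpectB (rmomM LX' LY) (rmomM LX' LV)); apply/eqP.
transitivity (E (fun w => (Num.max (X w) 0 * u1 w - Num.max (X w) 0 * u2 w)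
    - (Num.max (- X w) 0 * u1 w - Num.max (- X w) 0 * u2 w))).
  apply: eq_Rintegral => w _; rewrite -!mulrBr uYV -mulrBl max0E//.
rewrite (rexpectB (rmomB (rmomM Lxp' Lu1) (rmomM Lxp' Lu2)) (rmomB (rmomM Lxn' Lu1) (rmomM Lxn' Lu2))).
rewrite (rexpectB (rmomM Lxp' Lu1) (rmomM Lxp' Lu2)) (rexpectB (rmomM Lxn' Lu1) (rmomM Lxn' Lu2)).
by rewrite !main// !subrr.
Qed.

End RealMoments.

(** * Complex variables and conditional expectation by duality *)

Section ComplexMoments.
Context (R : realType) (d : measure_display) (Omega : measurableType d).
Variable P : probability Omega R.
Implicit Types (G : set (set Omega)) (X Y V U : Omega -> R[i]).

Definition mom G X := rmom P G (fun w => complex.Re (X w)) /\ rmom P G (fun w => complex.Im (X w)).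

Lemma mom_sub G G' X : G `<=` <<s G'>> -> G' `<=` measurable -> mom G X -> mom G' X.
Proof. by move=> h1 h2 [? ?]; split; apply: rmom_sub; eassumption. Qed.

Lemma mom_gen G X : mom G X -> G `<=` measurable.
Proof. by move=> [[]]. Qed.

Lemma mom_all G X : mom G X -> mom measurable X.
Proof.
move=> LX; apply: mom_sub (LX) => //.
by apply: subset_trans (mom_gen LX) _; exact: sub_sigma_algebra.
Qed.

Lemma mom_cst G (c : R[i]) : G `<=` measurable -> mom G (fun _ => c).
Proof. by move=> Gm; split; exact: rmom_cst. Qed.

Lemma momR G (X : Omega -> R) : rmom P G X -> mom G (fun w => (X w)%:C).
Proof. by move=> LX; split => //; apply: rmom_cst; case: LX. Qed.

Let ReD (x y : R[i]) : complex.Re (x + y) = complex.Re x + complex.Re y.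
Proof. by case: x y => [? ?] [? ?]. Qed.
Let ImD (x y : R[i]) : complex.Im (x + y) = complex.Im x + complex.Im y.
Proof. by case: x y => [? ?] [? ?]. Qed.
Let ReM (x y : R[i]) : complex.Re (x * y) = complex.Re x * complex.Re y - complex.Im x * complex.Im y.
Proof. by case: x y => [? ?] [? ?]. Qed.
Let ImM (x y : R[i]) : complex.Im (x * y) = complex.Re x * complex.Im y + complex.Im x * complex.Re y.
Proof. by case: x y => [? ?] [? ?]. Qed.
Let ReJ (x : R[i]) : complex.Re (Num.conj x) = complex.Re x.
Proof. by case: x => [? ?]. Qed.
Let ImJ (x : R[i]) : complex.Im (Num.conj x) = - complex.Im x.
Proof. by case: x => [? ?]. Qed.

Lemma momD G X Y : mom G X -> mom G Y -> mom G (fun w => X w + Y w).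
Proof.
move=> [LX1 LX2] [LY1 LY2]; split.
  by under eq_fun do rewrite ReD; exact: rmomD.
by under eq_fun do rewrite ImD; exact: rmomD.
Qed.

Lemma momM G X Y : mom G X -> mom G Y -> mom G (fun w => X w * Y w).
Proof.
move=> [LX1 LX2] [LY1 LY2]; split.
  by under eq_fun do rewrite ReM; apply: rmomB; exact: rmomM.
by under eq_fun do rewrite ImM; apply: rmomD; exact: rmomM.
Qed.

Lemma momJ G X : mom G X -> mom G (fun w => Num.conj (X w)).
Proof.
move=> [LX1 LX2]; split.
  by under eq_fun do rewrite ReJ.
by under eq_fun do rewrite ImJ; exact: rmomN.
Qed.

Lemma mom_sum G (I : finType) (Q : pred I) (X : I -> Omega -> R[i]) : G `<=` measurable ->
  (forall i, Q i -> mom G (X i)) -> mom G (fun w => \sum_(i | Q i) X i w).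
Proof.
move=> Gm LX; have -> : (fun w => \sum_(i | Q i) X i w) = \sum_(i | Q i) X i.
  by apply/funext => w; rewrite fct_sumE.
elim/big_ind: _ => //; first exact: mom_cst.
by move=> f g Lf Lg; exact: momD.
Qed.

Local Notation E X := (cexpect P X).
Local Notation rE X := (\int[P]_w X w)%R.

Lemma cexpectE X : E X = rE (fun w => complex.Re (X w)) +i* rE (fun w => complex.Im (X w)).
Proof. by rewrite /cexpect unlock. Qed.

Lemma has_cexpect_mom X (z : R[i]) : mom measurable X -> E X = z -> has_cexpect P X z.
Proof. by move=> [LX1 LX2] ?; split => //; split; [exact: (rmom_integrable LX1)|exact: (rmom_integrable LX2)]. Qed.

Lemma cexpectD X Y : mom measurable X -> mom measurable Y ->
  E (fun w => X w + Y w) = E X + E Y.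
Proof.
move=> [LX1 LX2] [LY1 LY2]; rewrite !cexpectE.
under eq_Rintegral do rewrite ReD; rewrite (rexpectD LX1 LY1).
have -> // : rE (fun w => complex.Im (X w + Y w)) = rE (fun w => complex.Im (X w)) + rE (fun w => complex.Im (Y w)).
by under eq_Rintegral do rewrite ImD; exact: rexpectD LX2 LY2.
Qed.

Lemma cexpectZ (c : R[i]) X : mom measurable X -> E (fun w => c * X w) = c * E X.
Proof.
move=> [LX1 LX2]; rewrite !cexpectE.
have LZ (a : R) (Z : Omega -> R) : rmom P measurable Z -> rmom P measurable (fun w => a * Z w).
  by apply: rmomM; exact: rmom_cst.
under eq_Rintegral do rewrite ReM.
rewrite (rexpectB (LZ _ _ LX1) (LZ _ _ LX2)) !(rexpectZ _ LX1, rexpectZ _ LX2).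
have -> : rE (fun w => complex.Im (c * X w)) =
    complex.Re c * rE (fun w => complex.Im (X w)) + complex.Im c * rE (fun w => complex.Re (X w)).
  under eq_Rintegral do rewrite ImM.
  by rewrite (rexpectD (LZ _ _ LX2) (LZ _ _ LX1)) !(rexpectZ _ LX1, rexpectZ _ LX2).
by case: c.
Qed.

Lemma cexpectJ X : mom measurable X -> E (fun w => Num.conj (X w)) = Num.conj (E X).
Proof.
move=> [LX1 LX2]; rewrite !cexpectE.
under eq_Rintegral do rewrite ReJ.
under [X in _ +i* X]eq_Rintegral do rewrite ImJ -mulN1r.
by rewrite (rexpectZ _ LX2) mulN1r.
Qed.

Lemma cexpect_cst (c : R[i]) : E (fun _ => c) = c.
Proof.
rewrite cexpectE /Rintegral !integral_cst//= probability_setT !mule1.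
by case: c.
Qed.

Lemma cexpect_sum (I : finType) (Q : pred I) (X : I -> Omega -> R[i]) :
  (forall i, Q i -> mom measurable (X i)) ->
  E (fun w => \sum_(i | Q i) X i w) = \sum_(i | Q i) E (X i).
Proof.
move=> LX.
have [_ <-] : mom measurable (\sum_(i | Q i) X i) /\ E (\sum_(i | Q i) X i) = \sum_(i | Q i) E (X i).
  apply: (big_ind2 (fun f z => mom measurable f /\ E f = z)).
  - by split; [exact: mom_cst|exact: cexpect_cst].
  - by move=> f a g b [Lf <-] [Lg <-]; split; [exact: momD|exact: cexpectD].
  - by move=> i Qi; split; [exact: LX|].
by congr (cexpect P _); apply/funext => w; rewrite fct_sumE.
Qed.

(** Holds without integrability, since [fine] turns an infinite integral into 0. This covers
    [mean_power] at any channel use. *)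
Lemma cexpect_ge0 X : (forall w, 0 <= X w) -> 0 <= E X.
Proof.
move=> X0; rewrite cexpectE.
have -> : (fun w => complex.Im (X w)) = cst 0.
  by apply/funext => w; have := X0 w; case: (X w) => a b; rewrite lecE /= => /andP[/eqP].
rewrite lecE; apply/andP; split; first by rewrite /= /Rintegral integral0.
by apply: Rintegral_ge0 => w _; have := X0 w; case: (X w) => a b; rewrite lecE /= => /andP[].
Qed.

(* V is a version of the conditional expectation of Y given <<s G>>, except
   that V need not be measurable with respect to it. *)
Definition condE G Y V := [/\ mom measurable Y, mom measurable V &
  forall X, mom G X -> E (fun w => X w * Y w) = E (fun w => X w * V w)].

Lemma condE_sets G Y V : mom measurable Y -> mom measurable V ->
  (forall A, <<s G>> A -> (\int[P]_(w in A) complex.Re (Y w))%R = (\int[P]_(w in A) complex.Re (V w))%R /\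
     (\int[P]_(w in A) complex.Im (Y w))%R = (\int[P]_(w in A) complex.Im (V w))%R) ->
  condE G Y V.
Proof.
move=> LY LV H; split => // X LX.
have [LY1 LY2] := LY; have [LV1 LV2] := LV; have [LX1 LX2] := LX.
have [LX1' LX2'] := mom_all LX.
have H1 := rmom_condE LY1 LV1 (fun A GA => (H A GA).1).
have H2 := rmom_condE LY2 LV2 (fun A GA => (H A GA).2).
rewrite !cexpectE; congr (_ +i* _).
  under eq_Rintegral do rewrite ReM; under [RHS]eq_Rintegral do rewrite ReM.
  rewrite (rexpectB (rmomM LX1' LY1) (rmomM LX2' LY2)) (rexpectB (rmomM LX1' LV1) (rmomM LX2' LV2)).
  by rewrite H1// H2.
under eq_Rintegral do rewrite ImM; under [RHS]eq_Rintegral do rewrite ImM.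
rewrite (rexpectD (rmomM LX1' LY2) (rmomM LX2' LY1)) (rexpectD (rmomM LX1' LV2) (rmomM LX2' LV1)).
by rewrite H2// H1.
Qed.

Lemma condE_mull G X Y V : mom G X -> condE G Y V -> condE G (fun w => X w * Y w) (fun w => X w * V w).
Proof.
move=> LX [LY LV H]; have LX' := mom_all LX; split; [exact: momM|exact: momM|].
move=> Z LZ; under eq_fun do rewrite mulrA; under [in RHS]eq_fun do rewrite mulrA.
by apply: H; exact: momM.
Qed.

Lemma condE_trans G Y V W : condE G Y V -> condE G V W -> condE G Y W.
Proof. by move=> [LY LV H1] [_ LW H2]; split => // X LX; rewrite H1// H2. Qed.

Lemma condE_sub G G' Y V : G `<=` <<s G'>> -> G' `<=` measurable -> condE G' Y V -> condE G Y V.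
Proof. by move=> GG' G'm [LY LV H]; split => // X LX; apply: H; exact: mom_sub LX. Qed.

Lemma condEJ G Y V : condE G Y V -> condE G (fun w => Num.conj (Y w)) (fun w => Num.conj (V w)).
Proof.
move=> [LY LV H]; split; [exact: momJ|exact: momJ|move=> X LX].
have JM (Z : Omega -> R[i]) : (fun w => X w * Num.conj (Z w)) = (fun w => Num.conj (Num.conj (X w) * Z w)).
  by apply/funext => w; rewrite rmorphM /= conjCK.
have LJX := momJ LX; have LJX' := mom_all LJX.
by rewrite !JM !cexpectJ ?H//; exact: momM.
Qed.

Lemma condE_expect G Y V X : condE G Y V -> mom G X -> E (fun w => X w * Y w) = E (fun w => X w * V w).
Proof. by move=> [_ _ H] /H. Qed.

End ComplexMoments.

(** * From conditional laws to conditional moments *)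

Section Gaussian.
Context (R : realType) (d : measure_display) (Omega : measurableType d).
Variable P : probability Omega R.
Implicit Types (G : set (set Omega)) (X Y V U : Omega -> R[i]).
Let RR := measurableTypeR R.

Let sqnormE (z : R[i]) : z * Num.conj z = (complex.Re z ^+ 2 + complex.Im z ^+ 2)%:C.
Proof. case: z => a b; apply/eqP; rewrite eq_complex /=; apply/andP; split; apply/eqP; ring. Qed.

Let normq (U : Omega -> R[i]) (w : Omega) : R := complex.Re (U w) ^+ 2 + complex.Im (U w) ^+ 2.

Lemma measurable_reim U : measurable_fun setT (fun w => reim (U w)) ->
  measurable_fun setT (fun w => complex.Re (U w)) /\ measurable_fun setT (fun w => complex.Im (U w)).
Proof.
move=> mU; split.
  exact: (measurableT_comp (@measurable_fst _ _ RR RR) mU).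
exact: (measurableT_comp (@measurable_snd _ _ RR RR) mU).
Qed.

Let self_sigma (f : Omega -> R) : measurable_fun (setT : set Omega) f ->
  measurable_fun (setT : set (g_sigma_algebraType (@measurable _ Omega))) (f : g_sigma_algebraType (@measurable _ Omega) -> R).
Proof.
by move=> mf _ B mB; rewrite setTI; apply: sub_sigma_algebra; rewrite -[X in measurable X]setTI; exact: mf.
Qed.

(** Integrating the conditional moments over the whole space gives finite moments of [|U|^2] from
    those of [S]; each part of [U] is bounded in modulus by 1 or by [|U|^2]. *)
Lemma cond_cgauss_mom G U (S : Omega -> R) : G `<=` measurable ->
  measurable_fun setT (fun w => reim (U w)) -> rmom P G S -> (forall w, 0 <= S w) ->
  cond_cgauss P G U S -> mom P measurable U.
Proof.
move=> Gm mU LS S0 H; have [mU1 mU2] := measurable_reim mU.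
have mS := rmom_measurable LS.
have sT : <<s G>> setT.
  have [s0 sC _] := smallest_sigma_algebra setT G.
  by have := sC _ s0; rewrite setD0.
have qfin (p : nat) : (\int[P]_w (normq U w ^+ p)%:E < +oo)%E.
  have mSp : measurable_fun setT (fun w => (S w ^+ p)%:E).
    by apply/measurable_EFinP; exact: measurable_funX.
  have Sp0 w : setT w -> (0 <= (S w ^+ p)%:E)%E by rewrite lee_fin exprn_ge0.
  have c0 : (0 <= cgauss_moment p :> \bar R)%E.
    by apply: integral_ge0 => z _; rewrite lee_fin exprn_ge0// divr_ge0// addr_ge0 ?sqr_ge0.
  rewrite (cond_cgauss_moment p Gm mU mS S0 H sT) ge0_integralZr//.
  apply: lte_mul_pinfty; last exact: cgauss_moment_lty.
    exact: integral_ge0.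
  rewrite ge0_fin_numE; last exact: integral_ge0.
  have [_ _ /(_ p)] := LS; congr (_ < _)%E; apply: eq_integral => w _.
  by rewrite ger0_norm.
have mq : measurable_fun setT (normq U) by apply: measurable_funD; exact: measurable_funX.
have q0 w : 0 <= normq U w by rewrite addr_ge0 ?sqr_ge0.
have Lq : rmom P measurable (normq U).
  split => //; first exact: self_sigma.
  by move=> p; under eq_integral do rewrite ger0_norm//.
have L1 : rmom P measurable (cst 1 : Omega -> R) by exact: rmom_cst.
have bound (a b : R) (p : nat) : `|a| ^+ p <= 1 * (`|1| ^+ p + `|a ^+ 2 + b ^+ 2| ^+ p).
  rewrite mul1r normr1 expr1n; have [a1|/ltW a1] := leP `|a| 1.
    by rewrite (@le_trans _ _ 1) ?lerDl ?exprn_ge0// exprn_ile1.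
  rewrite (@le_trans _ _ (`|a ^+ 2 + b ^+ 2| ^+ p)) ?lerDr// lerXn2r ?nnegrE//.
  rewrite [leRHS]ger0_norm ?addr_ge0 ?sqr_ge0//.
  rewrite (@le_trans _ _ (a ^+ 2)) ?lerDl ?sqr_ge0//.
  by rewrite -[leRHS]ger0_norm ?sqr_ge0// normrX -[leLHS]expr1 ler_weXn2l.
have bound2 (a b : R) (p : nat) : `|b| ^+ p <= 1 * (`|1| ^+ p + `|a ^+ 2 + b ^+ 2| ^+ p).
  by rewrite [a ^+ 2 + _]addrC; exact: bound.
split; apply: (rmom_dom _ L1 Lq); [exact: self_sigma| |exact: self_sigma|].
- by move=> p; exists p, 1 => // w; exact: bound.
- by move=> p; exists p, 1 => // w; exact: bound2.
Qed.

Let max0E (x : R) : x = Num.max x 0 - Num.max (- x) 0.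
Proof.
by have [x0|x0] := leP x 0; have [y0|y0] := leP (- x) 0; lra.
Qed.

(** Gathers what the sequel uses of a Gaussian law: conditional mean 0, second moment [S] and fourth
    moment [2 S^2], where the 2 is [cgauss_moment 2]. *)
Lemma cond_cgauss_condE G U (S : Omega -> R) : G `<=` measurable ->
  measurable_fun setT (fun w => reim (U w)) -> rmom P G S -> (forall w, 0 <= S w) ->
  cond_cgauss P G U S ->
  [/\ mom P measurable U, condE P G U (fun _ => 0),
      condE P G (fun w => U w * Num.conj (U w)) (fun w => (S w)%:C) &
      condE P G (fun w => (U w * Num.conj (U w)) ^+ 2) (fun w => 2 * (S w)%:C ^+ 2)].
Proof.
move=> Gm mU LS S0 H; have LU := cond_cgauss_mom Gm mU LS S0 H; have mS := rmom_measurable LS.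
have LUU : mom P measurable (fun w => U w * Num.conj (U w)) by apply: momM => //; exact: momJ.
have LS' : rmom P measurable S.
  by apply: rmom_sub LS => //; apply: subset_trans Gm _; exact: sub_sigma_algebra.
have LSC : mom P measurable (fun w => (S w)%:C) by exact: momR.
have iA (Z : Omega -> R) A : measurable A -> rmom P measurable Z -> P.-integrable A (EFin \o Z).
  by move=> mA /rmom_integrable; apply: integrableS.
split => //.
- apply: condE_sets => //; first exact: mom_cst.
  move=> A GA; have mA := sigma_measurable Gm GA.
  have [sym1 sym2] := cond_cgauss_sym Gm mU mS S0 H GA.
  have z0 (Z : Omega -> R) : rmom P measurable Z ->
      (\int[P]_(w in A) (Num.max (Z w) 0)%:E = \int[P]_(w in A) (Num.max (- Z w) 0)%:E)%E ->
      (\int[P]_(w in A) Z w)%R = (\int[P]_(w in A) 0)%R.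
    move=> LZ sym; transitivity (\int[P]_(w in A) (Num.max (Z w) 0 - Num.max (- Z w) 0))%R.
      by apply: eq_Rintegral => w _; rewrite -max0E.
    rewrite RintegralB//; [|exact/iA/rmom_max0|by apply/iA => //; exact/rmom_max0/rmomN].
    by rewrite /Rintegral sym subrr integral0.
  by have [LU1 LU2] := LU; split; exact: z0.
- apply: condE_sets => // A GA; have mA := sigma_measurable Gm GA; split; last first.
    by apply: eq_Rintegral => w _; rewrite sqnormE.
  under eq_Rintegral do rewrite sqnormE /=.
  congr fine; have h := cond_cgauss_moment 1 Gm mU mS S0 H GA.
  refine (etrans _ (etrans h _)); apply: eq_integral => w _; first by rewrite expr1.
  by rewrite cgauss_moment1 mule1 expr1.
- have -> : (fun w => (U w * Num.conj (U w)) ^+ 2) = (fun w => ((normq U w) ^+ 2)%:C).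
    by apply/funext => w; rewrite sqnormE rmorphXn.
  have -> : (fun w => 2 * (S w)%:C ^+ 2) = (fun w => (2 * (S w) ^+ 2)%:C).
    by apply/funext => w; rewrite rmorphM rmorphXn /= rmorph_nat.
  apply: condE_sets.
  + have := momM LUU LUU; congr mom; apply/funext => w; rewrite sqnormE -rmorphM /=.
    by rewrite -expr2.
  + by apply: momR; apply: rmomM; [exact: rmom_cst|exact: rmomM].
  move=> A GA; split; last by [].
  congr fine; have := cond_cgauss_moment 2 Gm mU mS S0 H GA.
  move=> ->; apply: eq_integral => w _; rewrite cgauss_moment2 -EFinM mulrC//.
Qed.

(** Real and imaginary parts are the cases [theta = 0] and [theta = - pi / 2] of one formula for
    [cos (phi + theta)], transferred from the normal law after adding 1. *)
Lemma condE_cis G (phi : Omega -> R) (v : R) : 0 <= v -> G `<=` measurable ->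
  measurable_fun setT phi ->
  (forall A (D : set RR), <<s G>> A -> measurable D ->
     P (A `&` phi @^-1` D) = (P A * gauss v D)%E) ->
  condE P G (fun w => cis (phi w)) (fun _ => (expR (- (v / 2)))%:C).
Proof.
move=> v0 Gm mphi H.
have mtrig (h : R -> R) : continuous h -> measurable_fun setT (fun w => h (phi w)).
  by move=> ch; apply: measurableT_comp => //; exact: continuous_measurable_fun.
have L (h : R -> R) : continuous h -> (forall x, `|h x| <= 1) -> rmom P measurable (fun w => h (phi w)).
  move=> ch h1; have L1 : rmom P measurable (cst 1 : Omega -> R) by exact: rmom_cst.
  apply: (rmom_dom _ L1 L1); first exact: (self_sigma (mtrig h ch)).
  move=> p; exists p, 1 => // w; rewrite mul1r normr1 expr1n (@le_trans _ _ 1) ?lerDl//.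
  by rewrite exprn_ile1.
have Lcos : rmom P measurable (fun w => cos (phi w)).
  by apply: L; [exact: continuous_cos|move=> x; rewrite ler_norml cos_geN1 cos_le1].
have Lsin : rmom P measurable (fun w => sin (phi w)).
  by apply: L; [exact: continuous_sin|move=> x; rewrite ler_norml sin_geN1 sin_le1].
apply: condE_sets; [by split|exact: mom_cst|].
move=> A GA; have mA := sigma_measurable Gm GA.
have PAfin : P A \is a fin_num by exact: fin_num_measure.
have key (theta : R) : (\int[P]_(w in A) cos (phi w + theta))%R =
    fine (P A) * (cos theta * expR (- (v / 2))).
  have mc : measurable_fun setT (fun x : RR => 1 + cos (x + theta) : R).
    apply: measurable_funD => //; apply: (measurableT_comp (continuous_measurable_fun (@continuous_cos R))).
    exact: measurable_funD.
  have ms : measurable_fun setT (fun x : RR => Num.sqrt v * x : RR) by exact: measurable_funM.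
  have c0 x : 0 <= 1 + cos (x + theta) by rewrite -lerBlDl sub0r cos_geN1.
  have e1 : (\int[P]_(w in A) (1 + cos (phi w + theta))%:E =
             (fine (P A) * (1 + cos theta * expR (- (v / 2))))%:E)%E.
    transitivity (\int[P]_w ((1 + cos (phi w + theta))%:E * (EFin \o \1_A) w))%E.
      by rewrite integral_mkcond; apply: eq_integral => w _; rewrite epatch_indic.
    have mA1 : measurable_fun setT (EFin \o (\1_A : Omega -> R)).
      by apply/measurable_EFinP; exact: measurable_indic.
    have A10 w : (0 <= (EFin \o (\1_A : Omega -> R)) w)%E by rewrite lee_fin.
    have eqD (D : set RR) : measurable D ->
        (\int[P]_(w in phi @^-1` D) (EFin \o (\1_A : Omega -> R)) w =
         \int[normal_prob (0 : R) 1]_(x in (fun x : RR => (Num.sqrt v * x)%R) @^-1` D) cst (P A) x)%E.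
      move=> mD; have mpD : measurable (phi @^-1` D) by rewrite -[X in measurable X]setTI; exact: mphi.
      have msD : measurable ((fun x : RR => Num.sqrt v * x) @^-1` D).
        by rewrite -[X in measurable X]setTI; exact: ms.
      rewrite [RHS]integral_cst//; transitivity (P (A `&` phi @^-1` D)); first by rewrite integral_indic.
      by rewrite H// gaussE.
    have T := @ge0_integral_transfer _ _ _ Omega RR RR R P (normal_prob (0 : R) 1) phi
      (fun x : RR => Num.sqrt v * x) (EFin \o (\1_A : Omega -> R)) (cst (P A)) mphi ms mA1 (measurable_cst _)
      A10 (fun _ => measure_ge0 P A) (fun _ => erefl) (fun _ => PAfin)
      (fun x : RR => (1 + cos (x + theta))%:E) eqD.
    rewrite T; [|exact/measurable_EFinP|by move=> x; rewrite lee_fin].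
    have mcs : measurable_fun setT (fun x : RR => (1 + cos (Num.sqrt v * x + theta))%:E).
      by apply/measurable_EFinP; exact: (measurableT_comp mc ms).
    have cs0 (x : RR) : setT x -> (0 <= (1 + cos (Num.sqrt v * x + theta))%:E)%E by rewrite lee_fin.
    rewrite /cst ge0_integralZr//.
    by rewrite integral_std_normal_1Dcos sqr_sqrtr// muleC EFinM fineK.
  have i1 : P.-integrable A (EFin \o (fun w => cos (phi w + theta))).
    apply: (integrableS measurableT) => //.
    have Lt : rmom P measurable (fun w => cos (phi w + theta)).
      apply: (L (fun x => cos (x + theta))); last by move=> x; rewrite ler_norml cos_geN1 cos_le1.
      move=> x; apply: (@cvg_comp _ _ _ (fun x => x + theta) cos); last exact: continuous_cos.
      by apply: (@cvgD R R); [exact: cvg_id|exact: cvg_cst].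
    exact: rmom_integrable Lt.
  have ic : P.-integrable A (EFin \o (cst 1 : Omega -> R)).
    by apply: (integrableS measurableT) => //; apply: (@rmom_integrable _ _ _ P measurable); exact: rmom_cst.
  have : (\int[P]_(w in A) (cst 1 w + cos (phi w + theta)))%R =
      fine (P A) * (1 + cos theta * expR (- (v / 2))) by rewrite /Rintegral e1.
  rewrite RintegralD// Rintegral_cst// mul1r mulrDr mulr1.
  by move/addrI.
split.
- have := key 0; rewrite cos0 mul1r => k0.
  transitivity (\int[P]_(w in A) cos (phi w + 0))%R; first by apply: eq_Rintegral => w _; rewrite addr0.
  by rewrite k0 /= Rintegral_cst// mulrC.
- have := key (- (pi / 2)); rewrite cosN cos_pihalf mul0r mulr0 => k1.
  transitivity (\int[P]_(w in A) cos (phi w - pi / 2))%R; first by apply: eq_Rintegral => w _; rewrite cosBpihalf.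
  by rewrite k1 /= Rintegral_cst// mul0r.
Qed.

End Gaussian.

(** * Independence *)

Section Independence.
Context (R : realType) (d : measure_display) (Omega : measurableType d).
Variable P : probability Omega R.
Implicit Types (F G : set (set Omega)) (A B E : set Omega).
Let RR := measurableTypeR R.

(* <<s F>> = F, with the closure properties used most often made explicit. *)
Definition sigalg F := [/\ F `<=` measurable, setI_closed F, F setT & <<s F>> `<=` F].

Definition indep2 F G := forall A B, F A -> G B -> P (A `&` B) = (P A * P B)%E.

Lemma sigma_setI G : setI_closed <<s G>>.
Proof. by move=> A B GA GB; exact: (@measurableI _ (g_sigma_algebraType G)). Qed.

Lemma sigma_setT G : <<s G>> setT.
Proof. exact: (@measurableT _ (g_sigma_algebraType G)). Qed.

Lemma sigma_set0 G : <<s G>> set0.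
Proof. exact: (@measurable0 _ (g_sigma_algebraType G)). Qed.

Lemma sigalg_gen G : G `<=` measurable -> sigalg <<s G>>.
Proof.
move=> Gm; split; [by move=> A; exact: sigma_measurable|exact: sigma_setI|exact: sigma_setT|].
by apply: smallest_sub => //; exact: smallest_sigma_algebra.
Qed.

Lemma sigma_sub F G : F `<=` <<s G>> -> <<s F>> `<=` <<s G>>.
Proof. by apply: smallest_sub => //; exact: smallest_sigma_algebra. Qed.

(** Both sides are finite measures in [A]: [P] restricted to [E], and [P] scaled by [P E]. *)
Lemma indep2_gen Pi E : setI_closed Pi -> Pi `<=` measurable -> Pi setT -> measurable E ->
  (forall A, Pi A -> P (A `&` E) = (P A * P E)%E) ->
  forall A, <<s Pi>> A -> P (A `&` E) = (P A * P E)%E.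
Proof.
move=> PiI Pim PiT mE H A PA.
have PE0 : 0 <= fine (P E) by rewrite fine_ge0.
pose m1 : {measure set Omega -> \bar R} := mrestr P mE.
pose m2 : {measure set Omega -> \bar R} := mscale (NngNum PE0) P.
have m2E B : m2 B = (P B * P E)%E.
  by rewrite /m2 /= /mscale /= fineK ?fin_num_measure// muleC.
rewrite -m2E.
apply: (@g_sigma_algebra_measure_unique _ R Omega Pi Pim (fun _ => setT) (fun _ => PiT) _ m1 m2) => //.
- by rewrite bigcup_const//; exists 0%N.
- by move=> B PB; rewrite m2E; exact: H.
- move=> k; apply: (@le_lt_trans _ _ (P setT)); last by rewrite probability_setT ltry.
  by rewrite /m1 /= /mrestr le_measure// inE//; exact: measurableI.
Qed.

Lemma indep2_sub F F' G G' : F' `<=` F -> G' `<=` G -> indep2 F G -> indep2 F' G'.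
Proof. by move=> FF GG H A B /FF FA /GG GB; exact: H. Qed.

(* If FA is independent of FF, and FB, FU are independent sub-sigma-algebras of FF,
   then FU is independent of FA and FB jointly. *)
Lemma indep2_join FA FF FB FU : sigalg FA -> sigalg FF -> sigalg FB -> FB `<=` FF -> FU `<=` FF ->
  indep2 FA FF -> indep2 FB FU -> indep2 <<s FA `|` FB>> FU.
Proof.
move=> [mA IA TA _] [mF IF TF _] [mB IB TB _] BF UF AF BU A U HA HU.
pose Pi := [set X | exists2 X1, FA X1 & exists2 X2, FB X2 & X = X1 `&` X2].
apply: (@indep2_gen Pi).
- move=> _ _ [X1 FX1 [X2 FX2 ->]] [Y1 FY1 [Y2 FY2 ->]].
  exists (X1 `&` Y1); first exact: IA.
  exists (X2 `&` Y2); first exact: IB.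
  by rewrite setIACA.
- by move=> _ [X1 FX1 [X2 FX2 ->]]; apply: measurableI; [exact: mA|exact: mB].
- by exists setT => //; exists setT => //; rewrite setIT.
- exact/mF/UF.
- move=> _ [X1 FX1 [X2 FX2 ->]].
  by rewrite -setIA AF//; [rewrite BU// AF ?muleA//; exact: BF|apply: IF; [exact: BF|exact: UF]].
- move: A HA; apply: sigma_sub => X [FX|FX]; apply: sub_sigma_algebra.
    by exists X => //; exists setT => //; rewrite setIT.
  by exists setT => //; exists X => //; rewrite setTI.
Qed.

(** The intersections of one event from each [F i], with [E i0 = setT], form a pi-system generating
    the other sigma-algebras; putting [U] in the free slot [i0] reduces the claim to the product
    rule. *)
Lemma mutual_indep_others (I : finType) (F : I -> set (set Omega)) (i0 : I) :
  (forall i, sigalg (F i)) -> mutual_indep P F ->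
  indep2 <<s \bigcup_(i in [set i | i != i0]) F i>> (F i0).
Proof.
move=> sF FI A U HA HU.
pose Pi := [set X | exists E : I -> set Omega, [/\ forall i, F i (E i), E i0 = setT &
  X = \bigcap_(i in [set: I]) E i]].
have TF i : F i setT by have [_ _ ? _] := sF i.
apply: (@indep2_gen Pi).
- move=> _ _ [E [FE E0 ->]] [E' [FE' E0' ->]]; exists (fun i => E i `&` E' i); split.
  + by move=> i; have [_ I' _ _] := sF i; exact: I'.
  + by rewrite E0 E0' setIT.
  + by rewrite bigcapI.
- move=> _ [E [FE E0 ->]]; apply: fin_bigcap_measurable => //.
  by move=> i _; have [m _ _ _] := sF i; exact: m.
- exists (fun=> setT); split => //; by rewrite bigcapT.
- by have [m _ _ _] := sF i0; exact: m.
- move=> _ [E [FE E0 ->]].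
  pose E' i := if i == i0 then U else E i.
  have FE' i : F i (E' i) by rewrite /E'; case: eqP => [->|].
  have -> : \bigcap_(i in [set: I]) E i `&` U = \bigcap_(i in [set: I]) E' i.
    apply/seteqP; split => w /=.
      by move=> [Ew Uw] i _; rewrite /E'; case: eqP => // _; exact: Ew.
    move=> Ew; split; last by have := Ew i0 Logic.I; rewrite /E' eqxx.
    move=> i _; have := Ew i Logic.I; rewrite /E'; case: eqP => [->|//]; by rewrite E0.
  rewrite (FI _ FE') (FI _ FE) (bigD1 i0)//= [X in (X * _)%E = _](_ : _ = P U); last by rewrite /E' eqxx.
  rewrite [in RHS](bigD1 i0)//= E0 probability_setT mul1e muleC; congr (_ * _)%E.
  by apply: eq_bigr => i; rewrite /E' => /negbTE ->.
- move: A HA; apply: sigma_sub => X [i /= ii0 FX]; apply: sub_sigma_algebra.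
  exists (fun k => if k == i then X else setT); split.
  + by move=> k; case: eqP => [->|].
  + by rewrite eq_sym (negbTE ii0).
  + apply/seteqP; split => w /=.
      by move=> Xw k _; case: eqP.
    by move=> /(_ i Logic.I); rewrite eqxx.
Qed.

Lemma sigma_of_measurable (I : Type) (d' : measure_display) (S : measurableType d') (X : I -> Omega -> S) :
  (forall i, measurable_fun setT (X i)) -> sigma_of X `<=` measurable.
Proof.
move=> mX; apply: smallest_sub; first exact: sigma_algebra_measurable.
by move=> _ [i _ [D mD <-]]; exact: mX.
Qed.

Lemma sigma_of_preimage (I : Type) (d' : measure_display) (S : measurableType d') (X : I -> Omega -> S) i D :
  measurable D -> sigma_of X (X i @^-1` D).
Proof.
by move=> mD; apply: sub_sigma_algebra; exists i => //; exists D => //; rewrite setTI.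
Qed.

Lemma sigma_of_sub (I : Type) (d' : measure_display) (S : measurableType d') (X : I -> Omega -> S) G :
  (forall i D, measurable D -> <<s G>> (X i @^-1` D)) -> sigma_of X `<=` <<s G>>.
Proof.
by move=> H; apply: sigma_sub => _ [i _ [D mD <-]]; rewrite setTI; exact: H.
Qed.

Lemma sigalg_sigma_of (I : Type) (d' : measure_display) (S : measurableType d') (X : I -> Omega -> S) :
  (forall i, measurable_fun setT (X i)) -> sigalg (sigma_of X).
Proof.
move=> mX; split; [exact: sigma_of_measurable|exact: sigma_setI|exact: sigma_setT|].
by apply: smallest_sub => //; exact: smallest_sigma_algebra.
Qed.

Lemma mom_preimage G (X : Omega -> R[i]) : mom P measurable X -> G `<=` measurable ->
  (forall D, measurable D -> <<s G>> ((fun w => reim (X w)) @^-1` D)) -> mom P G X.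
Proof.
move=> [[_ _ i1] [_ _ i2]] Gm H; split; split => //.
- move=> _ B mB; rewrite setTI.
  have := H (B `*` setT) (measurableX mB measurableT); congr (<<s _>> _).
  by apply/seteqP; split => w //= -[].
- move=> _ B mB; rewrite setTI.
  have := H (setT `*` B) (measurableX measurableT mB); congr (<<s _>> _).
  by apply/seteqP; split => w //= -[].
Qed.

Lemma cond_cgauss_indep G (U : Omega -> R[i]) (s : R) : G `<=` measurable ->
  measurable_fun setT (fun w => reim (U w)) ->
  has_law P (fun w => reim (U w)) (cgauss s) ->
  indep2 <<s G>> (sigma_of (fun (_ : unit) w => reim (U w))) ->
  cond_cgauss P G U (cst s).
Proof.
move=> Gm mU HU GU A D GA mD; have mA := sigma_measurable Gm GA.
rewrite (_ : (\int[P]_(w in A) cgauss (cst s w) D)%E = (\int[P]_(w in A) cst (cgauss s D) w)%E)//.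
rewrite integral_cst// GU//; first by rewrite [X in (_ * X)%E]HU// muleC.
exact: (@sigma_of_preimage unit _ _ (fun _ w => reim (U w)) tt).
Qed.

(** Independence at two levels: among the blocks [F i], and among the parts [H j] of the block
    [F i0]. It serves users and antennas for the channels, channel uses and antennas for the noise,
    antennas and increment against past for the phases. *)
Lemma mutual_indep_nested (I J : finType) (F : I -> set (set Omega)) (H : J -> set (set Omega)) i0 j0 :
  (forall i, sigalg (F i)) -> (forall j, sigalg (H j)) ->
  mutual_indep P F -> mutual_indep P H -> (forall j, H j `<=` F i0) ->
  indep2 <<s \bigcup_(i in [set i | i != i0]) F i `|` \bigcup_(j in [set j | j != j0]) H j>> (H j0).
Proof.
move=> sF sH iF iH HF; have [mF IF TF sF0] := sF i0.
have HI := @mutual_indep_others _ H j0 sH iH; have FI := @mutual_indep_others _ F i0 sF iF.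
have bF : \bigcup_(i in [set i | i != i0]) F i `<=` measurable.
  by move=> X [i _ FX]; have [m _ _ _] := sF i; exact: m.
have bH : \bigcup_(j in [set j | j != j0]) H j `<=` measurable.
  by move=> X [j _ HX]; have [m _ _ _] := sH j; exact: m.
have : indep2 <<s <<s \bigcup_(i in [set i | i != i0]) F i>> `|` <<s \bigcup_(j in [set j | j != j0]) H j>> >> (H j0).
  apply: (indep2_join (FF := F i0)) => //; [exact: sigalg_gen|exact: sigalg_gen|].
  apply: subset_trans sF0; apply: sigma_sub => X [j _ HX].
  by apply: sub_sigma_algebra; exact: HF HX.
apply: indep2_sub => //; apply: sigma_sub => X [hX|hX]; apply: sub_sigma_algebra; [left|right]; exact: sub_sigma_algebra.
Qed.

End Independence.

Section Mom.
Context (R : realType) (d : measure_display) (Omega : measurableType d) (P : probability Omega R).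
Implicit Types G : set (set Omega).

Lemma mom_cis G (phi : Omega -> R) : G `<=` measurable ->
  measurable_fun (setT : set (g_sigma_algebraType G)) (phi : g_sigma_algebraType G -> R) ->
  mom P G (fun w => cis (phi w)).
Proof.
move=> Gm mphi; have L1 : rmom P G (cst 1 : Omega -> R) by exact: rmom_cst.
have b (x : R) (p : nat) : `|x| <= 1 -> `|x| ^+ p <= 1 * (`|1| ^+ p + `|1| ^+ p).
  by move=> x1; rewrite mul1r normr1 expr1n (@le_trans _ _ 1) ?lerDl// exprn_ile1.
split; apply: (rmom_dom _ L1 L1).
- exact: (measurableT_comp (continuous_measurable_fun (@continuous_cos R)) mphi).
- by move=> p; exists p, 1 => // w; apply: b; rewrite ler_norml cos_geN1 cos_le1.
- exact: (measurableT_comp (continuous_measurable_fun (@continuous_sin R)) mphi).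
- by move=> p; exists p, 1 => // w; apply: b; rewrite ler_norml sin_geN1 sin_le1.
Qed.

Lemma cisB (x y : R) : cis (x - y) = cis x * Num.conj (cis y).
Proof.
apply/eqP; rewrite eq_complex /= cosB sinB; apply/andP; split; apply/eqP; ring.
Qed.

Lemma cis_conj (x : R) : cis x * Num.conj (cis x) = 1.
Proof. by rewrite -cisB subrr /cis cos0 sin0. Qed.

Lemma condE_id G (Y : Omega -> R[i]) : mom P measurable Y -> condE P G Y Y.
Proof. by []. Qed.

Lemma preimage_measurable_sigma (d' : measure_display) (S : measurableType d') G (X : Omega -> S) :
  (forall D, measurable D -> <<s G>> (X @^-1` D)) ->
  measurable_fun (setT : set (g_sigma_algebraType G)) (X : g_sigma_algebraType G -> S).
Proof. by move=> H _ D mD; rewrite setTI; exact: H. Qed.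

End Mom.

(** * Conditional moments in the uplink model *)

Section Model.
Context (R : realType) (d : measure_display) (Omega : measurableType d).
Context (P : probability Omega R) (L K N B T : nat) (M : uplink R Omega L K N B).
Hypothesis hM : uplink_model P M T.
Let RR := measurableTypeR R.

Local Notation CH := (sigma_channels M).
Local Notation PH := (sigma_phases M T).
Local Notation NO := (sigma_noise M T).

Let time (t : 'I_T) : (1 <= t.+1 <= T)%N. Proof. by rewrite ltn_ord. Qed.

Lemma sigalg_channels : sigalg CH.
Proof. by apply: sigalg_sigma_of => -[[[j l] k] n]; exact: (um_channel_meas hM). Qed.

Lemma sigalg_phases : sigalg PH.
Proof. by apply: sigalg_sigma_of => -[[j n] t]; apply: (um_phase_meas hM); exact: time. Qed.

Lemma sigalg_noise : sigalg NO.
Proof. by apply: sigalg_sigma_of => -[[j n] t]; apply: (um_noise_meas hM); exact: time. Qed.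

Let mCH : CH `<=` measurable. Proof. by have [] := sigalg_channels. Qed.
Let mPH : PH `<=` measurable. Proof. by have [] := sigalg_phases. Qed.
Let mNO : NO `<=` measurable. Proof. by have [] := sigalg_noise. Qed.

Let F3 := tnth [tuple CH; PH; NO].
Let i0 : 'I_3 := @Ordinal 3 0 isT.
Let i1 : 'I_3 := @Ordinal 3 1 isT.
Let i2 : 'I_3 := @Ordinal 3 2 isT.

Let sF3 i : sigalg (F3 i).
Proof.
case: i => -[|[|[|//]]] h; [exact: sigalg_channels|exact: sigalg_phases|exact: sigalg_noise].
Qed.

Let indep3 i : indep2 P <<s \bigcup_(k in [set k | k != i]) F3 k>> (F3 i).
Proof. by apply: mutual_indep_others; [exact: sF3|exact: (um_indep hM)]. Qed.

Let indep_noise : indep2 P <<s CH `|` PH>> NO.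
Proof.
apply: (indep2_sub _ _ (@indep3 i2)) => //; apply: sigma_sub => X [hX|hX]; apply: sub_sigma_algebra.
  by exists i0.
by exists i1.
Qed.

Let indep_phase : indep2 P CH PH.
Proof.
apply: (indep2_sub _ _ (@indep3 i1)) => // X hX; apply: sub_sigma_algebra; by exists i0.
Qed.

Let indep_channel : indep2 P <<s PH `|` NO>> CH.
Proof.
apply: (indep2_sub _ _ (@indep3 i0)) => //; apply: sigma_sub => X [hX|hX]; apply: sub_sigma_algebra.
  by exists i1.
by exists i2.
Qed.

(** * One channel coefficient given all the others *)

Section Channel.
Variables (i : 'I_L * 'I_L * 'I_K) (n : 'I_N).
Let F (i : 'I_L * 'I_L * 'I_K) : set (set Omega) := sigma_of (fun (n : 'I_N) w =>
  let: (j, l, k) := i in reim (channel M j l k w n 0)).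
Let H (n : 'I_N) : set (set Omega) := sigma_of (fun (_ : unit) w =>
  let: (j, l, k) := i in reim (channel M j l k w n 0)).

(** Covers every channel coefficient except entry [n] of vector [i]: the other vectors as wholes,
    and the remaining entries of vector [i], as in [mutual_indep_nested]. *)
Definition other_channels : set (set Omega) :=
  \bigcup_(i' in [set i' | i' != i]) F i' `|` \bigcup_(n' in [set n' | n' != n]) H n'.

Definition chan (i : 'I_L * 'I_L * 'I_K) (n : 'I_N) (w : Omega) : R[i] :=
  let: (j, l, k) := i in channel M j l k w n 0.

Let sF i' : sigalg (F i').
Proof. by case: i' => -[j l] k; apply: sigalg_sigma_of => n'; exact: (um_channel_meas hM). Qed.

Let sH n' : sigalg (H n').
Proof.
by rewrite /H; case: i => -[j l] k; apply: sigalg_sigma_of => _; exact: (um_channel_meas hM).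
Qed.

Lemma other_channels_measurable : other_channels `<=` measurable.
Proof.
move=> X [[i' _ hX]|[n' _ hX]].
  by have [m _ _ _] := sF i'; exact: m.
by have [m _ _ _] := sH n'; exact: m.
Qed.

Let lam := let: (j, l, k) := i in lambda M j l k.

Lemma condE_channel : let U := chan i n in
  [/\ mom P measurable U, condE P other_channels U (fun _ => 0),
      condE P other_channels (fun w => U w * Num.conj (U w)) (fun _ => lam%:C) &
      condE P other_channels (fun w => (U w * Num.conj (U w)) ^+ 2) (fun _ => 2 * lam%:C ^+ 2)].
Proof.
have Gm := other_channels_measurable.
have lam0 : 0 <= lam by rewrite /lam; case: i => -[j l] k; exact/ltW/(um_lambda hM).
have mU : measurable_fun setT (fun w => reim (chan i n w)).
  by rewrite /chan; case: i => -[j l] k; exact: (um_channel_meas hM).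
apply: (@cond_cgauss_condE _ _ _ P other_channels (chan i n) (cst lam)) => //; first exact: rmom_cst.
apply: cond_cgauss_indep => //.
  by rewrite /lam /chan; case: i => -[j l] k; have [h _] := um_channel_law hM j l k; exact: h.
have -> : sigma_of (fun (_ : unit) w => reim (chan i n w)) = H n.
  by rewrite /H /chan; case: i => -[j l] k.
apply: mutual_indep_nested => //; first exact: (um_channel_indep hM).
  by rewrite /H; case: i => -[j l] k; have [_ h] := um_channel_law hM j l k; exact: h.
move=> n'; rewrite /H /F; case: i => -[j l] k.
apply: sigma_of_sub => _ D mD.
exact: (@sigma_of_preimage _ _ _ _ _ (fun (n : 'I_N) w => reim (channel M j l k w n 0)) n').
Qed.

Lemma mom_other_channels i' n' : (i', n') != (i, n) -> mom P measurable (chan i' n') ->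
  mom P other_channels (chan i' n').
Proof.
move=> neq LU; apply: mom_preimage => //; first exact: other_channels_measurable.
move=> D mD; apply: sub_sigma_algebra; have [ii|ii] := eqVneq i' i; last first.
  left; exists i' => //; rewrite /F /chan; case: i' {ii LU neq} => -[j l] k.
  exact: (@sigma_of_preimage _ _ _ _ _ (fun (n : 'I_N) w => reim (channel M j l k w n 0)) n').
right; exists n' => /=; first by move: neq; rewrite ii xpair_eqE eqxx.
rewrite ii /H /chan; case: i => -[j l] k.
exact: (@sigma_of_preimage _ _ _ _ _ (fun (_ : unit) w => reim (channel M j l k w n' 0)) tt).
Qed.

Lemma mom_channel : mom P CH (chan i n).
Proof.
have [LU _ _ _] := condE_channel; apply: mom_preimage => // D mD; apply: sub_sigma_algebra.
rewrite /chan; case: i => -[j l] k.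
exact: (@sigma_of_preimage _ _ _ _ _ (fun (i : 'I_L * 'I_L * 'I_K * 'I_N) w =>
    let: (j, l, k, n) := i in reim (channel M j l k w n 0)) (j, l, k, n)).
Qed.

End Channel.

(** * One receiver noise sample given channels, phases and the other samples *)

Section Noise.
Variables (j : 'I_L) (n : 'I_N) (t : 'I_T).
Let F (t : 'I_T) : set (set Omega) := sigma_of (fun (n : 'I_N) w => reim (noise M j t.+1 w n 0)).
Let H (n : 'I_N) : set (set Omega) := sigma_of (fun (_ : unit) w => reim (noise M j t.+1 w n 0)).

(** Contains no distortion, which therefore has to be averaged out before the noise. *)
Definition other_noise : set (set Omega) := (CH `|` PH) `|`
  (\bigcup_(t' in [set t' | t' != t]) F t' `|` \bigcup_(n' in [set n' | n' != n]) H n').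

Let sF t' : sigalg (F t').
Proof. by apply: sigalg_sigma_of => n'; apply: (um_noise_meas hM); exact: time. Qed.

Let sH n' : sigalg (H n').
Proof. by apply: sigalg_sigma_of => _; apply: (um_noise_meas hM); exact: time. Qed.

Let m2 : \bigcup_(t' in [set t' | t' != t]) F t' `|` \bigcup_(n' in [set n' | n' != n]) H n' `<=` measurable.
Proof.
move=> X [[t' _ hX]|[n' _ hX]].
  by have [m _ _ _] := sF t'; exact: m.
by have [m _ _ _] := sH n'; exact: m.
Qed.

Lemma other_noise_measurable : other_noise `<=` measurable.
Proof. by move=> X [[hX|hX]|hX]; [exact: mCH|exact: mPH|exact: m2]. Qed.

Let FNO t' : F t' `<=` NO.
Proof.
have [_ _ _ sN] := sigalg_noise; apply: subset_trans sN; apply: sigma_of_sub => n' D mD.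
apply: sub_sigma_algebra.
exact: (@sigma_of_preimage _ _ _ _ _ (fun (i : 'I_L * 'I_N * 'I_T) w =>
    let: (j, n, t) := i in reim (noise M j t.+1 w n 0)) (j, n', t')).
Qed.

Let HF n' : H n' `<=` F t.
Proof.
have [_ _ _ sN] := sF t; apply: subset_trans sN; apply: sigma_of_sub => _ D mD.
apply: sub_sigma_algebra.
exact: (@sigma_of_preimage _ _ _ _ _ (fun (n : 'I_N) w => reim (noise M j t.+1 w n 0)) n').
Qed.

Lemma condE_noise : let U w := noise M j t.+1 w n 0 in
  [/\ mom P measurable U, condE P other_noise U (fun _ => 0),
      condE P other_noise (fun w => U w * Num.conj (U w)) (fun _ => (sigma M ^+ 2 * xi M)%:C) &
      condE P other_noise (fun w => (U w * Num.conj (U w)) ^+ 2) (fun _ => 2 * (sigma M ^+ 2 * xi M)%:C ^+ 2)].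
Proof.
have Gm := other_noise_measurable.
have s0 : 0 <= sigma M ^+ 2 * xi M.
  by rewrite mulr_ge0 ?sqr_ge0// (le_trans ler01)//; exact: (um_xi hM).
have mU : measurable_fun setT (fun w => reim (noise M j t.+1 w n 0)).
  by apply: (um_noise_meas hM); exact: time.
apply: (@cond_cgauss_condE _ _ _ P other_noise _ (cst (sigma M ^+ 2 * xi M))) => //; first exact: rmom_cst.
have [hl hi] := um_noise_law hM j (time t).
apply: cond_cgauss_indep => //.
have hF : mutual_indep P F by exact: (um_noise_indep hM).
have nested := @mutual_indep_nested _ _ _ P _ _ F H t n sF sH hF hi HF.
have J : indep2 P <<s <<s CH `|` PH>> `|` <<s \bigcup_(t' in [set t' | t' != t]) F t' `|` \bigcup_(n' in [set n' | n' != n]) H n'>> >> (H n).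
  apply: (indep2_join (FF := NO)) => //.
  - by apply: sigalg_gen => X [hX|hX]; [exact: mCH|exact: mPH].
  - exact: sigalg_noise.
  - exact: sigalg_gen.
  - have [_ _ _ sN] := sigalg_noise; apply: subset_trans sN; apply: sigma_sub => X hX.
    apply: sub_sigma_algebra; move: hX => [[t' _]|[n' _ hX]]; first exact: FNO.
    exact: (@FNO t X (@HF n' X hX)).
  - by move=> X hX; exact: (@FNO t X (@HF n X hX)).
apply: (indep2_sub _ _ J) => //.
by apply: sigma_sub => X [hX|hX]; apply: sub_sigma_algebra; [left|right]; exact: sub_sigma_algebra.
Qed.

Lemma mom_other_noise n' t' : (n', t') != (n, t) -> mom P measurable (fun w => noise M j t'.+1 w n' 0) ->
  mom P other_noise (fun w => noise M j t'.+1 w n' 0).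
Proof.
move=> neq LU; apply: mom_preimage => //; first exact: other_noise_measurable.
move=> D mD; apply: sub_sigma_algebra; right; have [tt'|tt'] := eqVneq t' t; last first.
  left; exists t' => //.
  exact: (@sigma_of_preimage _ _ _ _ _ (fun (n : 'I_N) w => reim (noise M j t'.+1 w n 0)) n').
right; exists n' => /=; first by move: neq; rewrite tt' xpair_eqE eqxx andbT.
rewrite tt'.
exact: (@sigma_of_preimage _ _ _ _ _ (fun (_ : unit) w => reim (noise M j t.+1 w n' 0)) tt).
Qed.

Lemma mom_noise : mom P NO (fun w => noise M j t.+1 w n 0).
Proof.
have [LU _ _ _] := condE_noise; apply: mom_preimage => // D mD; apply: sub_sigma_algebra.
exact: (@sigma_of_preimage _ _ _ _ _ (fun (i : 'I_L * 'I_N * 'I_T) w =>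
    let: (j, n, t) := i in reim (noise M j t.+1 w n 0)) (j, n, t)).
Qed.

End Noise.

(** * Phase increments given the past *)

Section Phase.
Variables (j : 'I_L) (n : 'I_N).
Let F (n : 'I_N) : set (set Omega) := sigma_of (fun (t : 'I_T) w => phase M j n t.+1 w : RR).
Let past (t : nat) : set (set Omega) := sigma_of (fun (s : 'I_t) w => phase M j n s.+1 w : RR).
Let inc (t : nat) : set (set Omega) := sigma_of (fun (_ : unit) w => phase M j n t.+1 w - phase M j n t w : RR).

(** The channels, the phases of the other antennas over the whole block, and the phase of antenna
    [n] at channel uses 1 to [t]. Noise and distortion are absent: they are removed earlier. *)
Definition phase_past (t : nat) : set (set Omega) :=
  CH `|` (\bigcup_(n' in [set n' | n' != n]) F n' `|` past t).

Let sF n' : sigalg (F n').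
Proof. by apply: sigalg_sigma_of => t; apply: (um_phase_meas hM); exact: time. Qed.

Let spast t : (t <= T)%N -> sigalg (past t).
Proof.
move=> tT; apply: sigalg_sigma_of => s; apply: (um_phase_meas hM).
by rewrite /= (leq_trans (ltn_ord s)).
Qed.

Let sinc t : (1 <= t < T)%N -> sigalg (inc t).
Proof.
move=> /andP[t1 tT]; apply: sigalg_sigma_of => _; apply: measurable_funB; apply: (um_phase_meas hM).
  by rewrite /= tT.
by rewrite t1 ltnW.
Qed.

Let pastF t : (t <= T)%N -> past t `<=` F n.
Proof.
move=> tT; have [_ _ _ sN] := sF n; apply: subset_trans sN; apply: sigma_of_sub => s D mD.
apply: sub_sigma_algebra.
exact: (@sigma_of_preimage _ _ _ _ _ (fun (t : 'I_T) w => phase M j n t.+1 w : RR) (widen_ord tT s)).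
Qed.

Let incF t : (1 <= t < T)%N -> inc t `<=` F n.
Proof.
case: t => // t /andP[_ tT]; have [_ _ _ sN] := sF n; apply: subset_trans sN; apply: sigma_of_sub => _ D mD.
have mp (s : 'I_T) : measurable_fun (setT : set (g_sigma_algebraType (F n)))
    (phase M j n s.+1 : g_sigma_algebraType (F n) -> RR).
  apply: preimage_measurable_sigma => E mE; apply: sub_sigma_algebra.
  exact: (@sigma_of_preimage _ _ _ _ _ (fun (t : 'I_T) w => phase M j n t.+1 w : RR) s).
have := measurable_funB (mp (Ordinal tT)) (mp (Ordinal (ltnW tT))) measurableT mD.
by rewrite setTI.
Qed.

Let FPH n' : F n' `<=` PH.
Proof.
have [_ _ _ sN] := sigalg_phases; apply: subset_trans sN; apply: sigma_of_sub => s D mD.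
apply: sub_sigma_algebra.
exact: (@sigma_of_preimage _ _ _ _ _ (fun (i : 'I_L * 'I_N * 'I_T) (w : Omega) =>
    let: (j, n, t) := i in phase M j n t.+1 w : measurableTypeR R) (j, n', s)).
Qed.

Let m2 t : (t <= T)%N -> \bigcup_(n' in [set n' | n' != n]) F n' `|` past t `<=` measurable.
Proof.
move=> tT X [[n' _ hX]|hX].
  by have [m _ _ _] := sF n'; exact: m.
by have [m _ _ _] := spast tT; exact: m.
Qed.

Lemma phase_past_measurable t : (t <= T)%N -> phase_past t `<=` measurable.
Proof. by move=> tT X [hX|hX]; [exact: mCH|exact: m2 hX]. Qed.

(** Independence of increment and past, and independence of the antennas, combine inside [PH]; since
    [PH] is independent of the channels, [CH] can be added. *)
Let indep_inc t : (1 <= t < T)%N -> indep2 P <<s phase_past t>> (inc t).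
Proof.
move=> /[dup] ht /andP[t1 tT]; have tT' := ltnW tT.
pose H := tnth [tuple inc t; past t].
have sH i : sigalg (H i).
  by case: i => -[|[|//]] h; [exact: sinc|exact: spast].
have HF i : H i `<=` F n.
  by case: i => -[|[|//]] h; [exact: incF|exact: pastF].
pose k0 : 'I_2 := @Ordinal 2 0 isT. pose k1 : 'I_2 := @Ordinal 2 1 isT.
have hF : mutual_indep P F by exact: (um_phase_indep hM).
have hH : mutual_indep P H by exact: (um_phase_incr hM).
have nested := @mutual_indep_nested _ _ _ P _ _ F H n k0 sF sH hF hH HF.
have sub : \bigcup_(n' in [set n' | n' != n]) F n' `|` past t `<=`
    <<s \bigcup_(n' in [set n' | n' != n]) F n' `|` \bigcup_(k in [set k | k != k0]) H k>>.
  by move=> X [hX|hX]; apply: sub_sigma_algebra; [left|right; exists k1].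
have nested' : indep2 P <<s \bigcup_(n' in [set n' | n' != n]) F n' `|` past t>> (inc t).
  by apply: (indep2_sub _ _ nested) => //; exact: sigma_sub.
have J : indep2 P <<s CH `|` <<s \bigcup_(n' in [set n' | n' != n]) F n' `|` past t>> >> (inc t).
  apply: (indep2_join (FF := PH)) => //.
  - exact: sigalg_channels.
  - exact: sigalg_phases.
  - by apply: sigalg_gen; exact: m2.
  - have [_ _ _ sN] := sigalg_phases; apply: subset_trans sN; apply: sigma_sub => X hX.
    apply: sub_sigma_algebra; move: hX => [[n' _]|hX]; first exact: FPH.
    exact: (@FPH n X (@pastF t tT' X hX)).
  - by move=> X hX; exact: (@FPH n X (@incF t ht X hX)).
apply: (indep2_sub _ _ J) => //.
by apply: sigma_sub => X [hX|hX]; apply: sub_sigma_algebra; [left|right]; [|exact: sub_sigma_algebra].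
Qed.

Let condE_inc t : (1 <= t < T)%N ->
  condE P (phase_past t) (fun w => cis (phase M j n t.+1 w - phase M j n t w))
    (fun _ => (expR (- (delta M / 2)))%:C).
Proof.
move=> /[dup] ht /andP[t1 tT]; apply: condE_cis.
- exact: (um_delta hM).
- exact/phase_past_measurable/ltnW.
- by apply: measurable_funB; apply: (um_phase_meas hM); rewrite /= ?tT// t1 ltnW.
- move=> A D hA mD; rewrite (indep_inc ht)//.
    by rewrite (um_phase_law hM j n ht)//.
  exact: (@sigma_of_preimage _ _ _ _ _ (fun (_ : unit) w => phase M j n t.+1 w - phase M j n t w : RR) tt).
Qed.

Lemma mom_phase (t : nat) : (1 <= t <= T)%N -> mom P PH (fun w => cis (phase M j n t w)).
Proof.
case: t => // t /andP[_ tT]; apply: mom_cis => //; apply: preimage_measurable_sigma => D mD.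
apply: sub_sigma_algebra.
exact: (@sigma_of_preimage _ _ _ _ _ (fun (i : 'I_L * 'I_N * 'I_T) (w : Omega) =>
    let: (j, n, t) := i in phase M j n t.+1 w : measurableTypeR R) (j, n, Ordinal tT)).
Qed.

Lemma mom_phase_past n' s t : n' != n -> (1 <= t <= T)%N -> (s <= T)%N ->
  mom P (phase_past s) (fun w => cis (phase M j n' t w)).
Proof.
case: t => // t nn /andP[_ tT] sT; apply: mom_cis; first exact: phase_past_measurable.
apply: preimage_measurable_sigma => D mD; apply: sub_sigma_algebra; right; left; exists n' => //.
exact: (@sigma_of_preimage _ _ _ _ _ (fun (t : 'I_T) w => phase M j n' t.+1 w : RR) (Ordinal tT)).
Qed.

(** Induction on [t]: the increment from [t] to [t.+1] is averaged given the past up to [t], which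
    contains the past up to [s], and contributes a factor [exp(- delta / 2)]. The arbitrary initial
    phase cancels in the product. *)
Lemma condE_phase s t : (1 <= s <= t)%N -> (t <= T)%N ->
  condE P (phase_past s) (fun w => cis (phase M j n t w) * Num.conj (cis (phase M j n s w)))
    (fun _ => (expR (- (delta M / 2) * (t - s)%:R))%:C).
Proof.
move=> /andP[s1]; elim: t => [|t IH].
  by rewrite leqn0 => /eqP s0; rewrite s0 in s1.
rewrite leq_eqVlt => /predU1P[->|st] tT.
  rewrite subnn mulr0 expR0.
  have -> : (fun w => cis (phase M j n t.+1 w) * Num.conj (cis (phase M j n t.+1 w))) = (fun _ : Omega => 1).
    by apply/funext => w; rewrite cis_conj.
  by apply: condE_id; exact: mom_cst.
have t1 : (1 <= t < T)%N by rewrite tT (leq_trans s1).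
have {}IH := IH st (ltnW tT); have [LIH Lc _] := IH.
have sub : phase_past s `<=` <<s phase_past t>>.
  move=> X [hX|[hX|hX]]; [by apply: sub_sigma_algebra; left|by apply: sub_sigma_algebra; right; left|].
  move: X hX; apply: sigma_of_sub => u D mD; apply: sub_sigma_algebra; right; right.
  exact: (@sigma_of_preimage _ _ _ _ _ (fun (s : 'I_t) w => phase M j n s.+1 w : RR) (widen_ord (st : (s <= t)%N) u)).
have pastmom (u : nat) : (1 <= u <= t)%N -> mom P (phase_past t) (fun w => cis (phase M j n u w)).
  case: u => // u /andP[_ ut]; apply: mom_cis; first by apply: phase_past_measurable; exact: ltnW.
  apply: preimage_measurable_sigma => D mD; apply: sub_sigma_algebra; right; right.
  exact: (@sigma_of_preimage _ _ _ _ _ (fun (s : 'I_t) w => phase M j n s.+1 w : RR) (Ordinal ut)).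
have LX : mom P (phase_past t) (fun w => cis (phase M j n t w) * Num.conj (cis (phase M j n s w))).
  by apply: momM; [|apply: momJ]; apply: pastmom; rewrite ?leqnn ?s1//; case/andP: t1 => -> _.
have step := condE_sub sub (phase_past_measurable (ltnW tT)) (condE_mull LX (condE_inc t1)).
have c := condE_mull (mom_cst P (expR (- (delta M / 2)))%:C (phase_past_measurable (leq_trans (st : (s <= t)%N) (ltnW tT)))) IH.
have -> : (fun w => cis (phase M j n t.+1 w) * Num.conj (cis (phase M j n s w))) =
   (fun w => cis (phase M j n t w) * Num.conj (cis (phase M j n s w)) * cis (phase M j n t.+1 w - phase M j n t w)).
  apply/funext => w; rewrite -!cisB; have D (x y : R) : cis x * cis y = cis (x + y).
    apply/eqP; rewrite eq_complex /= cosD sinD; apply/andP; split; apply/eqP; ring.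
  by rewrite D; congr cis; ring.
have -> : (fun _ : Omega => (expR (- (delta M / 2) * (t.+1 - s)%:R))%:C) =
   (fun _ => (expR (- (delta M / 2)))%:C * (expR (- (delta M / 2) * (t - s)%:R))%:C).
  apply/funext => w; rewrite -rmorphM /= -expRD; congr (expR _)%:C.
  by rewrite subSn// -natr1; ring.
apply: condE_trans step _; under eq_fun do rewrite mulrC.
exact: c.
Qed.

End Phase.

Definition mean_power (l : 'I_L) (k : 'I_K) (t : nat) : R[i] :=
  cexpect P (fun w => `|symbol M l k t w| ^+ 2).

Lemma mean_power_ge0 l k t : 0 <= mean_power l k t.
Proof. by apply: cexpect_ge0 => w; exact: exprn_ge0. Qed.

Let prod_upd (I J : finType) (g g' : I -> J -> \bar R) (k0 : I) (j0 : J) (c : \bar R) :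
  g k0 j0 = 1%E -> g' k0 j0 = c -> (forall i j, (i, j) != (k0, j0) -> g' i j = g i j) ->
  (\prod_i \prod_j g' i j = c * \prod_i \prod_j g i j)%E.
Proof.
move=> g1 g'c gg'; rewrite (bigD1 k0)// (bigD1 j0)//= g'c.
rewrite [in RHS](bigD1 k0)// [in RHS](bigD1 j0)//= g1 mul1e muleA; congr (_ * _ * _)%E.
  by apply: eq_bigr => j jj; rewrite gg'// xpair_eqE eqxx (negbTE jj).
by apply: eq_bigr => i ii; apply: eq_bigr => j _; rewrite gg'// xpair_eqE (negbTE ii).
Qed.

(** * One distortion sample given channels, phases, noise and the other samples *)

Section Distortion.
Variables (j : 'I_L) (n : 'I_N) (t : 'I_T).

Definition distortion_var (n : 'I_N) (t : nat) (w : Omega) : R := complex.Re (Upsilon P M j t w n n).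

Lemma UpsilonE m s w : Upsilon P M j s w m m = (kappa M ^+ 2)%:C *
  \sum_l \sum_k mean_power l k s * (chan (j, l, k) m w * Num.conj (chan (j, l, k) m w)).
Proof.
rewrite /Upsilon !mxE summxE; congr (_ * _); apply: eq_bigr => l _.
rewrite summxE; apply: eq_bigr => k _.
by rewrite !mxE eqxx mulr1n normCK.
Qed.

Lemma distortion_varE m s w : (distortion_var m s w)%:C = (kappa M ^+ 2)%:C *
  \sum_l \sum_k mean_power l k s * (chan (j, l, k) m w * Num.conj (chan (j, l, k) m w)).
Proof.
rewrite -UpsilonE /distortion_var.
have : 0 <= Upsilon P M j s w m m.
  rewrite UpsilonE mulr_ge0//; first by rewrite lecR sqr_ge0.
  apply: sumr_ge0 => l _; apply: sumr_ge0 => k _; rewrite mulr_ge0 ?mean_power_ge0//.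
  by rewrite -normCK exprn_ge0.
by case: (Upsilon P M j s w m m) => a b; rewrite lecE /= => /andP[/eqP -> _].
Qed.

Lemma distortion_var_ge0 m s w : 0 <= distortion_var m s w.
Proof.
rewrite -lecR distortion_varE mulr_ge0//; first by rewrite lecR sqr_ge0.
apply: sumr_ge0 => l _; apply: sumr_ge0 => k _; rewrite mulr_ge0 ?mean_power_ge0//.
by rewrite -normCK exprn_ge0.
Qed.

Lemma rmom_distortion_var m s : rmom P CH (distortion_var m s).
Proof.
have : mom P CH (fun w => Upsilon P M j s w m m); last by case.
have -> : (fun w => Upsilon P M j s w m m) = (fun w => (kappa M ^+ 2)%:C *
  \sum_l \sum_k mean_power l k s * (chan (j, l, k) m w * Num.conj (chan (j, l, k) m w))).
  by apply/funext => w; rewrite UpsilonE.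
apply: momM; first exact: mom_cst.
apply: mom_sum => // l _; apply: mom_sum => // k _; apply: momM; first exact: mom_cst.
by apply: momM; [|apply: momJ]; exact: mom_channel.
Qed.

Let dist (p : 'I_N * 'I_T) (w : Omega) : (RR * RR)%type := reim (distortion M j p.2.+1 w p.1 0).
(** The sample to be averaged is replaced by a constant, which generates only trivial events, so
    [sigma_of dist'] is generated by the remaining samples. *)
Let dist' (p : 'I_N * 'I_T) (w : Omega) : (RR * RR)%type :=
  if p == (n, t) then reim (0 : R[i]) else dist p w.

Definition other_distortion : set (set Omega) := (CH `|` <<s PH `|` NO>>) `|` sigma_of dist'.

Let mdist p : measurable_fun setT (dist p).
Proof. by apply: (um_distortion_meas hM); exact: time. Qed.

Let mdist' p : measurable_fun setT (dist' p).
Proof. by rewrite /dist'; case: eqP => _; [exact: measurable_cst|exact: mdist]. Qed.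

Let mPN : PH `|` NO `<=` measurable.
Proof. by move=> X [hX|hX]; [exact: mPH|exact: mNO]. Qed.

Lemma other_distortion_measurable : other_distortion `<=` measurable.
Proof.
move=> X [[hX|hX]|hX]; [exact: mCH|exact: (sigma_measurable mPN)|].
by move: X hX; exact: sigma_of_measurable.
Qed.

(** A family [D] encodes the product event [Edist D], and [f D] is its conditional probability given
    the channels: the model specifies the law of the distortion on such events. *)
Let fam := 'I_N -> 'I_T -> set (RR * RR).
Let mfam (D : fam) := forall n' t', measurable (D n' t').
Let Edist (D : fam) : set Omega := [set w | forall n' (t' : 'I_T), D n' t' (reim (distortion M j t'.+1 w n' 0))].
Let f (D : fam) (w : Omega) : \bar R :=
  (\prod_n \prod_(t < T) cgauss (complex.Re (Upsilon P M j t.+1 w n n)) (D n t))%E.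

Let upd (D : fam) (E : set (RR * RR)) : fam := fun n' t' => if (n', t') == (n, t) then E else D n' t'.

Let mupd D E : mfam D -> measurable E -> mfam (upd D E).
Proof. by move=> mD mE n' t'; rewrite /upd; case: ifP. Qed.

Let law D : mfam D -> cond_prob P CH (Edist D) (f D).
Proof. by move=> mD; exact: (um_distortion_law hM). Qed.

Let cg_setT s : 0 <= s -> cgauss s [set: RR * RR] = 1%E :> \bar R.
Proof. by move=> s0; rewrite cgaussE// preimage_setT; exact: std_normal2_setT. Qed.

Let cg_ge0 s (E : set (RR * RR)) : 0 <= s -> measurable E -> (0 <= cgauss s E :> \bar R)%E.
Proof. by move=> s0 mE; rewrite cgaussE. Qed.

Let cg_fin s (E : set (RR * RR)) : 0 <= s -> measurable E -> (cgauss s E : \bar R) \is a fin_num.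
Proof.
move=> s0 mE; rewrite cgaussE//; apply: fin_num_measure.
by rewrite -[X in measurable X]setTI; exact: measurable_scale2.
Qed.

Let f_upd D E w : D n t = setT -> f (upd D E) w = (cgauss (distortion_var n t.+1 w) E * f D w)%E.
Proof.
move=> DT; apply: (prod_upd (k0 := n) (j0 := t)).
- by rewrite DT cg_setT//; exact: distortion_var_ge0.
- by rewrite /upd eqxx.
- by move=> n' t' ne; rewrite /upd (negbTE ne).
Qed.

Let f_ge0_fin D w : mfam D -> (0 <= f D w)%E /\ f D w \is a fin_num.
Proof.
move=> mD; rewrite /f; elim/big_ind : _ => //.
  by move=> x y [x0 xf] [y0 yf]; split; [exact: mule_ge0|exact: fin_numM].
move=> n' _; elim/big_ind : _ => //.
  by move=> x y [x0 xf] [y0 yf]; split; [exact: mule_ge0|exact: fin_numM].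
move=> t' _; have h := distortion_var_ge0 n' t'.+1 w.
by split; [exact: cg_ge0|exact: cg_fin].
Qed.

Let Edist_sigma D : mfam D -> sigma_distortion M T (Edist D).
Proof.
move=> mD.
have -> : Edist D = \bigcap_(p in [set: 'I_N * 'I_T]) (dist p @^-1` D p.1 p.2).
  by apply/seteqP; split => w; [move=> h [n' t'] _; exact: h|move=> h n' t'; exact: (h (n', t') Logic.I)].
apply: (@fin_bigcap_measurable _ (g_sigma_algebraType _)) => // -[n' t'] _.
exact: (@sigma_of_preimage _ _ _ _ _ (fun (i : 'I_L * 'I_N * 'I_T) w =>
    let: (j, n, t) := i in reim (distortion M j t.+1 w n 0)) (j, n', t')).
Qed.

(** The constant [P E2] is a version of the conditional probability of [E2] given the channels,
    because phases and noise are independent of them; conditional independence then yields the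
    product. *)
Let joint D E2 : mfam D -> <<s PH `|` NO>> E2 ->
  cond_prob P CH (Edist D `&` E2) (fun w => f D w * P E2)%E.
Proof.
move=> mD hE2; apply: (um_distortion_indep hM) => //; [exact: Edist_sigma|exact: law|].
split.
  move=> Y _; have [YP|YP] := pselect (Y (P E2)).
    by rewrite (_ : _ @^-1` _ = setT); [exact: sigma_setT|apply/seteqP; split].
  by rewrite (_ : _ @^-1` _ = set0); [exact: sigma_set0|apply/seteqP; split].
move=> A hA; rewrite (_ : (\int[P]_(w in A) P E2)%E = (\int[P]_(w in A) cst (P E2) w)%E)//.
rewrite integral_cst//; last exact: mCH.
by rewrite setIC indep_channel.
Qed.

(** The slot [(n, t)] is free in [D]. Constraining it by [E] multiplies the conditional probability
    by a Gaussian factor that depends on the channels only, and such a factor can be integrated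
    against the indicator of the event in place of its conditional probability. *)
Let key D E2 E A : mfam D -> D n t = setT -> measurable E -> <<s PH `|` NO>> E2 -> CH A ->
  P (A `&` (Edist D `&` E2) `&` (fun w => reim (distortion M j t.+1 w n 0)) @^-1` E) =
  (\int[P]_(w in A `&` (Edist D `&` E2)) cgauss (distortion_var n t.+1 w) E)%E.
Proof.
move=> mD DT mE hE2 hA.
have mA : measurable A := mCH hA.
have mEd D' : mfam D' -> measurable (Edist D').
  move=> mD'; have : sigma_distortion M T `<=` measurable.
    by apply: sigma_of_measurable => -[[j' n'] t']; apply: (um_distortion_meas hM); exact: time.
  by apply; exact: Edist_sigma.
have mE2 : measurable E2 by exact: (sigma_measurable mPN).
have mEE : measurable (Edist D `&` E2) by apply: measurableI => //; exact: mEd.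
(* The constraint on the sample is absorbed into the product event. *)
transitivity (P (A `&` (Edist (upd D E) `&` E2))).
  congr (P _); rewrite -!setIA; congr (A `&` _); apply/seteqP; split => w /=.
    move=> [h [h2 hE]]; split => // n' t'; rewrite /upd; case: eqP => [[-> ->]//|_]; exact: h.
  move=> [h h2]; have hnt := h n t; rewrite /upd eqxx in hnt; split => //.
  move=> n' t'; have [[-> ->]|ne] := eqVneq (n', t') (n, t); first by rewrite DT.
  by have := h n' t'; rewrite /upd (negbTE ne).
have [_ <-//] := joint (mupd mD mE) hE2.
pose q (w : Omega) : \bar R := cgauss (distortion_var n t.+1 w) E.
have q0 w : (0 <= q w)%E by apply: cg_ge0 => //; exact: distortion_var_ge0.
(* That the factor is measurable in the channels comes with [cond_prob], applied to the event whose
   only constraint is [E] in slot [(n, t)]. *)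
have mq : measurable_fun (setT : set (g_sigma_algebraType CH)) (q : g_sigma_algebraType CH -> \bar R).
  pose DT' : fam := fun _ _ => setT.
  have mDT : mfam DT' by move=> ? ?; exact: measurableT.
  have [h _] := law (mupd mDT mE).
  have qE : q = f (upd DT' E).
    apply/funext => w; rewrite f_upd// /q (_ : f DT' w = 1%E) ?mule1//.
    by rewrite /f big1// => n' _; rewrite big1// => t' _; rewrite cg_setT//; exact: distortion_var_ge0.
  move=> _ Y mY; rewrite setTI qE; apply: sub_sigma_algebra; exact: h.
have [hu hA'] := joint mD hE2.
have mu2 : measurable_fun setT (fun w => f D w * P E2)%E.
  by move=> _ Y mY; rewrite setTI; apply: mCH; exact: hu.
have mid : measurable_fun (setT : set Omega) (id : Omega -> g_sigma_algebraType CH).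
  by move=> _ Y mY; rewrite setTI preimage_id; exact: (sigma_measurable mCH).
have mA1 : measurable_fun (setT : set (g_sigma_algebraType CH)) ((\1_A : Omega -> R) : g_sigma_algebraType CH -> R).
  by apply: measurable_indic; exact: sub_sigma_algebra.
pose qA (w : Omega) : \bar R := (q w * (\1_A w)%:E)%E.
have mqA : measurable_fun (setT : set (g_sigma_algebraType CH)) (qA : g_sigma_algebraType CH -> \bar R).
  by apply: emeasurable_funM => //; exact/measurable_EFinP.
have qA0 w : (0 <= qA w)%E by rewrite mule_ge0// lee_fin.
have mE1 : measurable_fun setT (EFin \o (\1_(Edist D `&` E2) : Omega -> R)).
  by apply/measurable_EFinP; exact: measurable_indic.
have [_ _ _ sCH] := sigalg_channels.
have eqA (X : set Omega) : <<s CH>> X ->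
    (\int[P]_(w in X) (EFin \o (\1_(Edist D `&` E2) : Omega -> R)) w = \int[P]_(w in X) (f D w * P E2))%E.
  move=> /sCH hX; rewrite hA'//.
  transitivity (P ((Edist D `&` E2) `&` X)); last by congr (P _); exact: setIC.
  by rewrite integral_indic//; exact: mCH.
have PE2f : P E2 \is a fin_num by exact: fin_num_measure.
(* The indicator of the event and its conditional probability have the same integral against [qA],
   which is measurable with respect to the channels. *)
have T1 := @ge0_integral_transfer _ _ _ Omega Omega (g_sigma_algebraType CH) R P P id id
  (EFin \o (\1_(Edist D `&` E2) : Omega -> R)) (fun w => f D w * P E2)%E mid mid mE1 mu2
  (fun w => lee_tofin (ler0n _ _)) (fun w => mule_ge0 (f_ge0_fin w mD).1 (measure_ge0 P E2))
  (fun w => erefl) (fun w => fin_numM (f_ge0_fin w mD).2 PE2f) qA eqA mqA qA0.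
transitivity (\int[P]_w (qA w * (f D w * P E2)))%E.
  rewrite integral_mkcond; apply: eq_integral => w _; rewrite epatch_indic /=.
  by rewrite f_upd// /qA -/(q w) muleAC -!muleA; congr (_ * _)%E; rewrite muleCA.
rewrite -T1 [RHS]integral_mkcond; apply: eq_integral => w _; rewrite epatch_indic /= /qA -muleA -EFinM.
by rewrite [in RHS]indicI.
Qed.

(** The product events of [key] form a pi-system from which the free slot keeps the sample itself
    out; [cond_cgauss_pi] extends the conditional law to the sigma-algebra that they generate. *)
Lemma condE_distortion : let U w := distortion M j t.+1 w n 0 in
  [/\ mom P measurable U, condE P other_distortion U (fun _ => 0),
      condE P other_distortion (fun w => U w * Num.conj (U w)) (fun w => (distortion_var n t.+1 w)%:C) &
      condE P other_distortion (fun w => (U w * Num.conj (U w)) ^+ 2)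
        (fun w => 2 * (distortion_var n t.+1 w)%:C ^+ 2)].
Proof.
have Gm := other_distortion_measurable.
have mU : measurable_fun setT (fun w => reim (distortion M j t.+1 w n 0)).
  by apply: (um_distortion_meas hM); exact: time.
have CHsub : CH `<=` <<s other_distortion>> by move=> X hX; apply: sub_sigma_algebra; left; left.
have LS := rmom_sub CHsub Gm (rmom_distortion_var n t.+1).
apply: (@cond_cgauss_condE _ _ _ P other_distortion _ (distortion_var n t.+1)) => //.
  by move=> w; exact: distortion_var_ge0.
pose Pi := [set X | exists A D E2, [/\ CH A, mfam D, D n t = setT, <<s PH `|` NO>> E2 &
  X = A `&` (Edist D `&` E2)]].
have [_ ICH TCH _] := sigalg_channels.
pose DT : fam := fun _ _ => setT.
have mDT : mfam DT by move=> ? ?; exact: measurableT.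
have EDT : Edist DT = setT by apply/seteqP; split.
have mEd D' : mfam D' -> measurable (Edist D').
  move=> mD'; have : sigma_distortion M T `<=` measurable.
    by apply: sigma_of_measurable => -[[j' n'] t']; apply: (um_distortion_meas hM); exact: time.
  by apply; exact: Edist_sigma.
apply: (@cond_cgauss_pi _ _ _ P Pi) => //.
- move=> _ _ [A [D [E [hA mD DnT hE ->]]]] [A' [D' [E' [hA' mD' DnT' hE' ->]]]].
  exists (A `&` A'), (fun n' t' => D n' t' `&` D' n' t'), (E `&` E'); split.
  + exact: ICH.
  + by move=> n' t'; exact: measurableI.
  + by rewrite DnT DnT' setIT.
  + exact: sigma_setI.
  + rewrite setIACA; congr (_ `&` _); rewrite setIACA; congr (_ `&` _).
    by apply/seteqP; split => w; [move=> [h h'] n' t'; split|move=> h; split => n' t'; have [] := h n' t'].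
- move=> _ [A [D [E [hA mD DnT hE ->]]]]; apply: measurableI; first exact: mCH.
  by apply: measurableI; [exact: mEd|exact: (sigma_measurable mPN)].
- by exists setT, DT, setT; split => //; [exact: sigma_setT|rewrite EDT !setIT].
- move=> X [[hX|hX]|].
  + by apply: sub_sigma_algebra; exists X, DT, setT; split => //; [exact: sigma_setT|rewrite EDT !setIT].
  + by apply: sub_sigma_algebra; exists setT, DT, X; split => //; rewrite EDT !setTI.
  + move: X; apply: sigma_of_sub => -[n' t'] D mD; rewrite /dist'; case: eqP => [_|/eqP ne].
      have [h|h] := pselect (D (reim (0 : R[i]))).
        by rewrite (_ : _ @^-1` _ = setT); [exact: sigma_setT|apply/seteqP; split].
      by rewrite (_ : _ @^-1` _ = set0); [exact: sigma_set0|apply/seteqP; split].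
    apply: sub_sigma_algebra.
    exists setT, (fun n1 t1 => if (n1, t1) == (n', t') then D else setT), setT; split => //.
    * by move=> n1 t1; case: ifP => // _; exact: measurableT.
    * by rewrite eq_sym (negbTE ne).
    * exact: sigma_setT.
    * rewrite setTI setIT; apply/seteqP; split => w /=.
        by move=> h n1 t1; case: eqP => // -[-> ->].
      by move=> /(_ n' t'); rewrite eqxx.
- by have [_ m _] := rmom_sub CHsub Gm (rmom_distortion_var n t.+1); exact: (rmom_measurable LS).
- by move=> w; exact: distortion_var_ge0.
- by move=> _ E [A [D [E2 [hA mD DnT hE2 ->]]]] mE; exact: key.
Qed.

Lemma mom_other_distortion n' (t' : 'I_T) : (n', t') != (n, t) ->
  mom P measurable (fun w => distortion M j t'.+1 w n' 0) ->
  mom P other_distortion (fun w => distortion M j t'.+1 w n' 0).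
Proof.
move=> ne LU; apply: mom_preimage => //; first exact: other_distortion_measurable.
move=> D mD; apply: sub_sigma_algebra; right.
have := @sigma_of_preimage _ _ _ _ _ dist' (n', t') D mD.
by rewrite /dist' (negbTE ne).
Qed.

End Distortion.

End Model.
Local Open Scope sesquilinear_scope.

(** * Averaging a centred factor out of a product *)

Section ConditionalExpectation.
Context (R : realType) (d : measure_display) (Omega : measurableType d) (P : probability Omega R).
Local Notation E X := (cexpect P X).
Implicit Types (G : set (set Omega)) (A X W e : Omega -> R[i]).

Lemma eq_cexpect X Y : X =1 Y -> E X = E Y.
Proof. by move=> XY; congr (cexpect P _); exact/funext. Qed.

Lemma condE_vanish G X e : condE P G e (fun _ => 0) -> mom P G X -> E (fun w => X w * e w) = 0.
Proof.
move=> ce LX; rewrite (condE_expect ce LX) -[RHS](cexpect_cst P 0).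
by apply: eq_cexpect => w; rewrite mulr0.
Qed.

Lemma condE_const G X e (v : R[i]) : condE P G e (fun _ => v) -> mom P G X ->
  E (fun w => X w * e w) = v * E X.
Proof.
move=> ce LX; rewrite (condE_expect ce LX) -cexpectZ; last exact: mom_all LX.
by apply: eq_cexpect => w; rewrite mulrC.
Qed.

Lemma condE0J G e : condE P G e (fun _ => 0) -> condE P G (fun w => Num.conj (e w)) (fun _ => 0).
Proof. by move/condEJ; congr condE; apply/funext => w; rewrite rmorph0. Qed.

Lemma cexpect_addl0 G A e X : condE P G e (fun _ => 0) -> mom P G X -> mom P measurable A ->
  E (fun w => (A w + e w) * X w) = E (fun w => A w * X w).
Proof.
move=> ce LX LA; have [Le _ _] := ce; have LX' := mom_all LX.
rewrite (_ : (fun w => (A w + e w) * X w) = (fun w => A w * X w + X w * e w)); last first.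
  by apply/funext => w; rewrite mulrDl [e w * _]mulrC.
rewrite cexpectD; [|exact: momM|exact: momM].
rewrite (condE_expect ce LX) [X in _ + X](_ : _ = 0) ?addr0//.
by rewrite -[RHS](cexpect_cst P 0); apply: eq_cexpect => w; rewrite mulr0.
Qed.

(** In [|A + e|^2] the two cross terms are linear in [e] or its conjugate and vanish, while [|e|^2]
    becomes [V]. The weight [W] will be 1 or a squared channel gain. *)
Lemma cexpect_sqr_addr G A e V W : condE P G e (fun _ => 0) ->
  condE P G (fun w => e w * Num.conj (e w)) V -> mom P G A -> mom P G W ->
  E (fun w => (A w + e w) * Num.conj (A w + e w) * W w) =
  E (fun w => A w * Num.conj (A w) * W w) + E (fun w => V w * W w).
Proof.
move=> ce cee LA LW; have [Le _ _] := ce; have LA' := mom_all LA; have LW' := mom_all LW.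
have [Lee LV _] := cee.
have LAJ := momJ LA; have LAJ' := momJ LA'; have LeJ := momJ Le.
rewrite (_ : (fun w => (A w + e w) * Num.conj (A w + e w) * W w) =
  (fun w => (A w + e w) * (Num.conj (A w) * W w) +
     (A w * W w * Num.conj (e w) + W w * (e w * Num.conj (e w))))); last first.
  by apply/funext => w; rewrite rmorphD /=; ring.
have LAe := momD LA' Le.
rewrite cexpectD; [|by apply: momM => //; exact: momM|by apply: momD; apply: momM => //; exact: momM].
rewrite (cexpect_addl0 ce); [|exact: momM|exact: LA'].
rewrite cexpectD; [|by apply: momM => //; exact: momM|exact: momM].
rewrite (condE_expect (condEJ ce)); last exact: momM.
rewrite (condE_expect cee LW); congr (_ + _); first by apply: eq_cexpect => w; rewrite mulrA.
rewrite [X in X + _](_ : _ = 0) ?add0r; first by apply: eq_cexpect => w; rewrite mulrC.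
by rewrite -[RHS](cexpect_cst P 0); apply: eq_cexpect => w; rewrite rmorph0 mulr0.
Qed.

Lemma cexpect_quad (I : finType) (a : I -> R[i]) (f : I -> Omega -> R[i]) W :
  (forall i, mom P measurable (f i)) -> mom P measurable W ->
  E (fun w => (\sum_i a i * f i w) * Num.conj (\sum_i a i * f i w) * W w) =
  \sum_i \sum_i' (a i * Num.conj (a i')) * E (fun w => f i w * Num.conj (f i' w) * W w).
Proof.
move=> Lf LW; have L i i' : mom P measurable (fun w => f i w * Num.conj (f i' w) * W w).
  by apply: momM => //; apply: momM => //; exact: momJ.
transitivity (E (fun w => \sum_i \sum_i' (a i * Num.conj (a i')) * (f i w * Num.conj (f i' w) * W w))).
  apply: eq_cexpect => w; rewrite rmorph_sum /= !mulr_suml; apply: eq_bigr => i _.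
  rewrite mulr_sumr mulr_suml; apply: eq_bigr => i' _; rewrite rmorphM /=; ring.
rewrite cexpect_sum => [|i _]; last by apply: mom_sum => // i' _; apply: momM => //; exact: mom_cst.
apply: eq_bigr => i _; rewrite cexpect_sum => [|i' _]; last by apply: momM => //; exact: mom_cst.
by apply: eq_bigr => i' _; rewrite cexpectZ.
Qed.

End ConditionalExpectation.

(** * Moments of a linear combiner *)

Section Computation.
Context (R : realType) (d : measure_display) (Omega : measurableType d).
Context (P : probability Omega R) (L K N B T : nat) (M : uplink R Omega L K N B).
Hypothesis hM : uplink_model P M T.
Variable (j : 'I_L).
Local Notation E X := (cexpect P X).
Local Notation CH := (sigma_channels M).
Local Notation PH := (sigma_phases M T).
Local Notation NO := (sigma_noise M T).
Local Notation I := ('I_L * 'I_K)%type.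

Let c (p : I) (n : 'I_N) (w : Omega) : R[i] := chan M (j, p.1, p.2) n w.
Let x (p : I) (s : 'I_B) : R[i] := pilot M p.1 p.2 s 0.
Let lam (p : I) : R[i] := (lambda M j p.1 p.2)%:C.
Let ph (n : 'I_N) (t : nat) (w : Omega) : R[i] := cis (phase M j n t w).
(** The received sample is layered: [u] is linear in the channels, [z] adds the phase, [q] the
    receiver noise, [y] the distortion, and the layers are peeled off from the outside. The index
    [s] counts from 0 and denotes channel use [s.+1]. *)
Let u (n : 'I_N) (s : 'I_B) (w : Omega) : R[i] := \sum_p c p n w * x p s.
Let ups (n : 'I_N) (t : 'I_T) (w : Omega) : R[i] := distortion M j t.+1 w n 0.
Let eta (n : 'I_N) (t : 'I_T) (w : Omega) : R[i] := noise M j t.+1 w n 0.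
Let tm (s : 'I_B) : 'I_T := widen_ord (um_BT hM) s.
Let z (n : 'I_N) (s : 'I_B) (w : Omega) : R[i] := ph n s.+1 w * u n s w.
Let q (n : 'I_N) (s : 'I_B) (w : Omega) : R[i] := z n s w + eta n (tm s) w.
Let y (n : 'I_N) (s : 'I_B) (w : Omega) : R[i] := q n s w + ups n (tm s) w.
Let s2 : R[i] := (sigma M ^+ 2 * xi M)%:C.
Let k2 : R[i] := (kappa M ^+ 2)%:C.
Let rho (r : R) : R[i] := (expR (- (delta M / 2) * r))%:C.

Lemma receivedE n (s : 'I_B) w : received M j s.+1 w n 0 = y n s w.
Proof.
rewrite /received /y /q /z !mxE addrAC; congr (_ + _ + _).
rewrite (bigD1 n)//= [X in _ + X]big1 ?addr0; last first.
  move=> i ni.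
  rewrite /phase_mx !mxE.
  by rewrite eq_sym (negbTE ni) mulr0n mul0r.
rewrite /phase_mx !mxE eqxx mulr1n; congr (_ * _).
rewrite summxE /u -(pair_bigA _ (fun l k => c (l, k) n w * x (l, k) s)) /=; apply: eq_bigr => l _.
rewrite mxE; apply: eq_bigr => k _; rewrite /channel_mx /symbol_vec !mxE (um_pilot hM)//.
Qed.

Let mCH : CH `<=` measurable. Proof. by have [] := sigalg_channels hM. Qed.
Let mPH : PH `<=` measurable. Proof. by have [] := sigalg_phases hM. Qed.
Let mNO : NO `<=` measurable. Proof. by have [] := sigalg_noise hM. Qed.

Let momc p n : mom P CH (c p n). Proof. exact: (mom_channel hM). Qed.
Let momcM p n : mom P measurable (c p n). Proof. exact: mom_all (momc p n). Qed.
Let momu n s : mom P CH (u n s).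
Proof. by apply: mom_sum => // p _; apply: momM => //; exact: mom_cst. Qed.
Let momph n t : (1 <= t <= T)%N -> mom P PH (ph n t). Proof. exact: (mom_phase hM). Qed.
Let mometa n t : mom P NO (eta n t). Proof. exact: (mom_noise hM). Qed.
Let momups n t : mom P measurable (ups n t). Proof. by have [] := condE_distortion hM j n t. Qed.
Let pilot_time (s : 'I_B) : (1 <= s.+1 <= T)%N.
Proof. by rewrite /= (leq_trans (ltn_ord s) (um_BT hM)). Qed.

Local Notation GU n t := (other_distortion M j n t).
Local Notation GN n t := (other_noise M j n t).
Local Notation GP n s := (phase_past T M j n s).

Let GUm (n : 'I_N) (t : 'I_T) : GU n t `<=` measurable. Proof. exact: (other_distortion_measurable hM). Qed.
Let GNm (n : 'I_N) (t : 'I_T) : GN n t `<=` measurable. Proof. exact: (other_noise_measurable hM). Qed.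

(** The prefixes name the family with respect to which a variable is measurable: [U_] for all but
    one distortion sample, [N_] for all but one noise sample, [P_] for the past of a phase, and
    later [O_] for all but one channel coefficient. *)
Let U_CH (n : 'I_N) (t : 'I_T) (X : Omega -> R[i]) : mom P CH X -> mom P (GU n t) X.
Proof. by apply: mom_sub => // Y hY; apply: sub_sigma_algebra; left; left. Qed.
Let U_PH (n : 'I_N) (t : 'I_T) (X : Omega -> R[i]) : mom P PH X -> mom P (GU n t) X.
Proof.
by apply: mom_sub => // Y hY; apply: sub_sigma_algebra; left; right; apply: sub_sigma_algebra; left.
Qed.
Let U_NO (n : 'I_N) (t : 'I_T) (X : Omega -> R[i]) : mom P NO X -> mom P (GU n t) X.
Proof.
by apply: mom_sub => // Y hY; apply: sub_sigma_algebra; left; right; apply: sub_sigma_algebra; right.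
Qed.
Let U_ups (n : 'I_N) (t : 'I_T) (n' : 'I_N) (t' : 'I_T) : (n', t') != (n, t) -> mom P (GU n t) (ups n' t').
Proof. by move=> ne; apply: (mom_other_distortion hM ne); exact: momups. Qed.
Let N_CH (n : 'I_N) (t : 'I_T) (X : Omega -> R[i]) : mom P CH X -> mom P (GN n t) X.
Proof. by apply: mom_sub => // Y hY; apply: sub_sigma_algebra; left; left. Qed.
Let N_PH (n : 'I_N) (t : 'I_T) (X : Omega -> R[i]) : mom P PH X -> mom P (GN n t) X.
Proof. by apply: mom_sub => // Y hY; apply: sub_sigma_algebra; left; right. Qed.
Let N_eta (n : 'I_N) (t : 'I_T) (n' : 'I_N) (t' : 'I_T) : (n', t') != (n, t) -> mom P (GN n t) (eta n' t').
Proof. by move=> ne; apply: (mom_other_noise hM ne); exact: mom_all (mometa n' t'). Qed.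
Let P_CH n s X : (s <= T)%N -> mom P CH X -> mom P (GP n s) X.
Proof.
move=> sT; apply: mom_sub => [Y hY|]; first by apply: sub_sigma_algebra; left.
exact: (phase_past_measurable hM).
Qed.

Let U_z (n : 'I_N) (t : 'I_T) (n' : 'I_N) (s : 'I_B) : mom P (GU n t) (z n' s).
Proof. by apply: momM; [exact/U_PH/momph|exact: U_CH]. Qed.
Let N_z (n : 'I_N) (t : 'I_T) (n' : 'I_N) (s : 'I_B) : mom P (GN n t) (z n' s).
Proof. by apply: momM; [exact/N_PH/momph|exact: N_CH]. Qed.
Let U_q (n : 'I_N) (t : 'I_T) (n' : 'I_N) (s : 'I_B) : mom P (GU n t) (q n' s).
Proof. by apply: momD; [exact: U_z|exact/U_NO/mometa]. Qed.
Let U_y (n : 'I_N) (t : 'I_T) (n' : 'I_N) (s : 'I_B) : (n', tm s) != (n, t) -> mom P (GU n t) (y n' s).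
Proof. by move=> ne; apply: momD; [exact: U_q|exact: U_ups]. Qed.
Let N_q (n : 'I_N) (t : 'I_T) (n' : 'I_N) (s : 'I_B) : (n', tm s) != (n, t) -> mom P (GN n t) (q n' s).
Proof. by move=> ne; apply: momD; [exact: N_z|exact: N_eta]. Qed.
Let momz n s : mom P measurable (z n s). Proof. by apply: momM; [exact/(mom_all (momph _ _))|exact/(mom_all (momu _ _))]. Qed.
Let momq n s : mom P measurable (q n s). Proof. by apply: momD => //; exact: mom_all (mometa _ _). Qed.
Let momy n s : mom P measurable (y n s). Proof. exact: momD. Qed.

Let ce_ups (n : 'I_N) (t : 'I_T) : condE P (GU n t) (ups n t) (fun _ => 0).
Proof. by have [] := condE_distortion hM j n t. Qed.
Let ce_upsJ (n : 'I_N) (t : 'I_T) : condE P (GU n t) (fun w => Num.conj (ups n t w)) (fun _ => 0).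
Proof. exact: condE0J (ce_ups n t). Qed.
Let ce_eta (n : 'I_N) (t : 'I_T) : condE P (GN n t) (eta n t) (fun _ => 0).
Proof. by have [] := condE_noise hM j n t. Qed.
Let ce_etaJ (n : 'I_N) (t : 'I_T) : condE P (GN n t) (fun w => Num.conj (eta n t w)) (fun _ => 0).
Proof. exact: condE0J (ce_eta n t). Qed.

Let tm_inj s s' : (tm s == tm s') = (s == s'). Proof. by []. Qed.

(** For [s != s'] each distortion sample is multiplied by factors known when it is averaged, and
    drops out; for [s = s'] its variance remains, as a function of the channels. *)
Let y_to_q n s s' W : mom P CH W ->
  E (fun w => y n s w * Num.conj (y n s' w) * W w) =
  E (fun w => q n s w * Num.conj (q n s' w) * W w) +
  (if s == s' then E (fun w => (distortion_var P M j n s.+1 w)%:C * W w) else 0).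
Proof.
move=> LW; have LW' := mom_all LW; have [<-|ss'] := eqVneq s s'.
  have [_ ce cee _] := condE_distortion hM j n (tm s).
  by rewrite (cexpect_sqr_addr ce cee) //; exact: U_CH.
have ne : (n, tm s') != (n, tm s) by rewrite xpair_eqE eqxx tm_inj eq_sym.
have ne' : (n, tm s) != (n, tm s') by rewrite eq_sym.
rewrite addr0; under eq_cexpect do rewrite -mulrA.
rewrite (cexpect_addl0 (ce_ups n (tm s))) //; last by apply: momM; [apply: momJ; exact: U_y|exact: U_CH].
under eq_cexpect do rewrite mulrCA /y rmorphD /=.
rewrite (cexpect_addl0 (ce_upsJ n (tm s'))).
- by apply: eq_cexpect => w; ring.
- by apply: momM; [exact: U_q|exact: U_CH].
- exact: momJ.
Qed.

Let q_to_z n s s' W : mom P CH W ->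
  E (fun w => q n s w * Num.conj (q n s' w) * W w) =
  E (fun w => z n s w * Num.conj (z n s' w) * W w) +
  (if s == s' then s2 * E W else 0).
Proof.
move=> LW; have LW' := mom_all LW; have [<-|ss'] := eqVneq s s'.
  have [_ ce cee _] := condE_noise hM j n (tm s).
  by rewrite (cexpect_sqr_addr ce cee) //; [rewrite cexpectZ|exact: N_CH].
have ne : (n, tm s') != (n, tm s) by rewrite xpair_eqE eqxx tm_inj eq_sym.
rewrite addr0; under eq_cexpect do rewrite -mulrA.
rewrite (cexpect_addl0 (ce_eta n (tm s))) //; last by apply: momM; [apply: momJ; exact: N_q|exact: N_CH].
under eq_cexpect do rewrite mulrCA /q rmorphD /=.
rewrite (cexpect_addl0 (ce_etaJ n (tm s'))).
- by apply: eq_cexpect => w; ring.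
- by apply: momM; [exact: N_z|exact: N_CH].
- exact: momJ.
Qed.

Let phase_corr n (s t : nat) X : (1 <= s <= t)%N -> (t <= T)%N -> mom P (GP n s) X ->
  E (fun w => X w * (ph n t w * Num.conj (ph n s w))) = rho (t - s)%:R * E X.
Proof.
move=> st tT LX; rewrite (condE_expect (condE_phase hM j n st tT) LX) -cexpectZ; last exact: mom_all LX.
by apply: eq_cexpect => w; rewrite mulrC.
Qed.

Let rhoJ r : Num.conj (rho r) = rho r. Proof. exact: conjc_real. Qed.

(** For [t < s] the case of nonnegative lag is conjugated; [rho] is real, whence the absolute
    value. *)
Let phase_corr_abs n (s t : nat) X : (1 <= s <= T)%N -> (1 <= t <= T)%N -> mom P CH X ->
  E (fun w => X w * (ph n t w * Num.conj (ph n s w))) = rho `|t%:R - s%:R| * E X.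
Proof.
move=> /andP[s1 sT] /andP[t1 tT] LX; have [st|/ltnW ts] := leqP s t.
  by rewrite phase_corr ?s1//; [rewrite natrB// ger0_norm// subr_ge0 ler_nat|exact: P_CH].
have LXJ := momJ LX.
have : E (fun w => Num.conj (X w) * (ph n s w * Num.conj (ph n t w))) = rho (s - t)%:R * E (fun w => Num.conj (X w)).
  by apply: phase_corr; rewrite ?t1//; exact: P_CH.
move/(congr1 (fun z : R[i] => Num.conj z)); rewrite /= rmorphM -cexpectJ /=; last first.
  apply: momM; first exact: mom_all LXJ.
  by apply: momM; [|apply: momJ]; apply: mom_all (momph _ _); rewrite ?s1 ?t1.
rewrite (cexpectJ (mom_all LX)) conjCK rhoJ => h.
rewrite distrC ger0_norm ?subr_ge0 ?ler_nat// -natrB// -h.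
by apply: eq_cexpect => w; rewrite !rmorphM /= !conjCK; ring.
Qed.

(** Under the weight [W] the channels at antenna [n] have a diagonal second moment matrix, with
    diagonal [mu]. An abstract [W] lets one computation give both [E|v_n|^2], with [W = 1], and
    [E(|v_n|^2 |h_n|^2)], with [W = |h_n|^2]. *)
Definition chan_moment (n : 'I_N) (W : Omega -> R[i]) (mu : I -> R[i]) :=
  forall p p', E (fun w => c p n w * Num.conj (c p' n w) * W w) = if p == p' then mu p else 0.

Let uu_moment n s s' W mu : mom P CH W -> chan_moment n W mu ->
  E (fun w => u n s w * Num.conj (u n s' w) * W w) = \sum_p mu p * (x p s * Num.conj (x p s')).
Proof.
move=> LW H; have LW' := mom_all LW.
have Lcc p p' : mom P measurable (fun w => c p n w * Num.conj (c p' n w) * W w).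
  by apply: momM => //; apply: momM => //; exact: momJ.
transitivity (E (fun w => \sum_p \sum_p' (x p s * Num.conj (x p' s')) * (c p n w * Num.conj (c p' n w) * W w))).
  apply: eq_cexpect => w; rewrite /u rmorph_sum /= mulr_suml mulr_suml; apply: eq_bigr => p _.
  rewrite mulr_sumr mulr_suml; apply: eq_bigr => p' _; rewrite rmorphM /=; ring.
rewrite cexpect_sum => [|p _]; last by apply: mom_sum => // p' _; apply: momM => //; exact: mom_cst.
apply: eq_bigr => p _; rewrite cexpect_sum => [|p' _]; last by apply: momM => //; exact: mom_cst.
rewrite (bigD1 p)//= big1 ?addr0; first by rewrite cexpectZ// H eqxx mulrC.
by move=> p' pp'; rewrite cexpectZ// H eq_sym (negbTE pp') mulr0.
Qed.

Let mean_powerE p (s : 'I_B) : mean_power P M p.1 p.2 s.+1 = x p s * Num.conj (x p s).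
Proof.
rewrite /mean_power -(cexpect_cst P (x p s * Num.conj (x p s))); apply: eq_cexpect => w.
by rewrite (um_pilot hM) normCK.
Qed.

Let var_moment n t W mu : mom P CH W -> chan_moment n W mu ->
  E (fun w => (distortion_var P M j n t w)%:C * W w) = k2 * \sum_p mean_power P M p.1 p.2 t * mu p.
Proof.
move=> LW H; have LW' := mom_all LW.
have Lcc p p' : mom P measurable (fun w => c p n w * Num.conj (c p' n w) * W w).
  by apply: momM => //; apply: momM => //; exact: momJ.
transitivity (E (fun w => k2 * \sum_p mean_power P M p.1 p.2 t * (c p n w * Num.conj (c p n w) * W w))).
  apply: eq_cexpect => w; rewrite distortion_varE// -mulrA; congr (_ * _).
  rewrite (pair_bigA _ (fun l k => mean_power P M l k t * (chan M (j, l, k) n w * Num.conj (chan M (j, l, k) n w)))) /=.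
  by rewrite mulr_suml; apply: eq_bigr => p _; rewrite -mulrA.
have Lm p : mom P measurable (fun w => mean_power P M p.1 p.2 t * (c p n w * Num.conj (c p n w) * W w)).
  by apply: momM => //; exact: mom_cst.
rewrite cexpectZ; last exact: mom_sum.
rewrite cexpect_sum//; congr (_ * _); apply: eq_bigr => p _.
by rewrite cexpectZ// H eqxx.
Qed.

(** The phases produce the decay in [|s - s'|], and on the diagonal the distortion, driven by the
    pilot power, adds [kappa^2 |x|^2]: together these are the entries of [Xmx]. *)
Lemma cexpect_yy n s s' W mu : mom P CH W -> chan_moment n W mu ->
  E (fun w => y n s w * Num.conj (y n s' w) * W w) =
  \sum_p mu p * Xmx M p.1 p.2 s s' + (s2 * E W) *+ (s == s').
Proof.
move=> LW H; have LW' := mom_all LW.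
rewrite y_to_q// q_to_z// addrAC; congr (_ + _); last by case: eqP.
have -> : E (fun w => z n s w * Num.conj (z n s' w) * W w) =
    rho `|s.+1%:R - s'.+1%:R| * \sum_p mu p * (x p s * Num.conj (x p s')).
  rewrite -(uu_moment s s' LW H) -(phase_corr_abs n (pilot_time s') (pilot_time s)); last first.
    by apply: momM => //; apply: momM => //; exact: momJ.
  by apply: eq_cexpect => w; rewrite /z rmorphM /=; ring.
rewrite (var_moment s.+1 LW H); case: eqVneq => [<-|ss'].
  rewrite subrr normr0 /rho mulr0 expR0 mul1r mulr_sumr -big_split /=; apply: eq_bigr => p _.
  rewrite mean_powerE /Xmx mxE eqxx normCK -/(x p s) rmorphD /= rmorph1 -/k2; ring.
rewrite addr0 mulr_sumr; apply: eq_bigr => p _.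
rewrite /Xmx mxE (negbTE ss') /rho -!natr1 -/(x p s) -/(x p s').
rewrite (_ : s%:R + 1 - (s'%:R + 1) = s%:R - s'%:R :> R); first by ring.
by ring.
Qed.

Let idx (p : I) : ('I_L * 'I_L * 'I_K)%type := (j, p.1, p.2).

Let idx_neq (p p' : I) (n n' : 'I_N) : (p', n') != (p, n) -> (idx p', n') != (idx p, n).
Proof. by apply: contra => /eqP[] e1 e2 ->; rewrite [p']surjective_pairing e1 e2 -surjective_pairing. Qed.

Local Notation GC p n := (other_channels M (idx p) n).

Let O_c (p p' : I) (n n' : 'I_N) : (p', n') != (p, n) -> mom P (GC p n) (c p' n').
Proof. by move=> ne; apply: (mom_other_channels hM (idx_neq ne)); exact: momcM. Qed.

Let ce_c (p : I) (n : 'I_N) : condE P (GC p n) (c p n) (fun _ => 0).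
Proof. by have [] := condE_channel hM (idx p) n. Qed.

Let ce_cJ (p : I) (n : 'I_N) : condE P (GC p n) (fun w => Num.conj (c p n w)) (fun _ => 0).
Proof. exact: condE0J (ce_c p n). Qed.

Let ce_cc (p : I) (n : 'I_N) : condE P (GC p n) (fun w => c p n w * Num.conj (c p n w)) (fun _ => lam p).
Proof. by have [] := condE_channel hM (idx p) n. Qed.

Let ce_c4 (p : I) (n : 'I_N) :
  condE P (GC p n) (fun w => (c p n w * Num.conj (c p n w)) ^+ 2) (fun _ => 2 * lam p ^+ 2).
Proof. by have [] := condE_channel hM (idx p) n. Qed.

Let GCm (p : I) (n : 'I_N) : GC p n `<=` measurable.
Proof. by have [_ [_ _ _] _ _] := condE_channel hM (idx p) n; exact: (other_channels_measurable hM). Qed.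

Let cc_E (p : I) (n : 'I_N) : E (fun w => c p n w * Num.conj (c p n w)) = lam p.
Proof.
have := condE_const (ce_cc p n) (mom_cst P 1 (@GCm p n)); rewrite cexpect_cst mulr1 => <-.
by apply: eq_cexpect => w; rewrite mul1r.
Qed.

Lemma chan_moment1 n : chan_moment n (fun _ => 1) lam.
Proof.
move=> p p'; have [<-|pp'] := eqVneq p p'.
  by rewrite -(cc_E p n); apply: eq_cexpect => w; rewrite mulr1.
rewrite -[RHS](condE_vanish (ce_c p n) (momJ (O_c (n' := n) _ : mom P (GC p n) (c p' n)))).
  by apply: eq_cexpect => w; rewrite mulr1 mulrC.
by rewrite xpair_eqE eq_sym (negbTE pp').
Qed.

(** If [p != p'], one of them differs from [m]; its coefficient occurs once and is centred given the
    others. If [p = p' = m], the fourth moment [2 lam m ^+ 2] exceeds the product of second moments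
    by [lam m ^+ 2], which is the correction term. *)
Lemma chan_moment2 n m : chan_moment n (fun w => c m n w * Num.conj (c m n w))
  (fun p => lam p * lam m + (lam m ^+ 2) *+ (p == m)).
Proof.
move=> p p'; have O (i i' : I) : i' != i -> mom P (GC i n) (c i' n).
  by move=> qq; apply: O_c; rewrite xpair_eqE (negbTE qq).
have [<-|pp'] := eqVneq p p'.
  have [->|pm] := eqVneq p m.
    have := condE_const (ce_c4 m n) (mom_cst P 1 (@GCm m n)); rewrite cexpect_cst mulr1.
    rewrite (_ : lam m * lam m + lam m ^+ 2 *+ 1 = 2 * lam m ^+ 2); last by rewrite mulr1n; ring.
    by move=> <-; apply: eq_cexpect => w; rewrite mul1r expr2.
  have Lm : mom P (GC p n) (c m n) by apply: O; rewrite eq_sym.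
  rewrite mulr0n addr0 -(cc_E m n) -(condE_const (ce_cc p n)); last by apply: momM => //; exact: momJ.
  by apply: eq_cexpect => w; rewrite mulrC.
have [pm|pm] := eqVneq p m; last first.
  have Lm : mom P (GC p n) (c m n) by apply: O; rewrite eq_sym.
  have Lp' : mom P (GC p n) (c p' n) by apply: O; rewrite eq_sym.
  rewrite -[RHS](condE_vanish (ce_c p n) (momM (momJ Lp') (momM Lm (momJ Lm)))).
  by apply: eq_cexpect => w; ring.
rewrite pm in pp' *; have Lm : mom P (GC p' n) (c m n) by exact: O.
rewrite -[RHS](condE_vanish (ce_cJ p' n) (momM Lm (momM Lm (momJ Lm)))).
by apply: eq_cexpect => w; ring.
Qed.

(** A user other than [m] contributes a single factor at its antenna, centred given all other
    coefficients. What survives is a product of squared gains at two antennas, which are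
    independent. *)
Lemma chan_cross n n' m p p' : n != n' ->
  E (fun w => Num.conj (c p n w) * c m n w * (c p' n' w * Num.conj (c m n' w))) =
  if (p == m) && (p' == m) then lam m ^+ 2 else 0.
Proof.
move=> nn; have O (i i' : I) (n1 n2 : 'I_N) : n2 != n1 -> mom P (GC i n1) (c i' n2).
  by move=> qq; apply: O_c; rewrite xpair_eqE (negbTE qq) andbF.
have O' (i i' : I) (n1 : 'I_N) : i' != i -> mom P (GC i n1) (c i' n1).
  by move=> qq; apply: O_c; rewrite xpair_eqE (negbTE qq).
have n'n : n' != n by rewrite eq_sym.
have [->|pm] := eqVneq p m; last first.
  have Lm : mom P (GC p n) (c m n) by apply: O'; rewrite eq_sym.
  rewrite -[RHS](condE_vanish (ce_cJ p n) (momM Lm (momM (O p p' n n' n'n) (momJ (O p m n n' n'n))))).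
  by apply: eq_cexpect => w; ring.
have [->|p'm] := eqVneq p' m; last first.
  have Lm : mom P (GC p' n') (c m n') by apply: O'; rewrite eq_sym.
  rewrite -[RHS](condE_vanish (ce_c p' n') (momM (momM (momJ (O p' m n' n nn)) (O p' m n' n nn)) (momJ Lm))).
  by apply: eq_cexpect => w; ring.
rewrite /= expr2 -{2}(cc_E m n') -(condE_const (ce_cc m n)); last first.
  by apply: momM; [|apply: momJ]; exact: O.
by apply: eq_cexpect => w; ring.
Qed.

Variable A : 'rV[R[i]]_B.
(** The row [A] stays arbitrary: it is the combining row in the theorem, and a row of the kernel of
    [Psi] in the proof of invertibility. *)
Let V (n : 'I_N) (w : Omega) : R[i] := \sum_s A 0 s * y n s w.

Let momV n : mom P measurable (V n).
Proof. by apply: mom_sum => // s _; apply: momM => //; exact: mom_cst. Qed.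

Let Q (X : 'M[R[i]]_B) : R[i] := (A *m X *m A^t*) 0 0.

Let QE X : Q X = \sum_s \sum_s' (A 0 s * Num.conj (A 0 s')) * X s s'.
Proof.
rewrite /Q mxE exchange_big /=; apply: eq_bigr => s' _.
by rewrite !mxE mulr_suml; apply: eq_bigr => s _; ring.
Qed.

Let QD X Y : Q (X + Y) = Q X + Q Y. Proof. by rewrite /Q mulmxDr mulmxDl mxE. Qed.
Let QZ a X : Q (a *: X) = a * Q X. Proof. by rewrite /Q -scalemxAr -scalemxAl mxE. Qed.
Let PsiE : Psi M j = \sum_p lam p *: Xmx M p.1 p.2 + s2 *: 1%:M.
Proof. by rewrite /Psi scalemx1 (pair_bigA _ (fun l k => (lambda M j l k)%:C *: Xmx M l k)). Qed.

Let cexpect_VV n W mu : mom P CH W -> chan_moment n W mu ->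
  E (fun w => V n w * Num.conj (V n w) * W w) =
  Q (\sum_p mu p *: Xmx M p.1 p.2 + (s2 * E W) *: 1%:M).
Proof.
move=> LW H; rewrite /V cexpect_quad//; last exact: mom_all LW.
rewrite QE; apply: eq_bigr => s _; apply: eq_bigr => s' _; congr (_ * _).
rewrite (cexpect_yy s s' LW H) !mxE summxE; congr (_ + _); last by case: eqP; rewrite ?mulr1 ?mulr0.
by apply: eq_bigr => p _; rewrite [RHS]mxE.
Qed.

Lemma cexpect_V2 n : E (fun w => V n w * Num.conj (V n w)) = Q (Psi M j).
Proof.
rewrite PsiE; have := cexpect_VV (mom_cst P 1 mCH) (chan_moment1 n).
rewrite cexpect_cst mulr1 => <-; by apply: eq_cexpect => w; rewrite mulr1.
Qed.

(** The products [lam p * lam m], with the noise weighted by the mean gain [lam m], rebuild [lam m]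
    times [Psi]; the correction at [p = m] leaves the term in [Xmx]. *)
Lemma cexpect_V2c2 n m : E (fun w => V n w * Num.conj (V n w) * (c m n w * Num.conj (c m n w))) =
  lam m * Q (Psi M j) + lam m ^+ 2 * Q (Xmx M m.1 m.2).
Proof.
rewrite (cexpect_VV _ (chan_moment2 n m)); last by apply: momM => //; exact: momJ.
rewrite cc_E -!QZ -QD PsiE; congr Q.
rewrite scalerDr scalerA [lam m * s2]mulrC addrAC; congr (_ + _).
under eq_bigr do rewrite scalerDl.
rewrite big_split /=; congr (_ + _).
  by rewrite scaler_sumr; apply: eq_bigr => p _; rewrite scalerA [lam p * _]mulrC.
rewrite (bigD1 m)//= eqxx mulr1n big1 ?addr0// => p pm.
by rewrite (negbTE pm) mulr0n scale0r.
Qed.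

Lemma Psi_pos (n : 'I_N) : s2 * Q 1%:M <= Q (Psi M j).
Proof.
have L1 : mom P CH (fun _ => 1) by exact: mom_cst.
rewrite -subr_ge0.
(* Beside the receiver noise there remain the squared combination of the signals [z] and the
   distortion variances. *)
have -> : Q (Psi M j) - s2 * Q 1%:M =
   E (fun w => (\sum_s A 0 s * z n s w) * Num.conj (\sum_s A 0 s * z n s w) * 1) +
   \sum_s (A 0 s * Num.conj (A 0 s)) * E (fun w => (distortion_var P M j n s.+1 w)%:C * 1).
  rewrite -(cexpect_V2 n) (_ : E _ = E (fun w => V n w * Num.conj (V n w) * 1)); last first.
    by apply: eq_cexpect => w; rewrite mulr1.
  rewrite /V cexpect_quad//; last exact: mom_cst.
  rewrite cexpect_quad//; last exact: mom_cst.
  rewrite QE mulr_sumr -sumrB -big_split /=; apply: eq_bigr => s _.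
  rewrite mulr_sumr -sumrB.
  rewrite [X in _ = _ + X](_ : _ = \sum_s' (if s == s' then (A 0 s * Num.conj (A 0 s')) *
     E (fun w => (distortion_var P M j n s.+1 w)%:C * 1) else 0)); last first.
    by rewrite (bigD1 s)//= eqxx big1 ?addr0// => s' ss'; rewrite eq_sym (negbTE ss').
  rewrite -big_split /=; apply: eq_bigr => s' _.
  rewrite y_to_q// q_to_z// cexpect_cst mxE; case: eqVneq => [<-|_]; rewrite ?mulr1n ?mulr0n; ring.
rewrite addr_ge0//.
  by apply: cexpect_ge0 => w; rewrite mulr1 -normCK exprn_ge0.
apply: sumr_ge0 => s _; rewrite mulr_ge0//; first by rewrite -normCK exprn_ge0.
by apply: cexpect_ge0 => w; rewrite mulr1 lecR distortion_var_ge0.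
Qed.

(** * Correlation of the combiner with channel and distortion at a data time *)

Section Data.
Variable t : 'I_T.
Hypothesis Bt : (B <= t)%N.

Let g (m : I) (n : 'I_N) (w : Omega) : R[i] := ph n t.+1 w * c m n w.
Let tmt (s : 'I_B) : tm s == t = false.
Proof. by apply/negbTE; rewrite neq_ltn (leq_trans (ltn_ord s) Bt). Qed.
Let momt n : mom P PH (ph n t.+1). Proof. by apply: momph; rewrite /= ltn_ord. Qed.
Let U_g (n : 'I_N) (t' : 'I_T) m (n' : 'I_N) : mom P (GU n t') (g m n').
Proof. by apply: momM; [exact/U_PH/momt|exact: U_CH]. Qed.
Let N_g (n : 'I_N) (t' : 'I_T) m (n' : 'I_N) : mom P (GN n t') (g m n').
Proof. by apply: momM; [exact/N_PH/momt|exact: N_CH]. Qed.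
Let momg m n : mom P measurable (g m n). Proof. exact: mom_all (U_g n t m n). Qed.

Let rm_ups n s X : mom P (GU n (tm s)) X -> E (fun w => y n s w * X w) = E (fun w => q n s w * X w).
Proof. by move=> LX; rewrite -(cexpect_addl0 (ce_ups n (tm s)) LX (momq n s)). Qed.

Let rm_upsJ n s X : mom P (GU n (tm s)) X ->
  E (fun w => Num.conj (y n s w) * X w) = E (fun w => Num.conj (q n s w) * X w).
Proof.
move=> LX; rewrite -(cexpect_addl0 (ce_upsJ n (tm s)) LX (momJ (momq n s))).
by apply: eq_cexpect => w; rewrite /y rmorphD.
Qed.

Let rm_eta n s X : mom P (GN n (tm s)) X -> E (fun w => q n s w * X w) = E (fun w => z n s w * X w).
Proof. by move=> LX; rewrite -(cexpect_addl0 (ce_eta n (tm s)) LX (momz n s)). Qed.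

Let rm_etaJ n s X : mom P (GN n (tm s)) X ->
  E (fun w => Num.conj (q n s w) * X w) = E (fun w => Num.conj (z n s w) * X w).
Proof.
move=> LX; rewrite -(cexpect_addl0 (ce_etaJ n (tm s)) LX (momJ (momz n s))).
by apply: eq_cexpect => w; rewrite /q rmorphD.
Qed.

Let st (s : 'I_B) : (1 <= s.+1 <= t.+1)%N. Proof. by rewrite /= ltnS (leq_trans _ Bt)// ltnW. Qed.

Let rr (s : 'I_B) : R[i] := rho (t.+1 - s.+1)%:R.

(** Of the users superposed in a pilot sample only [m] correlates with its own channel; the phase
    drift from channel use [s.+1] to [t.+1] contributes [rr s]. *)
Lemma cexpect_yg n s m : E (fun w => Num.conj (y n s w) * g m n w) = rr s * (lam m * Num.conj (x m s)).
Proof.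
have Lu := momu n s; have Lc := momc m n.
rewrite rm_upsJ// rm_etaJ//.
have -> : lam m * Num.conj (x m s) = E (fun w => Num.conj (u n s w) * c m n w).
  have Lt (p : I) : mom P measurable (fun w => c m n w * Num.conj (c p n w) * 1).
    by apply: momM; [apply: momM => //; exact: momJ|exact: mom_cst].
  transitivity (E (fun w => \sum_p Num.conj (x p s) * (c m n w * Num.conj (c p n w) * 1))).
    rewrite cexpect_sum => [|p _]; last by apply: momM => //; exact: mom_cst.
    rewrite (bigD1 m)//= big1 ?addr0; first by rewrite cexpectZ// chan_moment1 eqxx mulrC.
    by move=> p pm; rewrite cexpectZ// chan_moment1 eq_sym (negbTE pm) mulr0.
  apply: eq_cexpect => w; rewrite /u rmorph_sum /= mulr_suml; apply: eq_bigr => p _.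
  by rewrite rmorphM /=; ring.
rewrite -(phase_corr (n := n) (st s) (ltn_ord t)); last by apply: P_CH; [case/andP: (pilot_time s)|exact: momM (momJ Lu) Lc].
by apply: eq_cexpect => w; rewrite /z /g rmorphM /=; ring.
Qed.

(** Each variable is averaged while the factors at the other antenna are known, in the order
    distortion, noise, phases. The two drifts give separate factors, and [chan_cross] keeps only
    [p = p' = m]. *)
Lemma cexpect_ygyg n n' s s' m : n != n' ->
  E (fun w => Num.conj (y n s w) * g m n w * (y n' s' w * Num.conj (g m n' w))) =
  rr s * rr s' * (lam m ^+ 2 * (Num.conj (x m s) * x m s')).
Proof.
move=> nn; have n'n : n' != n by rewrite eq_sym.
have [nt nt'] : (n', tm s') != (n, tm s) /\ (n, tm s) != (n', tm s').
  by rewrite !xpair_eqE (negbTE nn) (negbTE n'n).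
have [_ sT] := andP (pilot_time s); have [_ sT'] := andP (pilot_time s').
have Lz1 := U_z n' (tm s') n s; have Lz2 := N_z n' (tm s') n s.
transitivity (E (fun w => y n' s' w * (Num.conj (y n s w) * g m n w * Num.conj (g m n' w)))).
  by apply: eq_cexpect => w; ring.
have LL X1 X2 X3 G : mom P G X1 -> mom P G X2 -> mom P G X3 ->
    mom P G (fun w => Num.conj (X1 w) * X2 w * Num.conj (X3 w)).
  by move=> ? ? ?; apply: momM (momJ _) => //; exact: momM (momJ _) _.
have LL' X1 X2 X3 G : mom P G X1 -> mom P G X2 -> mom P G X3 ->
    mom P G (fun w => X1 w * Num.conj (X2 w) * X3 w).
  by move=> ? ? ?; apply: momM => //; exact: momM _ (momJ _).
rewrite rm_ups; last by apply: LL => //; exact: U_y.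
transitivity (E (fun w => Num.conj (y n s w) * (g m n w * Num.conj (g m n' w) * q n' s' w))).
  by apply: eq_cexpect => w; ring.
rewrite rm_upsJ; last by apply: LL' => //; exact: U_q.
rewrite rm_etaJ; last by apply: LL' => //; exact: N_q.
transitivity (E (fun w => q n' s' w * (Num.conj (z n s w) * g m n w * Num.conj (g m n' w)))).
  by apply: eq_cexpect => w; ring.
rewrite rm_eta; last by apply: LL.
pose D n s w := ph n t.+1 w * Num.conj (ph n (s : 'I_B).+1 w).
pose C w := Num.conj (u n s w) * c m n w * (u n' s' w * Num.conj (c m n' w)).
have LC : mom P CH C.
  by apply: momM; apply: momM; [exact: momJ|exact: momc|exact: momu|exact/momJ/momc].
have Pp n1 n2 s1 k : n2 != n1 -> (s1 <= T)%N -> (1 <= k <= T)%N -> mom P (GP n1 s1) (ph n2 k).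
  by move=> ne hs hk; exact: (mom_phase_past hM).
have tT1 : (1 <= t.+1 <= T)%N by rewrite /= ltn_ord.
transitivity (E (fun w => C w * Num.conj (D n' s' w) * D n s w)).
  by apply: eq_cexpect => w; rewrite /z /g /C /D !rmorphM /= conjCK; ring.
rewrite (phase_corr (st s) (ltn_ord t)); last first.
  apply: momM; first exact: P_CH.
  by apply: momJ; apply: momM; [|apply: momJ]; exact: Pp.
rewrite -mulrA; congr (_ * _).
(* The rotation at antenna [n'] appears conjugated; its conditional mean is unchanged because [rho]
   is real. *)
have := condEJ (condE_phase hM j n' (st s') (ltn_ord t)) => ce.
have ce' : condE P (GP n' s'.+1) (fun w => Num.conj (D n' s' w)) (fun _ => rr s').
  by move: ce; congr condE; apply/funext => w; exact: rhoJ.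
rewrite (condE_const ce'); last exact: P_CH.
congr (_ * _).
have Lcc p p' : mom P measurable (fun w => Num.conj (c p n w) * c m n w * (c p' n' w * Num.conj (c m n' w))).
  by apply: momM; apply: momM => //; exact: momJ.
transitivity (E (fun w => \sum_p \sum_p' (Num.conj (x p s) * x p' s') *
    (Num.conj (c p n w) * c m n w * (c p' n' w * Num.conj (c m n' w))))).
  apply: eq_cexpect => w; rewrite /C /u rmorph_sum /= !mulr_suml; apply: eq_bigr => p _.
  rewrite mulr_sumr; apply: eq_bigr => p' _; rewrite rmorphM /=; ring.
rewrite cexpect_sum => [|p _]; last by apply: mom_sum => // p' _; apply: momM => //; exact: mom_cst.
rewrite (bigD1 m)//= [X in _ + X]big1 ?addr0 => [|p pm]; last first.
  rewrite cexpect_sum => [|p' _]; last by apply: momM => //; exact: mom_cst.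
  by rewrite big1// => p' _; rewrite cexpectZ// chan_cross// (negbTE pm) mulr0.
rewrite cexpect_sum => [|p' _]; last by apply: momM => //; exact: mom_cst.
rewrite (bigD1 m)//= big1 ?addr0 => [|p' pm]; last first.
  by rewrite cexpectZ// chan_cross// (negbTE pm) andbF mulr0.
by rewrite cexpectZ// chan_cross// eqxx mulrC.
Qed.

Let b (m : I) : R[i] := (A *m Ddelta M t.+1 *m pilot M m.1 m.2) 0 0.

Let bE m : b m = \sum_s A 0 s * (rr s * x m s).
Proof.
rewrite /b mxE; apply: eq_bigr => s _.
rewrite mxE (bigD1 s)//= [X in _ + X]big1 ?addr0 => [|s' ss']; last first.
  by rewrite /Ddelta !mxE (negbTE ss') mulr0n mulr0.
rewrite /Ddelta !mxE eqxx mulr1n -mulrA; congr (_ * (_ * _)).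
by rewrite /rr /rho natrB// ltnS (leq_trans _ Bt)// ltnW.
Qed.

(** A data time is no pilot time, so the combiner involves no sample [ups n t] and is known when one
    of them is averaged. *)
Let U_V (n n' : 'I_N) : mom P (GU n t) (V n').
Proof.
apply: mom_sum => // s _; apply: momM; first exact: mom_cst.
by apply: U_y; rewrite xpair_eqE tmt andbF.
Qed.

Lemma cexpect_Vg n m : E (fun w => Num.conj (V n w) * g m n w) = lam m * Num.conj (b m).
Proof.
have Ls s : mom P measurable (fun w => Num.conj (y n s w) * g m n w) by apply: momM => //; exact: momJ.
transitivity (E (fun w => \sum_s Num.conj (A 0 s) * (Num.conj (y n s w) * g m n w))).
  apply: eq_cexpect => w; rewrite /V rmorph_sum /= mulr_suml; apply: eq_bigr => s _.
  by rewrite rmorphM /= mulrA.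
rewrite cexpect_sum => [|s _]; last by apply: momM => //; exact: mom_cst.
rewrite bE rmorph_sum mulr_sumr; apply: eq_bigr => s _.
by rewrite cexpectZ// cexpect_yg !rmorphM /= rhoJ; ring.
Qed.

Lemma cexpect_VgVg n n' m : n != n' ->
  E (fun w => Num.conj (V n w) * g m n w * (V n' w * Num.conj (g m n' w))) =
  lam m ^+ 2 * (Num.conj (b m) * b m).
Proof.
move=> nn.
have Ls s s' : mom P measurable (fun w => Num.conj (y n s w) * g m n w * (y n' s' w * Num.conj (g m n' w))).
  by apply: momM; apply: momM => //; exact: momJ.
transitivity (E (fun w => \sum_s \sum_s' (Num.conj (A 0 s) * A 0 s') *
    (Num.conj (y n s w) * g m n w * (y n' s' w * Num.conj (g m n' w))))).
  apply: eq_cexpect => w; rewrite /V rmorph_sum /= !mulr_suml; apply: eq_bigr => s _.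
  rewrite mulr_sumr; apply: eq_bigr => s' _; rewrite rmorphM /=; ring.
rewrite cexpect_sum => [|s _]; last by apply: mom_sum => // s' _; apply: momM => //; exact: mom_cst.
rewrite bE rmorph_sum mulr_suml mulr_sumr; apply: eq_bigr => s _.
rewrite cexpect_sum => [|s' _]; last by apply: momM => //; exact: mom_cst.
rewrite !mulr_sumr; apply: eq_bigr => s' _.
by rewrite cexpectZ// cexpect_ygyg// !rmorphM /= rhoJ; ring.
Qed.

Lemma cexpect_norm : E (fun w => \sum_n V n w * Num.conj (V n w)) = N%:R * Q (Psi M j).
Proof.
rewrite cexpect_sum => [|n _]; last by apply: momM => //; exact: momJ.
under eq_bigr do rewrite cexpect_V2.
by rewrite sumr_const card_ord mulr_natl.
Qed.

Lemma cexpect_inner m : E (fun w => \sum_n Num.conj (V n w) * g m n w) = N%:R * (lam m * Num.conj (b m)).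
Proof.
rewrite cexpect_sum => [|n _]; last by apply: momM => //; exact: momJ.
under eq_bigr do rewrite cexpect_Vg.
by rewrite sumr_const card_ord mulr_natl.
Qed.

(** Common to effective channel and distortion, which play [h]: there are [N] diagonal terms [al]
    and [N (N - 1)] cross terms [be], with [be = 0] for the distortion. *)
Let cexpect_sqr_sum (h : 'I_N -> Omega -> R[i]) (al be : R[i]) :
  (forall n, mom P measurable (h n)) ->
  (forall n, E (fun w => V n w * Num.conj (V n w) * (h n w * Num.conj (h n w))) = al) ->
  (forall n n', n != n' -> E (fun w => Num.conj (V n w) * h n w * (V n' w * Num.conj (h n' w))) = be) ->
  E (fun w => (\sum_n Num.conj (V n w) * h n w) * Num.conj (\sum_n Num.conj (V n w) * h n w)) =
  N%:R * al + N%:R * (N%:R - 1) * be.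
Proof.
move=> Lh Hal Hbe; have LG n : mom P measurable (fun w => Num.conj (V n w) * h n w).
  by apply: momM => //; exact: momJ.
transitivity (E (fun w => (\sum_n 1 * (Num.conj (V n w) * h n w)) *
    Num.conj (\sum_n 1 * (Num.conj (V n w) * h n w)) * 1)).
  by apply: eq_cexpect => w; rewrite mulr1; under eq_bigr do rewrite -[_ * h _ _]mul1r.
rewrite (cexpect_quad (fun _ : 'I_N => 1) LG); last exact: mom_cst.
transitivity (\sum_(n < N) \sum_(n' < N) (be + (al - be) *+ (n' == n))).
  apply: eq_bigr => n _; apply: eq_bigr => n' _; rewrite rmorph1 !mul1r.
  have [->|nn] := eqVneq n' n.
    rewrite mulr1n addrC subrK -(Hal n); apply: eq_cexpect => w; rewrite rmorphM /= conjCK; ring.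
  rewrite mulr0n addr0 -(Hbe n n'); last by rewrite eq_sym.
  by apply: eq_cexpect => w; rewrite rmorphM /= conjCK; ring.
transitivity (\sum_(n < N) (be *+ N + (al - be))).
  apply: eq_bigr => n _; rewrite big_split /= sumr_const card_ord; congr (_ + _).
  by rewrite (bigD1 n)//= eqxx mulr1n big1 ?addr0// => n' nn; rewrite (negbTE nn) mulr0n.
rewrite sumr_const card_ord -[LHS]mulr_natl -[be *+ N]mulr_natl.
move: (N%:R : R[i]) => nn; ring.
Qed.

Lemma cexpect_inner2 m :
  E (fun w => (\sum_n Num.conj (V n w) * g m n w) * Num.conj (\sum_n Num.conj (V n w) * g m n w)) =
  N%:R * (lam m * Q (Psi M j) + lam m ^+ 2 * Q (Xmx M m.1 m.2)) +
  N%:R * (N%:R - 1) * (lam m ^+ 2 * (Num.conj (b m) * b m)).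
Proof.
apply: cexpect_sqr_sum => // [n|n n']; last exact: cexpect_VgVg.
(* The phase at the data time has modulus 1, so [|g|^2 = |c|^2] at a single antenna. *)
rewrite -(cexpect_V2c2 n); apply: eq_cexpect => w; congr (_ * _).
by rewrite /g rmorphM /= mulrACA cis_conj mul1r.
Qed.

(** The conditional variance of a sample is [kappa^2] times a weighted sum of squared gains, to each
    of which [cexpect_V2c2] applies. Cross terms vanish because a sample is centred given the
    combiner and the samples at the other antennas. *)
Lemma cexpect_inner_distortion :
  E (fun w => (\sum_n Num.conj (V n w) * ups n t w) * Num.conj (\sum_n Num.conj (V n w) * ups n t w)) =
  k2 * \sum_p mean_power P M p.1 p.2 t.+1 *
    (N%:R * (lam p * Q (Psi M j) + lam p ^+ 2 * Q (Xmx M p.1 p.2))).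
Proof.
rewrite (cexpect_sqr_sum (al := k2 * \sum_p mean_power P M p.1 p.2 t.+1 *
    (lam p * Q (Psi M j) + lam p ^+ 2 * Q (Xmx M p.1 p.2))) (be := 0)).
- rewrite mulr0 addr0 [LHS]mulrCA; congr (_ * _); rewrite mulr_sumr; apply: eq_bigr => p _; ring.
- by move=> n; exact: momups.
- move=> n; have [_ _ ce _] := condE_distortion hM j n t.
  have LVV : mom P (GU n t) (fun w => V n w * Num.conj (V n w)) by apply: momM => //; exact: momJ.
  rewrite (condE_expect ce LVV).
  have Lp p : mom P measurable (fun w => V n w * Num.conj (V n w) * (c p n w * Num.conj (c p n w))).
    by apply: momM; apply: momM => //; exact: momJ.
  transitivity (E (fun w => k2 * \sum_p mean_power P M p.1 p.2 t.+1 *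
     (V n w * Num.conj (V n w) * (c p n w * Num.conj (c p n w))))).
    apply: eq_cexpect => w; rewrite distortion_varE// mulrCA; congr (_ * _).
    rewrite (pair_bigA _ (fun l k => mean_power P M l k t.+1 * (chan M (j, l, k) n w * Num.conj (chan M (j, l, k) n w)))) /=.
    by rewrite mulr_sumr; apply: eq_bigr => p _; rewrite mulrCA.
  have Lm p : mom P measurable (fun w => mean_power P M p.1 p.2 t.+1 *
      (V n w * Num.conj (V n w) * (c p n w * Num.conj (c p n w)))).
    by apply: momM => //; exact: mom_cst.
  rewrite cexpectZ; last exact: mom_sum.
  rewrite cexpect_sum//; congr (_ * _); apply: eq_bigr => p _.
  by rewrite cexpectZ// cexpect_V2c2.
- move=> n n' nn; rewrite -[RHS](condE_vanish (ce_ups n t) (momM (momM (momJ (U_V n n)) (U_V n n'))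
    (momJ (U_ups (n := n) (t := t) (n' := n') (t' := t) _)))).
    by apply: eq_cexpect => w; ring.
  by rewrite xpair_eqE eq_sym (negbTE nn).
Qed.

Variable v : Omega -> 'cV[R[i]]_N.
Hypothesis vE : forall w n, v w n 0 = \sum_s A 0 s * received M j s.+1 w n 0.

Let v_V w n : v w n 0 = V n w.
Proof. by rewrite vE; apply: eq_bigr => s _; rewrite receivedE. Qed.

Let innerE w (h : 'cV[R[i]]_N) : inner (v w) h = \sum_n Num.conj (V n w) * h n 0.
Proof. by rewrite /inner mxE; apply: eq_bigr => n _; rewrite !mxE v_V. Qed.

Let effE l m w n : eff_channel M j l m t.+1 w n 0 = g (l, m) n w.
Proof.
rewrite /eff_channel mxE (bigD1 n)//= big1 ?addr0 => [|i ni]; first by rewrite /phase_mx !mxE eqxx mulr1n.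
by rewrite /phase_mx !mxE eq_sym (negbTE ni) mulr0n mul0r.
Qed.

Let momVh (h : 'I_N -> Omega -> R[i]) : (forall n, mom P measurable (h n)) ->
  mom P measurable (fun w => \sum_n Num.conj (V n w) * h n w).
Proof. by move=> Lh; apply: mom_sum => // n _; apply: momM => //; exact: momJ. Qed.

Lemma has_cexpect_norm2sq :
  has_cexpect P (fun w => norm2sq (v w)) (N%:R * (A *m Psi M j *m A^t*) 0 0).
Proof.
have -> : (fun w => norm2sq (v w)) = (fun w => \sum_n V n w * Num.conj (V n w)).
  by apply/funext => w; apply: eq_bigr => n _; rewrite normCK v_V.
apply: has_cexpect_mom; last exact: cexpect_norm.
by apply: mom_sum => // n _; apply: momM => //; exact: momJ.
Qed.

Lemma has_cexpect_inner l m :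
  has_cexpect P (fun w => inner (v w) (eff_channel M j l m t.+1 w))
    (N%:R * ((lambda M j l m)%:C * Num.conj ((A *m Ddelta M t.+1 *m pilot M l m) 0 0))).
Proof.
have -> : (fun w => inner (v w) (eff_channel M j l m t.+1 w)) =
    (fun w => \sum_n Num.conj (V n w) * g (l, m) n w).
  by apply/funext => w; rewrite innerE; apply: eq_bigr => n _; rewrite effE.
by apply: has_cexpect_mom; [exact: momVh|exact: (cexpect_inner (l, m))].
Qed.

Lemma has_cexpect_inner2 l m :
  has_cexpect P (fun w => `|inner (v w) (eff_channel M j l m t.+1 w)| ^+ 2)
    (N%:R * ((lambda M j l m)%:C * (A *m Psi M j *m A^t*) 0 0 +
       (lambda M j l m)%:C ^+ 2 * (A *m Xmx M l m *m A^t*) 0 0) +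
     N%:R * (N%:R - 1) * ((lambda M j l m)%:C ^+ 2 * `|(A *m Ddelta M t.+1 *m pilot M l m) 0 0| ^+ 2)).
Proof.
have -> : (fun w => `|inner (v w) (eff_channel M j l m t.+1 w)| ^+ 2) =
    (fun w => (\sum_n Num.conj (V n w) * g (l, m) n w) * Num.conj (\sum_n Num.conj (V n w) * g (l, m) n w)).
  by apply/funext => w; rewrite normCK innerE; under eq_bigr do rewrite effE.
rewrite normCK [_ * Num.conj _]mulrC.
apply: has_cexpect_mom; last exact: (cexpect_inner2 (l, m)).
by apply: momM; [|apply: momJ]; exact: momVh.
Qed.

Lemma has_cexpect_inner_distortion :
  has_cexpect P (fun w => `|inner (v w) (distortion M j t.+1 w)| ^+ 2)
    ((kappa M ^+ 2)%:C * \sum_p (power M p.1 p.2)%:C *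
      (N%:R * ((lambda M j p.1 p.2)%:C * (A *m Psi M j *m A^t*) 0 0 +
       (lambda M j p.1 p.2)%:C ^+ 2 * (A *m Xmx M p.1 p.2 *m A^t*) 0 0))).
Proof.
have -> : (fun w => `|inner (v w) (distortion M j t.+1 w)| ^+ 2) =
    (fun w => (\sum_n Num.conj (V n w) * ups n t w) * Num.conj (\sum_n Num.conj (V n w) * ups n t w)).
  by apply/funext => w; rewrite normCK innerE.
apply: has_cexpect_mom.
  by apply: momM; [|apply: momJ]; apply: momVh => n; exact: momups.
rewrite cexpect_inner_distortion; congr (_ * _); apply: eq_bigr => p _; congr (_ * _).
have Bt' : (B < t.+1 <= T)%N by rewrite ltnS Bt ltn_ord.
by have [_ <-] := um_data_power hM p.1 p.2 Bt'.
Qed.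

End Data.
End Computation.

(** * Maximum ratio combining *)

Section Assembly.
Context (R : realType) (d : measure_display) (Omega : measurableType d).
Context (P : probability Omega R) (L K N B T : nat) (M : uplink R Omega L K N B).
Hypothesis hM : uplink_model P M T.
Variable (j : 'I_L).

Let conjR (a : R) : Num.conj a%:C = a%:C :> R[i]. Proof. exact: conjc_real. Qed.

Lemma XmxH l m : (Xmx M l m)^t* = Xmx M l m.
Proof.
apply/matrixP => s s'; rewrite !mxE eq_sym; case: eqVneq => [->|_].
  by rewrite rmorphM /= conjR normCK rmorphM /= conjCK [_ * pilot _ _ _ _ _]mulrC.
by rewrite !rmorphM /= conjR conjCK distrC [_ * pilot _ _ _ _ _]mulrC.
Qed.

Lemma PsiH : (Psi M j)^t* = Psi M j.
Proof.
have conjD (X Y : 'M[R[i]]_B) : (X + Y)^t* = X^t* + Y^t* by rewrite linearD map_mxD.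
have conjZ (a : R) (X : 'M[R[i]]_B) : (a%:C *: X)^t* = a%:C *: X^t*.
  by rewrite linearZ /= map_mxZ; congr (_ *: _); exact: conjR.
have conj_sum n (F : 'I_n -> 'M[R[i]]_B) : (\sum_i F i)^t* = \sum_i (F i)^t*.
  by rewrite linear_sum map_mx_sum.
rewrite /Psi conjD conj_sum; congr (_ + _); last first.
  by rewrite tr_scalar_mx map_scalar_mx; congr (_%:M); exact: conjR.
apply: eq_bigr => l _; rewrite conj_sum; apply: eq_bigr => m _.
by rewrite conjZ XmxH.
Qed.

Lemma DdeltaH t : (Ddelta M t)^t* = Ddelta M t.
Proof.
rewrite /Ddelta tr_diag_mx map_diag_mx; congr diag_mx.
by apply/rowP => s; rewrite !mxE; exact: conjR.
Qed.

Lemma Psi_unitmx : Psi M j \in unitmx.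
Proof.
rewrite -row_free_unit -kermx_eq0; apply/eqP/row_matrixP => i; rewrite row0.
set A := row i _; have A0 : A *m Psi M j = 0 by rewrite /A -row_mul mulmx_ker row0.
(* [N >= 1] provides the antenna; for a row [A] in the kernel of [Psi] the inequality bounds a
   positive multiple of [|A|^2] by 0. *)
have := Psi_pos hM j A (Ordinal (um_N hM)); rewrite A0 mul0mx mulmx1 [leRHS]mxE => h.
have s0 : 0 < (sigma M ^+ 2 * xi M)%:C.
  by rewrite ltcR mulr_gt0 ?(um_sigma hM)// (lt_le_trans ltr01)// (um_xi hM).
move: h; rewrite pmulr_rle0// => h.
have AE : (A *m A^t*) 0 0 = \sum_s `|A 0 s| ^+ 2.
  by rewrite mxE; apply: eq_bigr => s _; rewrite !mxE normCK.
have S0 : \sum_s `|A 0 s| ^+ 2 = 0.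
  apply/eqP; rewrite eq_le -{1}AE h /=; apply: sumr_ge0 => s _; exact: exprn_ge0.
apply/rowP => s; rewrite [RHS]mxE; apply/eqP; rewrite -normr_eq0 -sqrf_eq0; apply/eqP.
by move/psumr_eq0P: S0; apply => // s' _; exact: exprn_ge0.
Qed.

(** The Kronecker factor [1%:M] makes every antenna apply the same row to its own [B] samples. *)
Lemma mrcE k t w n : mrc M j k t w n 0 =
  \sum_s ((lambda M j j k)%:C *: ((pilot M j k)^t* *m Ddelta M t *m invmx (Psi M j))) 0 s *
    received M j s.+1 w n 0.
Proof.
rewrite /mrc /channel_est; set A := _ *: _; rewrite castmxE mxE; clearbody A.
have -> : cast_ord (esym (mul1n N, erefl 1%N).1) n = mxtens_index (0 : 'I_1, n).
  by apply/val_inj; rewrite /= mul0n.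
rewrite (reindex (@mxtens_index B N)); last first.
  by exists (@mxtens_unindex B N) => q _; rewrite (mxtens_indexK, mxtens_unindexK).
pose F (p : 'I_B * 'I_N) := A 0 p.1 * (1%:M : 'M[R[i]]_N) n p.2 * received M j p.1.+1 w p.2 0.
transitivity (\sum_p F p).
  apply: eq_bigr => -[s n'] _; rewrite tensmxE /F; congr (_ * _).
  by rewrite /psi mxE mxtens_indexK.
rewrite -(pair_bigA _ (fun s n' => F (s, n'))) /= /F.
apply: eq_bigr => s _; rewrite (bigD1 n)//= big1 ?addr0 => [|n' nn]; first by rewrite mxE eqxx mulr1.
by rewrite mxE eq_sym (negbTE nn) mulr0 mul0r.
Qed.

End Assembly.

Theorem theorem2 (R : realType) (d : measure_display) (Omega : measurableType d)
    (P : probability Omega R) (L K N B T : nat) (M : uplink R Omega L K N B)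
    (hM : uplink_model P M T) (t : nat) (ht : (B + 1 <= t <= T)%N)
    (j : 'I_L) (k : 'I_K) :
  let v := mrc M j k t in
  let x l m := pilot M l m in
  let D := Ddelta M t in
  let Psi_inv := invmx (Psi M j) in
  let lam l m := (lambda M j l m)%:C in
  let p l m := (power M l m)%:C in
  let Ev2 := cexpect P (fun w => norm2sq (v w)) in
  [/\ has_cexpect P (fun w => norm2sq (v w))
        (N%:R * lam j k ^+ 2 *
         ((x j k)^t* *m D *m Psi_inv *m D^t* *m x j k) 0 0),
      has_cexpect P (fun w => inner (v w) (eff_channel M j j k t w)) Ev2,
      (forall (l : 'I_L) (m : 'I_K),
         has_cexpect P (fun w => `|inner (v w) (eff_channel M j l m t w)| ^+ 2)
           (lam l m * Ev2
            + N%:R * lam j k ^+ 2 * lam l m ^+ 2 *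
              ((x j k)^t* *m D *m Psi_inv *m Xmx M l m *m Psi_inv *m D^t* *m x j k) 0 0
            + N%:R * (N%:R - 1) * lam j k ^+ 2 * lam l m ^+ 2 *
              `|((x j k)^t* *m D *m Psi_inv *m D^t* *m x l m) 0 0| ^+ 2)) &
      has_cexpect P (fun w => `|inner (v w) (distortion M j t w)| ^+ 2)
        ((kappa M ^+ 2)%:C *
           (\sum_(l < L) \sum_(m < K) p l m * lam l m * Ev2)
         + (kappa M ^+ 2)%:C *
           (\sum_(l < L) \sum_(m < K) p l m * N%:R * lam j k ^+ 2 * lam l m ^+ 2 *
              ((x j k)^t* *m D *m Psi_inv *m Xmx M l m *m Psi_inv *m D^t* *m x j k) 0 0))].
Proof.
move=> v x D Psi_inv lam p Ev2.
(* Channel uses start at 1 and ordinals of ['I_T] at 0: the ordinal [t] stands for channel use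
   [t.+1], and [B <= t] says that it is a data time. *)
case: t => [|t] in ht v D Ev2 *; first by rewrite addn1 in ht.
move: ht; rewrite addn1 ltnS => /andP[Bt tT].
pose A := lam j k *: ((x j k)^t* *m D *m Psi_inv).
have vE w n : v w n 0 = \sum_s A 0 s * received M j s.+1 w n 0 by exact: mrcE.
have DH : D^t* = D := DdeltaH M t.+1.
have PiH : Psi_inv^t* = Psi_inv by rewrite /Psi_inv trmx_inv map_invmx PsiH.
have lamJ : Num.conj (lam j k) = lam j k by exact: conjc_real.
have mulH m n q (X : 'M[R[i]]_(m, n)) (Y : 'M[R[i]]_(n, q)) : (X *m Y)^t* = Y^t* *m (X^t*).
  by rewrite trmx_mul map_mxM.
have HK m n (X : 'M[R[i]]_(m, n)) : X^t*^t* = X by apply/matrixP => a b; rewrite !mxE conjCK.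
have AH : A^t* = lam j k *: (Psi_inv *m D^t* *m x j k).
  by rewrite /A linearZ /= map_mxZ mulH mulH PiH HK !mulmxA; congr (_ *: _); exact: lamJ.
have QE X : (A *m X *m A^t*) 0 0 =
    lam j k ^+ 2 * ((x j k)^t* *m D *m Psi_inv *m X *m Psi_inv *m D^t* *m x j k) 0 0.
  by rewrite AH /A -scalemxAl -scalemxAl -scalemxAr scalerA -expr2 mxE !mulmxA.
pose q l m := ((x j k)^t* *m D *m Psi_inv *m D^t* *m x l m) 0 0.
pose r l m := ((x j k)^t* *m D *m Psi_inv *m Xmx M l m *m Psi_inv *m D^t* *m x j k) 0 0.
(* A Hermitian form is real. The second claim depends on it, since the correlation comes out with
   the conjugate of [b j k]. *)
have qJ : Num.conj (q j k) = q j k.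
  have -> : Num.conj (q j k) = ((x j k)^t* *m D *m Psi_inv *m D^t* *m x j k)^t* 0 0.
    by rewrite [RHS]mxE [X in _ = Num.conj X]mxE.
  by rewrite !mulH PiH !HK DH !mulmxA /q DH.
pose QPsi := (A *m Psi M j *m A^t*) 0 0.
pose QX l m := (A *m Xmx M l m *m A^t*) 0 0.
pose b l m := (A *m D *m pilot M l m) 0 0.
(* [Psi_inv] cancels against [Psi], which leaves the same [q j k] as in [b j k]: this is why the
   correlation equals the mean squared norm. *)
have QPsiE : QPsi = lam j k ^+ 2 * q j k.
  by rewrite /QPsi QE mulmxKV//; exact: (Psi_unitmx hM).
have QXE l m : QX l m = lam j k ^+ 2 * r l m by exact: QE.
have bE l m : b l m = lam j k * q l m by rewrite /b /q DH /A -!scalemxAl mxE.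
have lam_norm : `|lam j k| = lam j k by rewrite ger0_norm// lecR ltW// (um_lambda hM).
pose tt := Ordinal tT; have Btt : (B <= tt)%N by [].
have Hv2 : has_cexpect P (fun w => norm2sq (v w)) (N%:R * QPsi) :=
  has_cexpect_norm2sq hM vE.
have Hin l m : has_cexpect P (fun w => inner (v w) (eff_channel M j l m t.+1 w))
    (N%:R * (lam l m * Num.conj (b l m))) := has_cexpect_inner hM Btt vE l m.
have Hin2 l m : has_cexpect P (fun w => `|inner (v w) (eff_channel M j l m t.+1 w)| ^+ 2)
    (N%:R * (lam l m * QPsi + lam l m ^+ 2 * QX l m) +
     N%:R * (N%:R - 1) * (lam l m ^+ 2 * `|b l m| ^+ 2)) := has_cexpect_inner2 hM Btt vE l m.
have Hd : has_cexpect P (fun w => `|inner (v w) (distortion M j t.+1 w)| ^+ 2)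
    ((kappa M ^+ 2)%:C * \sum_(i : 'I_L * 'I_K) p i.1 i.2 *
      (N%:R * (lam i.1 i.2 * QPsi + lam i.1 i.2 ^+ 2 * QX i.1 i.2))) :=
  has_cexpect_inner_distortion hM Btt vE.
have Ev2E : Ev2 = N%:R * QPsi by have [] := Hv2.
clearbody QPsi QX b Ev2.
split.
- by rewrite -mulrA -/(q j k) -QPsiE.
- rewrite Ev2E QPsiE; have := Hin j k; rewrite bE rmorphM /= lamJ qJ; congr has_cexpect.
  by rewrite [lam j k * (_ * _)]mulrA expr2.
- move=> l m; have := Hin2 l m; congr has_cexpect.
  rewrite Ev2E -/(q l m) -/(r l m) QXE bE normrM exprMn lam_norm.
  move: (N%:R : R[i]) (lam l m) (lam j k) (r l m) (`|q l m| ^+ 2) => n a c r1 q2; ring.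
- have := Hd; congr has_cexpect; rewrite !pair_bigA /= -mulrDr -big_split /=; congr (_ * _).
  apply: eq_bigr => i _; rewrite Ev2E -/(r i.1 i.2) QXE.
  move: (N%:R : R[i]) (lam i.1 i.2) (lam j k) (r i.1 i.2) (p i.1 i.2) => n a c r1 p1; ring.
Qed.
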